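(* Let $N\geq 5$, $0<R\leq\infty$, and let $W_{2}$ be a smooth function on $(0,R)$. Then the following statements are equivalent: 1. There exists $c>0$ such that for all $u\in C_{0}^{\infty}(B_{R}\cap\mathbb{R}^{N}\setminus\{0\})$: $$\int_{B_{R}\cap\mathbb{R}^{N}}|\Delta u|^{2}\,dx\geq c\int_{B_{R}\cap\mathbb{R}^{N}}W_{2}(|x|)\,|\nabla u|^{2}\,dx.$$ 2. There exists $c>0$ such that for all radial functions $u\in C_{0}^{\infty}(B_{R}\cap\mathbb{R}^{N}\setminus\{0\})$: $$\int_{B_{R}\cap\mathbb{R}^{N}}|\Delta u|^{2}\,dx\geq c\int_{B_{R}\cap\mathbb{R}^{N}}W_{2}(|x|)\,|\nabla u|^{2}\,dx.$$ 3. There exists $c>0$ such that for all $u\in C_{0}^{\infty}(B_{R}\cap\mathbb{R}^{N+2}\setminus\{0\})$: $$\int_{B_{R}\cap\mathbb{R}^{N+2}}|\nabla u|^{2}\,dx\geq c\int_{B_{R}\cap\mathbb{R}^{N+2}}W_{2}(|x|)\,|u|^{2}\,dx.$$ 4. There exists $c>0$ such that for all radial functions $u\in C_{0}^{\infty}(B_{R}\cap\mathbb{R}^{N+2}\setminus\{0\})$: $$\int_{B_{R}\cap\mathbb{R}^{N+2}}|\nabla u|^{2}\,dx\geq c\int_{B_{R}\cap\mathbb{R}^{N+2}}W_{2}(|x|)\,|u|^{2}\,dx.$$ 5. $(1,cW_{2})$ is an $(N+2)$-dimensional Bessel pair on $(0,R)$ for some $c>0$.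
   Context: $B_R\cap\mathbb{R}^{m}$ denotes the open ball of radius $R$ centered at the origin in $\mathbb{R}^{m}$ (all of $\mathbb{R}^m$ if $R=\infty$). $C_0^\infty(\Omega)$ is the space of smooth functions with compact support in $\Omega$. For an integer $n\ge 1$, a pair $(V,W)$ of functions on $(0,R)$ (with $V\ge 0$ and $W$ of arbitrary sign) is an $n$-dimensional Bessel pair on $(0,R)$ if there exists a positive function $\varphi$ on $(0,R)$ such that $\left(r^{n-1}V\varphi'\right)'+r^{n-1}W\varphi=0$ on $(0,R)$. *)

(* Defs.v *)
From HB Require Import structures.
From mathcomp Require Import all_boot all_order all_algebra.
From mathcomp Require Import all_classical all_reals all_analysis.

Set Implicit Arguments.
Unset Strict Implicit.
Unset Printing Implicit Defensive.

Import Order.TTheory GRing.Theory Num.Theory.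
Import numFieldNormedType.Exports.

Local Open Scope classical_set_scope.
Local Open Scope ring_scope.

(* Points of R^n are the row vectors 'rV[R]_n.  The library provides Lebesgue
   measure on R and binary product measures only, so 'rV[R]_n gets the
   sigma-algebra generated by its coordinates (its Borel sets), and n-dimensional
   Lebesgue measure is the n-fold product of lebesgue_measure. *)

Definition measure_rV_display : measure_display. Proof. exact. Qed.

Section measurable_rV.
Variables (R : realType) (n : nat).

Definition rV_coord (i : 'I_n) (x : 'rV[R]_n) : measurableTypeR R := x ord0 i.

Let rV_set0 : g_sigma_preimage rV_coord set0.
Proof. exact: sigma_algebra0. Qed.

Let rV_setC A : g_sigma_preimage rV_coord A -> g_sigma_preimage rV_coord (~` A).
Proof. exact: sigma_algebraC. Qed.

Let rV_bigcup (F : (set 'rV[R]_n)^nat) :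
  (forall i, g_sigma_preimage rV_coord (F i)) ->
  g_sigma_preimage rV_coord (\bigcup_i (F i)).
Proof. exact: sigma_algebra_bigcup. Qed.

HB.instance Definition _ := @isMeasurable.Build measure_rV_display
  'rV[R]_n (g_sigma_preimage rV_coord) rV_set0 rV_setC rV_bigcup.

End measurable_rV.

Section lebesgue_measure_rV.
Variable R : realType.

Definition rV_cons n (p : measurableTypeR R * 'rV[R]_n) : 'rV[R]_(1 + n) :=
  row_mx (\row_(_ < 1) (p.1 : R)) p.2.

Lemma measurable_rV_coord n (i : 'I_n) :
  measurable_fun [set: 'rV[R]_n] (@rV_coord R n i).
Proof.
move=> _ Y mY; rewrite setTI; apply: sub_sigma_algebra => /=.
rewrite -bigcup_seq/=; exists i => /=; first by rewrite mem_index_enum.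
by exists Y => //; rewrite setTI.
Qed.

Lemma measurable_fun_rV d (T : measurableType d) n (f : T -> 'rV[R]_n) :
  (forall i, measurable_fun [set: T] (@rV_coord R n i \o f)) ->
  measurable_fun [set: T] f.
Proof.
move=> mf _ A mA; rewrite setTI.
have : preimage_set_system [set: T] f (g_sigma_preimage (@rV_coord R n))
    (f @^-1` A) by exists A => //; rewrite setTI.
rewrite -g_sigma_preimage_comp; apply: smallest_sub.
  exact: sigma_algebra_measurable.
rewrite -bigcup_seq/= => B [i _ [C mC <-]].
exact: mf.
Qed.

Lemma measurable_rV_cons n : measurable_fun setT (@rV_cons n).
Proof.
apply: measurable_fun_rV => i; case: (splitP (i : 'I_(1 + n))) => j ij.
  rewrite (_ : _ \o _ = fst) //; apply/funext => p.
  rewrite /rV_coord /rV_cons /= (_ : i = lshift n j); last exact: val_inj.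
  by rewrite row_mxEl mxE.
rewrite (_ : _ \o _ = @rV_coord R n j \o snd).
  apply: measurableT_comp => //; exact: measurable_rV_coord.
apply/funext => p.
rewrite /rV_coord /rV_cons /= (_ : i = rshift 1 j); last exact: val_inj.
by rewrite row_mxEr.
Qed.

Section rV_cons_measure.
Variables (n : nat) (mu : {sigma_finite_measure set 'rV[R]_n -> \bar R}).

Let lebxmu : {measure set (measurableTypeR R * 'rV[R]_n)%type -> \bar R} :=
  (lebesgue_measure \x mu)%E.

Definition rV_cons_measure : set 'rV[R]_n.+1 -> \bar R :=
  pushforward (lebesgue_measure \x mu)%E (@rV_cons n).

Let rV_cons_measure0 : rV_cons_measure set0 = 0%E.
Proof. by rewrite /rV_cons_measure /pushforward preimage_set0 measure0. Qed.

Let rV_cons_measure_ge0 A : (0 <= rV_cons_measure A)%E.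
Proof. exact: (measure_ge0 lebxmu). Qed.

Let rV_cons_measure_sigma_additive : semi_sigma_additive rV_cons_measure.
Proof.
move=> F mF tF mUF; rewrite /rV_cons_measure /pushforward preimage_bigcup.
apply: (measure_semi_sigma_additive (s := lebxmu)).
- by move=> k; rewrite -[X in measurable X]setTI; exact: measurable_rV_cons.
- apply/trivIsetP => /= i j _ _ ij; rewrite -preimage_setI.
  by move/trivIsetP : tF => /(_ _ _ _ _ ij) ->//; rewrite preimage_set0.
- rewrite -preimage_bigcup -[X in measurable X]setTI.
  exact: measurable_rV_cons.
Qed.

HB.instance Definition _ := isMeasure.Build _ _ _ rV_cons_measure
  rV_cons_measure0 rV_cons_measure_ge0 rV_cons_measure_sigma_additive.

Let rV_cons_measure_sigma_finite : sigma_finite setT rV_cons_measure.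
Proof.
have /sigma_finiteP[F [TF ndF Foo]] := sigma_finiteT (@lebesgue_measure R).
have /sigma_finiteP[G [TG ndG Goo]] := sigma_finiteT mu.
pose hd (x : 'rV[R]_n.+1) : measurableTypeR R := rV_coord ord0 x.
pose tl (x : 'rV[R]_n.+1) : 'rV[R]_n := @rsubmx _ 1 1 n x.
have hdK p : hd (rV_cons p) = p.1.
  have := row_mxEl (\row_(_ < 1) (p.1 : R)) p.2 ord0 ord0.
  rewrite mxE => <-; rewrite /hd /rV_coord /rV_cons.
  by congr (row_mx _ _ _ _); exact: val_inj.
have tlK p : tl (rV_cons p) = p.2 by rewrite /tl /rV_cons row_mxKr.
have mhd : measurable_fun setT hd by exact: measurable_rV_coord.
have mtl : measurable_fun setT tl.
  apply: measurable_fun_rV => i.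
  rewrite (_ : _ \o _ = @rV_coord R n.+1 (rshift 1 i)).
    exact: measurable_rV_coord.
  by apply/funext => x; rewrite /rV_coord /tl /= mxE.
exists (fun k => hd @^-1` F k `&` tl @^-1` G k).
  apply/esym; rewrite -subTset => x _.
  have [k _ Fk] : (\bigcup_k F k) (hd x) by rewrite -TF.
  have [l _ Gl] : (\bigcup_k G k) (tl x) by rewrite -TG.
  exists (maxn k l) => //; split.
  - by move/subsetPset: (ndF _ _ (leq_maxl k l)); apply.
  - by move/subsetPset: (ndG _ _ (leq_maxr k l)); apply.
move=> k; have [mF Fk] := Foo k; have [mG Gk] := Goo k; split.
  apply: measurableI.
  - by rewrite -[X in measurable X]setTI; exact: mhd.
  - by rewrite -[X in measurable X]setTI; exact: mtl.
rewrite /rV_cons_measure /pushforward (_ : _ @^-1` _ = F k `*` G k).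
  rewrite product_measure1E //.
  by rewrite lte_mul_pinfty// ge0_fin_numE.
by apply/seteqP; split => p; rewrite /= hdK tlK.
Qed.

HB.instance Definition _ := Measure_isSigmaFinite.Build _ _ _ rV_cons_measure
  rV_cons_measure_sigma_finite.

End rV_cons_measure.

Fixpoint lebesgue_rV n : {sigma_finite_measure set 'rV[R]_n -> \bar R} :=
  match n with
  | 0 => @dirac _ 'rV[R]_0 0 R
  | n'.+1 => rV_cons_measure (lebesgue_rV n')
  end.

End lebesgue_measure_rV.

Section calculus_rV.
Variables (R : realType) (n : nat).
Implicit Types (u : 'rV[R]_n -> R) (x : 'rV[R]_n) (rho : \bar R).

(* The library norm on 'rV[R]_n is the sup norm. *)
Definition enorm x : R := Num.sqrt (\sum_(i < n) x ord0 i ^+ 2).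

Definition eball rho : set 'rV[R]_n := [set x | ((enorm x)%:E < rho)%E].

Definition partial (i : 'I_n) u : 'rV[R]_n -> R :=
  fun x => 'D_(delta_mx ord0 i) u x.

Definition grad u x : 'rV[R]_n := \row_(i < n) partial i u x.

Definition laplacian u x : R := \sum_(i < n) partial i (partial i u) x.

Definition smooth u : Prop := forall s : seq 'I_n,
  continuous (foldr partial u s) /\
  forall (i : 'I_n) x, derivable (foldr partial u s) x (delta_mx ord0 i).

(* C_0^oo(Omega), its elements being extended by 0 to the whole of R^n. *)
Definition test_function (Omega : set 'rV[R]_n) u : Prop :=
  let supp := closure [set x | u x != 0] in
  [/\ smooth u, compact supp & supp `<=` Omega].

Definition radial u : Prop := exists f : R -> R, forall x, u x = f (enorm x).

End calculus_rV.

Section interval.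
Variable R : realType.
Implicit Types (rho : \bar R) (V W : R -> R).

Definition oitv0 rho : set R := [set r | 0 < r /\ (r%:E < rho)%E].

Definition smooth_on (A : set R) W : Prop :=
  forall k r, A r -> derivable (derive1n k W) r 1.

(* The differential equation is understood in the classical pointwise sense. *)
Definition bessel_pair (n : nat) rho V W : Prop :=
  (forall r, oitv0 rho r -> 0 <= V r) /\
  exists phi : R -> R,
    let flux := fun r => r ^+ n.-1 * V r * derive1 phi r in
    forall r, oitv0 rho r ->
      [/\ 0 < phi r, derivable phi r 1, derivable flux r 1
        & derive1 flux r + r ^+ n.-1 * W r * phi r = 0].

End interval.

(* Main.v *)
Require Import Defs.
From mathcomp Require Import all_boot all_order all_algebra.
From mathcomp Require Import all_classical all_reals all_analysis.
From mathcomp Require Import measurable_realfun ring lra.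

Set Implicit Arguments.
Unset Strict Implicit.
Unset Printing Implicit Defensive.

Import Order.TTheory GRing.Theory Num.Theory.
Import numFieldNormedType.Exports.

Local Open Scope classical_set_scope.
Local Open Scope ring_scope.

(** All five statements are equivalent to the nonnegativity, for some c > 0, of a
    quadratic form in one variable: the integral of
    r^(N+1) (v'^2 - c W2 v^2) over (0, rho), for test functions v on (0, rho).

    The radial inequalities imply this one-dimensional one. For the Hardy inequality
    in dimension N + 2 this is integration in polar coordinates
    ([line_form_of_radial_hardy]). For the Rellich inequality in dimension N one
    takes u = U(|x|) with U' = r v: then |grad u| = r |v|, and int |Lap u|^2 is
    the energy of v in dimension N + 2, up to a total derivative and a constant factor
    ([line_form_of_radial_rellich]). Since U must have compact support in
    (0, rho), v has to satisfy int r v = 0. This constraint can be removed at the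
    expense of c ([unconstrain]): were the form negative at test functions vanishing
    on arbitrarily large compact intervals, two such functions with disjoint
    supports could be combined into one satisfying the constraint, so the form is
    nonnegative off some compact interval, and Hardy's inequality takes care of that
    interval.

    The one-dimensional inequality gives a Bessel pair with constant c/2
    ([line_form_bessel_pair]). The differential equation is linear, so its solutions
    exist on the whole interval ([linear_system_exists]); none of them vanishes
    twice, because a solution for c/2 cut off near two of its zeros would
    contradict the inequality for c ([disconjugate]); hence a suitable combination of
    two solutions is positive everywhere ([positive_solution]).

    Conversely a Bessel pair with positive solution phi gives the Riccati equation
    for r k(r) = phi'/phi, and the divergence of the field u^2 k(|x|) x turns it into
    Hardy's inequality in dimension N + 2, for all test functions and not only for
    the radial ones ([hardy_riccati], [hardy_of_bessel]). In dimension N the same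
    function phi gives a scalar inequality int |grad f|^2 >= c' int W2 f^2, after
    averaging its Riccati solution with that of the classical Hardy inequality
    ([hardy_of_bessel_two_dims_up]). Applied to the partial derivatives of u, and
    combined with int |Lap u|^2 = int |D^2 u|^2, it gives the Rellich inequality
    ([rellich_of_bessel]).

    Polar coordinates for radial functions require no measure on the sphere: a
    profile F with int F r^(n-1) = 0 is the divergence of a compactly supported
    radial field, so int F(|x|) dx is proportional to int F r^(n-1)
    ([polar_coordinates]). *)

(** * Rules of differentiation *)
Section derivatives.
Variables (R : realType) (V : normedModType R).
Implicit Types (f g : V -> R) (x v : V).

Lemma is_derive_add f g x v df dg :
  is_derive x v f df -> is_derive x v g dg ->
  is_derive x v (fun y => f y + g y) (df + dg).
Proof. by move=> hf hg; have := is_deriveD hf hg. Qed.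

Lemma is_derive_sub f g x v df dg :
  is_derive x v f df -> is_derive x v g dg ->
  is_derive x v (fun y => f y - g y) (df - dg).
Proof. by move=> hf hg; have := is_deriveB hf hg. Qed.

Lemma is_derive_mul f g x v df dg :
  is_derive x v f df -> is_derive x v g dg ->
  is_derive x v (fun y => f y * g y) (df * g x + f x * dg).
Proof.
move=> hf hg; have [h1 h2] := is_deriveM hf hg; apply: DeriveDef => //.
by rewrite h2 /GRing.scale /= addrC mulrC.
Qed.

Lemma is_derive_inv f x v df : f x != 0 ->
  is_derive x v f df -> is_derive x v (fun y => (f y)^-1) (- df / f x ^+ 2).
Proof.
move=> fx0 [hf <-]; have := deriveV fx0 hf; have := derivableV fx0 hf.
move=> h1 h2; apply: DeriveDef => //; rewrite h2.
by rewrite /GRing.scale /= mulNr mulrC mulNr.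
Qed.

End derivatives.

Section derivatives1.
Variable R : realType.
Implicit Types (f g : R -> R) (x : R) (V : normedModType R).

Lemma is_derive_line V (g : V -> R) (x v : V) (s df : R) :
  is_derive (s *: v + x) v g df <-> is_derive s 1 (fun t : R => g (t *: v + x)) df.
Proof.
have e : (fun h : R => h^-1 *: ((g \o shift (s *: v + x)) (h *: v) - g (s *: v + x))) =
   (fun h : R => h^-1 *: (((fun t : R => g (t *: v + x)) \o shift s) (h *: (1 : R)) - g (s *: v + x))).
  apply/funext => h; rewrite /= /shift /=; congr (_ *: (g _ - _)).
  by rewrite addrA -scalerDl (_ : h *: 1 = h) // /GRing.scale /= mulr1.
split=> -[d dE]; apply: DeriveDef.
- by rewrite /derivable -e.
- by rewrite -dE /derive -e.
- by rewrite /derivable e.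
- by rewrite -dE /derive e.
Qed.

Lemma is_derive_line0 V (g : V -> R) (x v : V) (df : R) :
  is_derive x v g df <-> is_derive (0 : R) 1 (fun t : R => g (t *: v + x)) df.
Proof. by have := is_derive_line g x v 0 df; rewrite scale0r add0r. Qed.

Lemma is_derive_comp V (f : V -> R) (g : R -> R) (x v : V) df dg :
  is_derive x v f df -> is_derive (f x) 1 g dg ->
  is_derive x v (fun y => g (f y)) (dg * df).
Proof.
move=> hf hg.
apply/is_derive_line0; have hf' := (is_derive_line0 _ _ _ _).1 hf.
have hg' : is_derive (f (0 *: v + x)) 1 g dg by rewrite scale0r add0r.
have := @is_derive1_comp _ g (fun t : R => f (t *: v + x)) 0 _ _ hg' hf'.
by [].
Qed.

Lemma is_derive_pow V (f : V -> R) n (x v : V) df : is_derive x v f df ->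
  is_derive x v (fun y => f y ^+ n) (n%:R * f x ^+ n.-1 * df).
Proof.
move=> hf; apply: (is_derive_comp (g := fun y => y ^+ n) hf).
apply: DeriveDef; first exact: exprn_derivable.
by rewrite exp_derive /GRing.scale /= mulr1.
Qed.

End derivatives1.

(** * Smooth functions on open subsets of the line *)
Section smooth_on.
Variable R : realType.
Implicit Types (f g : R -> R) (x : R) (A B : set R) (k : nat).

Lemma is_derive1E f x df : is_derive x 1 f df -> derive1 f x = df.
Proof. by move=> h; rewrite derive1E; exact: derive_val. Qed.

Lemma derivable_is_derive f x : derivable f x 1 -> is_derive x 1 f (derive1 f x).
Proof. by rewrite derive1E => /derivableP. Qed.

Lemma is_derive_near f g x df : {near x, f =1 g} ->
  is_derive x 1 f df -> is_derive x 1 g df.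
Proof. by move=> fg; exact: near_eq_is_derive. Qed.

Lemma is_derive_open A f g x df : open A -> A x -> (forall y, A y -> f y = g y) ->
  is_derive x 1 f df -> is_derive x 1 g df.
Proof.
move=> oA Ax fg; apply: is_derive_near.
by apply: filterS (open_nbhs_nbhs (conj oA Ax)) => y /fg.
Qed.

(** The closure properties of smoothness are proved by induction on the number of
    derivatives, which needs a version of finite order. *)
Definition cn k A f := forall j, (j < k)%N -> forall x, A x -> derivable (derive1n j f) x 1.

Lemma cnS k A f : cn k.+1 A f <->
  (forall x, A x -> derivable f x 1) /\ cn k A (derive1 f).
Proof.
split=> [h|[h1 h2] [|j]].
- split=> [x Ax|j jk x Ax]; first exact: (h 0%N).
  by have := h j.+1 jk x Ax; rewrite derive1Sn.
- by move=> _ x Ax; exact: h1.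
- by rewrite ltnS => jk x Ax; rewrite derive1Sn; exact: h2.
Qed.

Lemma cnW k A f : cn k.+1 A f -> cn k A f.
Proof. by move=> h j jk; apply: h; exact: leqW. Qed.

Lemma cn_ext k A f g : open A -> (forall y, A y -> f y = g y) -> cn k A f -> cn k A g.
Proof.
move=> oA; elim: k f g => [|k IH] f g fg; first by move=> _ [].
move=> /cnS[df ck]; apply/cnS; split=> [x Ax|].
  have [] // := is_derive_open oA Ax fg (derivable_is_derive (df x Ax)).
apply: IH ck => y Ay; apply/esym.
by apply: is_derive1E; apply: (is_derive_open oA Ay fg); exact/derivable_is_derive/df.
Qed.

Lemma cn_derive k A f df : open A -> (forall x, A x -> is_derive x 1 f (df x)) ->
  cn k A df -> cn k.+1 A f.
Proof.
move=> oA hf ck; apply/cnS; split=> [x Ax|]; first by have [] := hf x Ax.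
by apply: cn_ext ck => // y Ay; apply/esym; exact/is_derive1E/hf.
Qed.

Lemma cn_cst k A (c : R) : cn k A (fun=> c).
Proof.
elim: k c => [|k IH] c; first by case.
apply/cnS; split=> [x _|]; first exact: derivable_cst.
rewrite (_ : derive1 _ = fun=> 0) //.
by apply/funext => x; apply: is_derive1E; exact: is_derive_cst.
Qed.

Lemma cnD k A f g : open A -> cn k A f -> cn k A g -> cn k A (fun x => f x + g x).
Proof.
move=> oA; elim: k f g => [|k IH] f g; first by move=> _ _ [].
move=> /cnS[df cf] /cnS[dg cg]; apply: (cn_derive oA _ (IH _ _ cf cg)) => x Ax.
by apply: is_derive_add; apply: derivable_is_derive; auto.
Qed.

Lemma cnM k A f g : open A -> cn k A f -> cn k A g -> cn k A (fun x => f x * g x).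
Proof.
move=> oA; elim: k f g => [|k IH] f g; first by move=> _ _ [].
move=> cf1 cg1; have /cnS[df cf] := cf1; have /cnS[dg cg] := cg1.
have h := cnD oA (IH _ _ cf (cnW cg1)) (IH _ _ (cnW cf1) cg).
apply: (cn_derive oA _ h) => x Ax.
by apply: is_derive_mul; apply: derivable_is_derive; auto.
Qed.

Lemma cnV k A f : open A -> (forall x, A x -> f x != 0) ->
  cn k A f -> cn k A (fun x => (f x)^-1).
Proof.
move=> oA fN0; elim: k => [_ []//|k IH] cf1; have /cnS[df cf] := cf1.
have cV := IH (cnW cf1).
have h := cnM oA (cnM oA (@cn_cst k A (-1)) cf) (cnM oA cV cV).
apply: (cn_derive oA _ h) => x Ax.
have := is_derive_inv (fN0 x Ax) (derivable_is_derive (df x Ax)).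
by rewrite mulN1r -invfM -expr2.
Qed.

Lemma cn_comp k A B f g : open A -> open B -> (forall x, A x -> B (g x)) ->
  cn k A g -> cn k B f -> cn k A (fun x => f (g x)).
Proof.
move=> oA oB AB; elim: k f => [|k IH] f; first by move=> _ _ [].
move=> cg1 cf1; have /cnS[df cf] := cf1; have /cnS[dg cg] := cg1.
have h := cnM oA (IH _ (cnW cg1) cf) cg.
apply: (cn_derive oA _ h) => x Ax.
by apply: is_derive_comp; apply: derivable_is_derive; auto.
Qed.

Lemma smooth_onP A f : smooth_on A f <-> forall k, cn k A f.
Proof. by split=> [h k j _|h k]; [exact: h|exact: (h k.+1)]. Qed.

Lemma smooth_on_derivable A f x : smooth_on A f -> A x -> derivable f x 1.
Proof. by move=> h; exact: (h 0%N). Qed.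

Lemma smooth_on_is_derive A f x : smooth_on A f -> A x -> is_derive x 1 f (derive1 f x).
Proof. by move=> h Ax; exact/derivable_is_derive/(smooth_on_derivable h). Qed.

Lemma smooth_on_derive1 A f : smooth_on A f -> smooth_on A (derive1 f).
Proof. by move=> h k x Ax; rewrite -derive1Sn; exact: h. Qed.

Lemma is_derive_continuous f x df : is_derive x 1 f df -> {for x, continuous f}.
Proof. by move=> [/derivable1_diffP/differentiable_continuous]. Qed.

Lemma smooth_on_continuous A f x : smooth_on A f -> A x -> {for x, continuous f}.
Proof. by move=> h Ax; exact: is_derive_continuous (smooth_on_is_derive h Ax). Qed.

Lemma smooth_on_subset A B f : A `<=` B -> smooth_on B f -> smooth_on A f.
Proof. by move=> AB h k x /AB; exact: h. Qed.

Lemma smooth_on_ext A f g : open A -> (forall y, A y -> f y = g y) ->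
  smooth_on A f -> smooth_on A g.
Proof. by move=> oA fg /smooth_onP h; apply/smooth_onP => k; exact: cn_ext (h k). Qed.

Lemma smooth_on_antiderivative A f df : open A ->
  (forall x, A x -> is_derive x 1 f (df x)) -> smooth_on A df -> smooth_on A f.
Proof.
move=> oA hf /smooth_onP h; apply/smooth_onP => -[//|k].
exact: cn_derive (h k).
Qed.

Lemma smooth_on_cst A (c : R) : smooth_on A (fun=> c).
Proof. by apply/smooth_onP => k; exact: cn_cst. Qed.

Lemma smooth_on_id A : open A -> smooth_on A (fun x => x).
Proof.
by move=> oA; apply: (smooth_on_antiderivative oA) (@smooth_on_cst A 1).
Qed.

Lemma smooth_onD A f g : open A -> smooth_on A f -> smooth_on A g ->
  smooth_on A (fun x => f x + g x).
Proof. by move=> oA /smooth_onP h /smooth_onP h'; apply/smooth_onP => k; exact: cnD. Qed.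

Lemma smooth_onM A f g : open A -> smooth_on A f -> smooth_on A g ->
  smooth_on A (fun x => f x * g x).
Proof. by move=> oA /smooth_onP h /smooth_onP h'; apply/smooth_onP => k; exact: cnM. Qed.

Lemma smooth_onN A f : open A -> smooth_on A f -> smooth_on A (fun x => - f x).
Proof.
move=> oA h; have := smooth_onM oA (@smooth_on_cst A (-1)) h.
by apply: smooth_on_ext => // y _; rewrite mulN1r.
Qed.

Lemma smooth_onB A f g : open A -> smooth_on A f -> smooth_on A g ->
  smooth_on A (fun x => f x - g x).
Proof. by move=> oA h h'; apply: smooth_onD => //; exact: smooth_onN. Qed.

Lemma smooth_onV A f : open A -> (forall x, A x -> f x != 0) -> smooth_on A f ->
  smooth_on A (fun x => (f x)^-1).
Proof. by move=> oA f0 /smooth_onP h; apply/smooth_onP => k; exact: cnV. Qed.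

Lemma smooth_on_comp A B f g : open A -> open B -> (forall x, A x -> B (g x)) ->
  smooth_on A g -> smooth_on B f -> smooth_on A (fun x => f (g x)).
Proof.
move=> oA oB AB /smooth_onP h /smooth_onP h'; apply/smooth_onP => k.
exact: cn_comp (h k) (h' k).
Qed.

Lemma smooth_onX A f n : open A -> smooth_on A f -> smooth_on A (fun x => f x ^+ n).
Proof.
move=> oA h; elim: n => [|n IH]; first exact: smooth_on_cst.
by apply: (smooth_on_ext oA) (smooth_onM oA h IH) => y _; rewrite exprS.
Qed.

End smooth_on.

(** * Smooth plateaus *)
Section plateau.
Variable R : realType.
Implicit Types (x : R) (k : nat).

Lemma is_derive_quadratic (f : R -> R) x (C : R) :
  (forall y, `|f y - f x| <= C * (y - x) ^+ 2) -> is_derive x 1 f 0.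
Proof.
move=> hf.
have lim0 : h^-1 *: ((f \o shift x) (h *: (1 : R)) - f x) @[h --> 0^'] --> (0 : R).
  apply/cvgrPdist_le => e e0; near=> h.
  have hN0 : h != 0 by near: h; exact: nbhs_dnbhs_neq.
  rewrite sub0r normrN normrM normfV ler_pdivrMl ?normr_gt0 //.
  rewrite /= /shift /=.
  apply: (le_trans (hf _)); rewrite addrK (_ : h *: 1 = h); last by rewrite /GRing.scale /= mulr1.
  rewrite -real_normK ?num_real // expr2 mulrA mulrC ler_wpM2l //.
  have hlt : `|h| < e / (`|C| + 1).
    by near: h; apply: dnbhs0_lt; rewrite divr_gt0 // ltr_wpDl.
  rewrite ltr_pdivlMr ?ltr_wpDl // in hlt.
  apply: le_trans (ltW hlt); rewrite mulrC ler_wpM2l //.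
  by rewrite (le_trans (ler_norm C)) // lerDl.
apply: DeriveDef; first by apply/cvg_ex; exists 0.
exact/cvg_lim.
Unshelve. all: by end_near. Qed.

(** The derivative of x^-k e^(-1/x) is a linear combination of the functions of
    order k + 1 and k + 2, so the whole family is smooth across 0. *)
Definition flat k x : R := if 0 < x then x ^- k * expR (- x^-1) else 0.

Lemma flat_le k x : `|flat k x| <= (k.+2)`!%:R * x ^+ 2.
Proof.
rewrite /flat; case: ifPn => [x0|_]; last first.
  by rewrite normr0 mulr_ge0 // sqr_ge0.
rewrite expRN ger0_norm; last first.
  by rewrite mulr_ge0 ?invr_ge0 ?expR_ge0 ?exprn_ge0 // ltW.
rewrite ler_pdivrMr ?expR_gt0 //.
have h : x^-1 ^+ k.+2 / (k.+2)`!%:R <= expR x^-1.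
  apply: le_trans (expR_ge1Dxn k.+1 _); first by rewrite lerDr.
  by rewrite invr_ge0 ltW.
have {h} : (k.+2)`!%:R * x ^+ 2 * (x^-1 ^+ k.+2 / (k.+2)`!%:R) <= (k.+2)`!%:R * x ^+ 2 * expR x^-1.
  by rewrite ler_wpM2l // mulr_ge0 // sqr_ge0.
apply: le_trans; rewrite le_eqVlt; apply/orP; left; apply/eqP.
have fN0 : (k.+2)`!%:R != 0 :> R by rewrite pnatr_eq0 -lt0n fact_gt0.
have xkN0 : x ^+ k != 0 by rewrite expf_neq0 ?gt_eqF.
rewrite exprVn -addn2 exprD; move: fN0; rewrite addn2.
move: (_%:R : R) => F F0; move: xkN0; move: (x ^+ k) => X X0; field.
by rewrite F0 X0 gt_eqF.
Qed.

Lemma is_derive_flat k x : is_derive x 1 (flat k) (flat k.+2 x - k%:R * flat k.+1 x).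
Proof.
have [x0|x0|->] := ltgtP x 0.
- rewrite {2 3}/flat !ifF ?(lt_gtF x0) // mulr0 subr0.
  apply: is_derive_near (is_derive_cst 0 x 1); near=> y; rewrite /flat ifF //.
  apply/negbTE; rewrite -leNgt ltW //.
  by near: y; exact: lt_nbhsl.
- have h : is_derive x 1 (fun y : R => y ^- k * expR (- y^-1)) (flat k.+2 x - k%:R * flat k.+1 x).
    have xN0 : x != 0 by rewrite gt_eqF.
    have dV := @is_derive_inv R R (fun y : R => y ^+ k) x 1 _ (expf_neq0 k xN0)
      (is_derive_pow k (is_derive_id x (1 : R))).
    have dI := is_derive_inv xN0 (is_derive_id x (1 : R)).
    have dN := is_derive_mul (is_derive_cst (-1 : R) x 1) dI.
    have := is_derive_mul dV (is_derive_comp dN (is_derive_expR _)).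
    rewrite /flat x0; under eq_fun do rewrite mulN1r.
    move=> [h1 h2]; apply: DeriveDef => //; rewrite h2 mulN1r.
    rewrite /cst mulN1r; case: (k) => [|j]; first by rewrite !expr0; field.
    by rewrite /= !exprS; field; rewrite ?xN0 ?expf_neq0.
  apply: is_derive_near h; near=> y; rewrite /flat ifT //.
  by near: y; exact: lt_nbhsr.
- rewrite {2 3}/flat ltxx mulr0 subr0.
  apply: (@is_derive_quadratic _ _ (k.+2)`!%:R) => y.
  by rewrite {2}/flat ltxx !subr0 flat_le.
Unshelve. all: by end_near. Qed.

Lemma smooth_flat k : smooth_on setT (flat k).
Proof.
apply/smooth_onP => n; elim: n k => [//|n IH] k.
apply: (cn_derive openT (fun x _ => is_derive_flat k x)).
apply: cnD => //; first exact: openT.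
have := cnM openT (@cn_cst R n setT (- k%:R)) (IH k.+1).
by apply: cn_ext; [exact: openT|move=> x _; rewrite mulNr].
Qed.

Definition step x : R := flat 0 x / (flat 0 x + flat 0 (1 - x)).

Lemma flat0_ge0 x : 0 <= flat 0 x.
Proof. by rewrite /flat; case: ifP => // _; rewrite expr0 invr1 mul1r expR_ge0. Qed.

Lemma flat0_gt0 x : 0 < x -> 0 < flat 0 x.
Proof. by move=> x0; rewrite /flat x0 expr0 invr1 mul1r expR_gt0. Qed.

Lemma step_denom_gt0 x : 0 < flat 0 x + flat 0 (1 - x).
Proof.
have [x0|x0] := ltP 0 x.
  by rewrite ltr_pwDl ?flat0_ge0 // flat0_gt0.
by rewrite ltr_wpDl ?flat0_ge0 // flat0_gt0 //; lra.
Qed.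

Lemma step_ge0 x : 0 <= step x.
Proof. by rewrite divr_ge0 ?flat0_ge0 // ltW // step_denom_gt0. Qed.

Lemma step_le1 x : step x <= 1.
Proof. by rewrite ler_pdivrMr ?step_denom_gt0 // mul1r lerDl flat0_ge0. Qed.

Lemma step0 x : x <= 0 -> step x = 0.
Proof. by move=> x0; rewrite /step {1}/flat ltNge x0 mul0r. Qed.

Lemma step1 x : 1 <= x -> step x = 1.
Proof.
move=> x1; have f0 : flat 0 (1 - x) = 0.
  by rewrite /flat ifF //; apply/negbTE; rewrite -leNgt; lra.
by rewrite /step f0 addr0 divff // gt_eqF // flat0_gt0 //; lra.
Qed.

Lemma smooth_step : smooth_on setT step.
Proof.
have oT := @openT R.
have s1 : smooth_on setT (fun x : R => flat 0 (1 - x)).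
  apply: (@smooth_on_comp R setT setT (flat 0) (fun x => 1 - x) oT oT _ _ (@smooth_flat 0)) => //.
  by apply: smooth_onB => //; [exact: smooth_on_cst|exact: smooth_on_id].
apply: smooth_onM => //; first exact: smooth_flat.
apply: smooth_onV => // [x _|]; first by rewrite gt_eqF // step_denom_gt0.
by apply: smooth_onD => //; exact: smooth_flat.
Qed.

Lemma derive1_step_bounded : exists2 C : R, 0 < C & forall x, `|derive1 step x| <= C.
Proof.
have c1 : {within `[(0 : R), 1], continuous (fun x => `|derive1 step x|)}.
  apply: continuous_subspaceT => x.
  apply: (continuous_comp (smooth_on_continuous (smooth_on_derive1 smooth_step) _)) => //.
  exact: norm_continuous.
have [c _ hc] := EVT_max (@ler01 R) c1.
exists (`|derive1 step c| + 1) => [|x]; first by rewrite ltr_pwDr.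
have [x0|x0] := ltP x 0.
  rewrite (_ : derive1 step x = 0) ?normr0 ?addr_ge0 //.
  apply: is_derive1E; apply: is_derive_near (is_derive_cst (0 : R) x (1 : R)).
  by near=> y; rewrite step0 //; near: y; exact: lt_le_nbhsl.
have [x1|x1] := ltP 1 x.
  rewrite (_ : derive1 step x = 0) ?normr0 ?addr_ge0 //.
  apply: is_derive1E; apply: is_derive_near (is_derive_cst (1 : R) x (1 : R)).
  by near=> y; rewrite step1 //; near: y; exact: lt_le_nbhsr.
by rewrite (le_trans (hc x _)) ?lerDl // in_itv /= x0.
Unshelve. all: by end_near. Qed.

(** Rises from 0 to 1 on [a0, a1] and falls back to 0 on [b1, b0]. *)
Definition plateau (a0 a1 b1 b0 : R) x : R :=
  step ((x - a0) / (a1 - a0)) * step ((b0 - x) / (b0 - b1)).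

Section plateau_theory.
Variables a0 a1 b1 b0 : R.
Hypotheses (a01 : a0 < a1) (b10 : b1 < b0).

Let a01' : 0 < a1 - a0. Proof. by rewrite subr_gt0. Qed.
Let b10' : 0 < b0 - b1. Proof. by rewrite subr_gt0. Qed.

Lemma plateau_ge0 x : 0 <= plateau a0 a1 b1 b0 x.
Proof. by rewrite mulr_ge0 ?step_ge0. Qed.

Lemma plateau_le1 x : plateau a0 a1 b1 b0 x <= 1.
Proof. by rewrite mulr_ile1 ?step_ge0 ?step_le1. Qed.

Lemma plateau1 x : a1 <= x -> x <= b1 -> plateau a0 a1 b1 b0 x = 1.
Proof.
move=> x1 x2; rewrite /plateau !step1 ?mulr1 //.
  by rewrite ler_pdivlMr // mul1r; lra.
by rewrite ler_pdivlMr // mul1r; lra.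
Qed.

Lemma plateau0l x : x <= a0 -> plateau a0 a1 b1 b0 x = 0.
Proof.
by move=> x0; rewrite /plateau step0 ?mul0r // pmulr_lle0 ?invr_gt0 // subr_le0.
Qed.

Lemma plateau0r x : b0 <= x -> plateau a0 a1 b1 b0 x = 0.
Proof.
move=> x0; rewrite /plateau [X in _ * X]step0 ?mulr0 //.
by rewrite pmulr_lle0 ?invr_gt0 // subr_le0.
Qed.

Lemma smooth_plateau : smooth_on setT (plateau a0 a1 b1 b0).
Proof.
have oT := @openT R.
apply: smooth_onM => //; apply: (@smooth_on_comp R setT setT step _ oT oT _ _ smooth_step) => //.
  apply: smooth_onM => //; last exact: smooth_on_cst.
  by apply: smooth_onB => //; [exact: smooth_on_id|exact: smooth_on_cst].
apply: smooth_onM => //; last exact: smooth_on_cst.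
by apply: smooth_onB => //; [exact: smooth_on_cst|exact: smooth_on_id].
Qed.

End plateau_theory.

Lemma derive1_plateau_le (C : R) (a0 a1 b1 b0 d x : R) :
  (forall y, `|derive1 step y| <= C) -> 0 < d -> d <= a1 - a0 -> d <= b0 - b1 ->
  `|derive1 (plateau a0 a1 b1 b0) x| <= 2 * C / d.
Proof.
move=> hC d0 da db.
have C0 : 0 <= C by exact: le_trans (normr_ge0 _) (hC 0).
have sD (y : R) : is_derive y 1 step (derive1 step y) by exact: smooth_on_is_derive smooth_step _.
have e1 : is_derive x 1 (fun x : R => (x - a0) / (a1 - a0)) ((a1 - a0)^-1).
  have := is_derive_mul (is_derive_sub (is_derive_id x (1:R)) (is_derive_cst a0 x (1:R))) (is_derive_cst (a1 - a0)^-1 x (1:R)).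
  by rewrite subr0 mulr0 addr0 mul1r.
have e2 : is_derive x 1 (fun x : R => (b0 - x) / (b0 - b1)) (- (b0 - b1)^-1).
  have := is_derive_mul (is_derive_sub (is_derive_cst b0 x (1:R)) (is_derive_id x (1:R))) (is_derive_cst (b0 - b1)^-1 x (1:R)).
  by rewrite sub0r mulr0 addr0 mulN1r.
have := is_derive_mul (is_derive_comp e1 (sD _)) (is_derive_comp e2 (sD _)).
move=> /is_derive1E => e.
rewrite [derive1 (plateau _ _ _ _) x](_ : _ = derive1 (fun x => step ((x - a0) / (a1 - a0)) * step ((b0 - x) / (b0 - b1))) x) // e.
apply: (le_trans (ler_normD _ _)).
rewrite (_ : 2 * C / d = C / d + C / d); last by rewrite -mulrA mulr2n mulrDl mul1r.
have bd y (e' : R) : d <= e' -> `|derive1 step y * e'^-1| <= C / d.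
  move=> de; rewrite normrM ler_pM // normfV ger0_norm ?lef_pV2 ?posrE //.
    exact: lt_le_trans de.
  exact: le_trans (ltW d0) de.
apply: lerD; rewrite normrM -[leRHS]mulr1.
  apply: ler_pM => //; first exact: bd.
  by rewrite ger0_norm ?step_ge0 // step_le1.
rewrite mulrC; apply: ler_pM => //; first by rewrite mulrN normrN bd.
by rewrite ger0_norm ?step_ge0 // step_le1.
Qed.

End plateau.

(** * Integration on the line *)
Section integral_line.
Variable R : realType.
Implicit Types (F G : R -> R) (a b s t x : R) (rho : \bar R).
Notation mu := (@lebesgue_measure R).

Definition vanish_outside s t F := forall x, (x < s) || (t < x) -> F x = 0.

Definition integral_line F : R := \int[mu]_x F x.
Local Notation J := integral_line.

Lemma itv_integrable F a b : (forall x, a <= x <= b -> {for x, continuous F}) ->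
  mu.-integrable `[a, b] (EFin \o F).
Proof.
move=> cF; apply: continuous_compact_integrable; first exact: segment_compact.
by apply: continuous_in_subspaceT => x; rewrite inE /= in_itv /= => /cF.
Qed.

Lemma vanish_outside_restrict s t F : vanish_outside s t F -> F \_ `[s, t] = F.
Proof.
move=> h; apply/funext => x; rewrite patchE; case: ifPn => //.
rewrite notin_setE /= in_itv /= => /negP; rewrite negb_and -!ltNge => xst.
by rewrite h.
Qed.

Lemma vanish_outside_integrable s t F : continuous F -> vanish_outside s t F ->
  mu.-integrable setT (EFin \o F).
Proof.
move=> cF hF; rewrite -(vanish_outside_restrict hF) -restrict_EFin.
have mI : measurable (`[s, t]%classic : set (measurableTypeR R)) by exact: measurable_itv.
refine ((integrable_mkcond (mu := mu) (EFin \o F) mI).1 _).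
by apply: itv_integrable => x _; exact: cF.
Qed.

Lemma integral_line_itv s t F : vanish_outside s t F -> J F = \int[mu]_(x in `[s, t]) F x.
Proof. by move=> h; rewrite Rintegral_mkcond vanish_outside_restrict. Qed.

Lemma is_derive_FTC2 G F a b : a < b -> (forall x, is_derive x 1 G (F x)) -> continuous F ->
  \int[mu]_(x in `[a, b]) F x = G b - G a.
Proof.
move=> ab dG cF.
have cG : continuous G by move=> x; exact: is_derive_continuous (dG x).
rewrite /Rintegral (@continuous_FTC2 _ F G) //.
- exact: continuous_subspaceT.
- split; first by move=> x _; have [] := dG x.
    by apply: cvg_at_right_filter; exact: cG.
  by apply: cvg_at_left_filter; exact: cG.
- by move=> x _; exact: is_derive1E (dG x).
Qed.

Lemma integral_line_derive s t G F : (forall x, is_derive x 1 G (F x)) -> continuous F ->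
  vanish_outside s t G -> J F = 0.
Proof.
move=> dG cF hG.
wlog st : t hG / s < t.
  move=> H; apply: (H (Num.max t (s + 1))).
    move=> x xst; apply: hG; case/orP: xst => [->//|].
    by rewrite gt_max => /andP[->]; rewrite orbT.
  by rewrite lt_max ltrDl ltr01 orbT.
have hF : vanish_outside (s - 1) (t + 1) F.
  move=> x xst; rewrite -(is_derive1E (dG x)); apply: is_derive1E.
  apply: is_derive_near (is_derive_cst (0 : R) x (1 : R)).
  case/orP: xst => xst; near=> y; rewrite hG //; apply/orP; [left|right];
    near: y; [apply: lt_nbhsl|apply: lt_nbhsr]; lra.
rewrite (integral_line_itv hF) (is_derive_FTC2 _ dG cF); last lra.
by rewrite !hG ?subrr //; apply/orP; [left|right]; lra.
Unshelve. all: by end_near. Qed.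

(** F need not be integrable near 0, so the base point m x of the integral moves with
    x; subtracting the integral from m x to r0 removes the dependence on m x. *)
Lemma antiderivative_exists rho F : (forall x, oitv0 rho x -> {for x, continuous F}) ->
  exists P, forall x, oitv0 rho x -> is_derive x 1 P (F x).
Proof.
move=> cF.
have [[r0 r0rho]|nex] := pselect (exists r, oitv0 rho r); last first.
  by exists F => x hx; case: nex; exists x.
pose A s x := \int[mu]_(y in `[s, x]) F y.
pose m x := Num.min x r0 / 2.
pose P x := A (m x) x - A (m x) r0; exists P => x xrho.
have sub y z : 0 < y -> oitv0 rho z -> mu.-integrable `[y, z] (EFin \o F).
  move=> y0 [z0 zrho]; apply: itv_integrable => w /andP[yw wz]; apply: cF.
  by split; [exact: lt_le_trans yw|apply: le_lt_trans zrho; rewrite lee_fin].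
have split3 s s' z : 0 < s -> s <= s' -> s' <= z -> oitv0 rho z -> A s z = A s s' + A s' z.
  move=> s0 ss' s'z zrho; have := @Rintegral_itvB R F (BLeft s) (BRight z) s' (sub _ _ s0 zrho).
  rewrite !bnd_simp => /(_ ss' s'z) h; rewrite /A -(@Rintegral_itv_obnd_cbnd R s' (BRight z) F).
    by rewrite -h addrC subrK.
  apply: (integrableS _ _ _ (sub s' z _ zrho)) => //; last exact: lt_le_trans s0 ss'.
  exact: subset_itv_oc_cc.
have indep s y : 0 < s -> s < y -> s < r0 -> oitv0 rho y -> P y = A s y - A s r0.
  move=> s0 sy sr0 yrho.
  have y0 : 0 < y by case: yrho.
  have r00 : 0 < r0 by case: r0rho.
  have m0 : 0 < m y by rewrite divr_gt0 // lt_min y0.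
  have my : m y <= y by rewrite ler_pdivrMr // ge_min; apply/orP; left; lra.
  have mr : m y <= r0 by rewrite ler_pdivrMr // ge_min; apply/orP; right; lra.
  rewrite /P; case: (leP s (m y)) => sm.
    by rewrite (split3 s (m y) y) // (split3 s (m y) r0) //; ring.
  by rewrite (split3 (m y) s y) ?(split3 (m y) s r0) // ?ltW //; ring.
have x0 : 0 < x by case: xrho.
have r00 : 0 < r0 by case: r0rho.
have m0 : 0 < m x by rewrite divr_gt0 // lt_min x0.
have mx : m x < x by rewrite ltr_pdivrMr // gt_min; apply/orP; left; lra.
have mr : m x < r0 by rewrite ltr_pdivrMr // gt_min; apply/orP; right; lra.
have [u [xu urho]] : exists u, x < u /\ oitv0 rho u.
  case: xrho => _; case: (rho) => [r| |//]; rewrite ?lte_fin => xr.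
  - by exists ((x + r) / 2); split; [lra|split; [lra|rewrite lte_fin; lra]].
  - by exists (x + 1); split; [lra|split; [lra|rewrite ltry]].
have [dA vA] := @continuous_FTC1_closed R F (m x) x u xu (sub _ _ m0 urho) mx (cF _ xrho).
have dA' : is_derive x 1 (fun y => A (m x) y - A (m x) r0) (F x).
  rewrite -[F x]subr0 -vA.
  exact: is_derive_sub (derivable_is_derive dA) (is_derive_cst (A (m x) r0) x (1 : R)).
apply: is_derive_near dA'; near=> y; apply/esym/indep => //.
  by near: y; exact: lt_nbhsr.
split; first by near: y; exact: lt_nbhsr.
by case: urho => _; apply: le_lt_trans; rewrite lee_fin ltW //; near: y; exact: lt_nbhsl.
Unshelve. all: by end_near. Qed.

Lemma integral_lineD s t F G : continuous F -> continuous G ->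
  vanish_outside s t F -> vanish_outside s t G ->
  J (fun x => F x + G x) = J F + J G.
Proof. by move=> *; apply: RintegralD => //; exact: (@vanish_outside_integrable s t). Qed.

Lemma integral_lineB s t F G : continuous F -> continuous G ->
  vanish_outside s t F -> vanish_outside s t G ->
  J (fun x => F x - G x) = J F - J G.
Proof. by move=> *; apply: RintegralB => //; exact: (@vanish_outside_integrable s t). Qed.

Lemma integral_lineZ s t F c : continuous F -> vanish_outside s t F ->
  J (fun x => c * F x) = c * J F.
Proof. by move=> *; apply: RintegralZl => //; exact: (@vanish_outside_integrable s t). Qed.

Lemma integral_line_le s t F G : continuous F -> continuous G ->
  vanish_outside s t F -> vanish_outside s t G ->
  (forall x, F x <= G x) -> J F <= J G.
Proof.
by move=> *; apply: le_Rintegral => //; exact: (@vanish_outside_integrable s t).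
Qed.

Lemma integral_line_ge0 F : (forall x, 0 <= F x) -> 0 <= J F.
Proof. by move=> h; apply: Rintegral_ge0. Qed.

End integral_line.

(** * The interval (0, rho) *)
Section half_line.
Variable R : realType.
Implicit Types (rho : \bar R) (f P F : R -> R).

Lemma oitv0_open rho : open (oitv0 rho).
Proof.
case: rho => [b| |].
- rewrite (_ : oitv0 _ = `]0, b[%classic); first exact: itv_open.
  by apply/seteqP; split => x; rewrite /oitv0 /= in_itv /= lte_fin => /andP.
- rewrite (_ : oitv0 _ = `]0, +oo[%classic); first exact: rray_open.
  apply/seteqP; split => x; rewrite /oitv0 /= in_itv /= andbT; first by case.
  by move=> x0; split => //; rewrite ltry.
- by rewrite (_ : oitv0 _ = set0); [exact: open0|apply/seteqP; split => x // []].
Qed.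

Lemma oitv0_convex rho s t x : oitv0 rho s -> oitv0 rho t -> s <= x <= t -> oitv0 rho x.
Proof.
move=> [s0 _] [_ trho] /andP[sx xt]; split; first exact: lt_le_trans sx.
by apply: le_lt_trans trho; rewrite lee_fin.
Qed.

Lemma oitv0_outside rho s t x : oitv0 rho s -> oitv0 rho t -> ~ oitv0 rho x ->
  (x < s) || (t < x).
Proof.
move=> Is It nIx; apply/negPn/negP; rewrite negb_or -!leNgt => xst; apply: nIx.
exact: oitv0_convex xst.
Qed.

Lemma oitv0_gt rho x : oitv0 rho x -> exists2 u, x < u & oitv0 rho u.
Proof.
case=> x0; case: rho => [r| |//] xr; first rewrite lte_fin in xr.
- by exists ((x + r) / 2); [lra|split; [lra|rewrite lte_fin; lra]].
- by exists (x + 1); [lra|split; [lra|rewrite ltry]].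
Qed.

Lemma oitv0_lt rho x : oitv0 rho x -> exists2 u, u < x & oitv0 rho u.
Proof.
case=> x0 xr; exists (x / 2); first lra.
by split; [lra|apply: lt_trans xr; rewrite lte_fin; lra].
Qed.

Lemma MVT_is_derive f (df : R -> R) (a b : R) : a < b ->
  (forall x, a <= x <= b -> is_derive x 1 f (df x)) ->
  exists2 c, a < c < b & f b - f a = df c * (b - a).
Proof.
move=> ab h; have [] := @MVT R f df a b ab.
- by move=> x; rewrite in_itv /= => /andP[/ltW ax /ltW xb]; apply: h; rewrite ax.
- apply: continuous_in_subspaceT => x; rewrite inE /= in_itv /= => /h.
  exact: is_derive_continuous.
- by move=> c; rewrite in_itv /=; exists c.
Qed.

Lemma is_derive_ge0_le f (df : R -> R) (a b : R) : a <= b ->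
  (forall x, a <= x <= b -> is_derive x 1 f (df x)) ->
  (forall x, a <= x <= b -> 0 <= df x) -> f a <= f b.
Proof.
rewrite le_eqVlt => /predU1P[->//|ab] h h0.
have [c /andP[/ltW ac /ltW cb] e] := MVT_is_derive ab h.
by rewrite -subr_ge0 e mulr_ge0 ?h0 ?ac // subr_ge0 ltW.
Qed.

Lemma is_derive0_cst f (a b : R) : a <= b ->
  (forall x, a <= x <= b -> is_derive x 1 f 0) -> f a = f b.
Proof.
rewrite le_eqVlt => /predU1P[->//|ab] h.
by have [c _ /eqP] := MVT_is_derive (df := fun=> 0) ab h; rewrite mul0r subr_eq0 => /eqP.
Qed.

Lemma continuous_bounded_itv f (a b : R) : a <= b ->
  (forall x, a <= x <= b -> {for x, continuous f}) ->
  exists2 M : R, 0 < M & forall x, a <= x <= b -> `|f x| <= M.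
Proof.
move=> ab cf.
have c1 : {within `[a, b], continuous (fun x => `|f x|)}.
  apply: continuous_in_subspaceT => x; rewrite inE /= in_itv /= => /cf cfx.
  by apply: (continuous_comp cfx); exact: norm_continuous.
have [c _ hc] := EVT_max ab c1.
exists (`|f c| + 1) => [|x xab]; first by rewrite ltr_wpDl.
by apply: le_trans (hc _ _) _; rewrite ?in_itv // lerDl.
Qed.

(** Gronwall-type comparison: the weight e^(2M|x-r0|) makes one integration gain
    a factor 1/2, whatever the length of the interval. *)
Lemma primitive_bound P F (s t r0 M C : R) : s <= r0 <= t -> 0 < M -> P r0 = 0 ->
  (forall x, s <= x <= t -> is_derive x 1 P (F x)) ->
  (forall x, s <= x <= t -> `|F x| <= M * (C * expR (2 * M * `|x - r0|))) ->
  forall x, s <= x <= t -> `|P x| <= C / 2 * expR (2 * M * `|x - r0|).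
Proof.
move=> /andP[sr rt] M0 P0 dP hF x /andP[sx xt].
have C0 : 0 <= C.
  have := hF r0; rewrite sr rt => /(_ isT); rewrite subrr normr0 mulr0 expR0 mulr1.
  by move=> h; have := le_trans (normr_ge0 _) h; rewrite pmulr_rge0.
pose E k (y : R) := C / 2 * expR (2 * M * (k * (y - r0))).
have dE (k y : R) : is_derive y 1 (E k) (k * M * (C * expR (2 * M * (k * (y - r0))))).
  have e0 : is_derive y 1 (fun z : R => 2 * M * (k * (z - r0))) (2 * M * k).
    rewrite (_ : (fun z => _) = (fun z : R => cst (2 * M * k) z * (z - cst r0 z))).
      have := is_derive_mul (is_derive_cst (2 * M * k) y (1 : R))
        (is_derive_sub (is_derive_id y (1 : R)) (is_derive_cst r0 y (1 : R))).
      by rewrite mul0r add0r subr0 mulr1.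
    by apply/funext => z; rewrite /cst; ring.
  have := is_derive_mul (is_derive_cst (C / 2) y (1 : R)) (is_derive_comp e0 (is_derive_expR _)).
  by rewrite mul0r add0r /cst /=; move=> [h1 h2]; apply: DeriveDef => //; rewrite h2; field.
have main (sg : R) : `|sg| = 1 -> sg * P x <= C / 2 * expR (2 * M * `|x - r0|).
  move=> sg1.
  have dG (k y : R) : s <= y <= t -> is_derive y 1 (fun z => E k z - sg * P z)
      (k * M * (C * expR (2 * M * (k * (y - r0)))) - sg * F y).
    move=> yst; apply: is_derive_sub => //.
    have := is_derive_mul (is_derive_cst sg y (1 : R)) (dP y yst).
    by rewrite mul0r add0r.
  have bF y : s <= y <= t -> `|sg * F y| <= M * (C * expR (2 * M * `|y - r0|)).
    by move=> yst; rewrite normrM sg1 mul1r; exact: hF.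
  have Er0 k : 0 <= E k r0 - sg * P r0.
    by rewrite P0 mulr0 subr0 mulr_ge0 ?expR_ge0 // divr_ge0.
  case: (leP r0 x) => xr.
    have st y : r0 <= y <= x -> s <= y <= t.
      by move=> /andP[y1 y2]; rewrite (le_trans sr y1) (le_trans y2 xt).
    have pos y : r0 <= y <= x -> 0 <= 1 * M * (C * expR (2 * M * (1 * (y - r0)))) - sg * F y.
      move=> yx; have := bF y (st y yx); rewrite (@ger0_norm _ (y - r0)); last by rewrite subr_ge0; case/andP: yx.
      by rewrite !mul1r subr_ge0; apply: le_trans; exact: ler_norm.
    have := is_derive_ge0_le xr (fun y yx => dG 1 y (st y yx)) pos.
    move/(le_trans (Er0 1)); rewrite /E subr_ge0 mul1r.
    by rewrite ger0_norm ?subr_ge0.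
  have st y : x <= y <= r0 -> s <= y <= t.
    by move=> /andP[y1 y2]; rewrite (le_trans sx y1) (le_trans y2 rt).
  have dH (y : R) : x <= y <= r0 -> is_derive y 1 (fun z => - (E (-1) z - sg * P z))
      (- (-1 * M * (C * expR (2 * M * (-1 * (y - r0)))) - sg * F y)).
    by move=> yx; exact: is_deriveN (dG (-1) y (st y yx)).
  have pos y : x <= y <= r0 -> 0 <= - (-1 * M * (C * expR (2 * M * (-1 * (y - r0)))) - sg * F y).
    move=> yx; have := bF y (st y yx); rewrite (@ler0_norm _ (y - r0)); last by rewrite subr_le0; case/andP: yx.
    rewrite !mulN1r !opprB ler_norml => /andP[b _].
    by rewrite mulNr opprK; lra.
  have := is_derive_ge0_le (ltW xr) dH pos.
  rewrite lerN2; move/(le_trans (Er0 (-1))); rewrite /E subr_ge0 mulN1r opprB.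
  by rewrite ltr0_norm ?subr_lt0 // opprB.
rewrite ler_norml; apply/andP; split.
  by rewrite lerNl -mulN1r; apply: main; rewrite normrN1.
by rewrite -[P x]mul1r; apply: main; rewrite normr1.
Qed.

End half_line.

(** * Linear systems of differential equations *)
Section linear_system.
Variables (R : realType) (rho : \bar R) (r0 : R).
Hypothesis r0rho : oitv0 rho r0.
Implicit Types (F : R -> R).
Local Notation I := (oitv0 rho).

Definition primitive F : R -> R :=
  xget (fun=> 0) [set P | P r0 = 0 /\ forall x, I x -> is_derive x 1 P (F x)].

Lemma primitiveP F : (forall x, I x -> {for x, continuous F}) ->
  primitive F r0 = 0 /\ forall x, I x -> is_derive x 1 (primitive F) (F x).
Proof.
move=> cF; have [P dP] := antiderivative_exists cF.
suff [Q hQ] : exists Q, [set P | P r0 = 0 /\ forall x, I x -> is_derive x 1 P (F x)] Q.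
  by have := @xgetI _ (fun=> 0) _ _ hQ.
exists (fun x => P x - P r0); split; first by rewrite subrr.
move=> x Ix; have := is_derive_sub (dP x Ix) (is_derive_cst (P r0) x (1 : R)).
by rewrite subr0.
Qed.

Variables (a q : R -> R).
Hypotheses (ca : forall x, I x -> {for x, continuous a})
           (cq : forall x, I x -> {for x, continuous q}).
Variables (y0 z0 : R).

(** Terms of the Neumann series of y = y0 + z0 int a - int a int (q y). *)
Fixpoint neumann k : R -> R :=
  if k is k'.+1 then
    fun x => - primitive (fun s => a s * primitive (fun u => q u * neumann k' u) s) x
  else fun x => y0 + z0 * primitive a x.

Let cM (f g : R -> R) : (forall x, I x -> {for x, continuous f}) -> (forall x, I x -> {for x, continuous g}) ->
  forall x, I x -> {for x, continuous (fun x => f x * g x)}.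
Proof. by move=> cf cg x Ix; apply: continuousM; [exact: cf|exact: cg]. Qed.

Let cprim (f : R -> R) : (forall x, I x -> {for x, continuous f}) ->
  forall x, I x -> {for x, continuous (primitive f)}.
Proof. by move=> cf x Ix; exact: is_derive_continuous ((primitiveP cf).2 x Ix). Qed.

Lemma neumann_continuous k x : I x -> {for x, continuous (neumann k)}.
Proof.
elim: k x => [|k IH] x Ix /=.
  apply: continuousD; first exact: cvg_cst.
  by apply: continuousM; [exact: cvg_cst|exact: cprim].
by apply: continuousN; apply: cprim => //; apply: cM => //; apply: cprim; exact: cM.
Qed.

(* S n approximates y and Z n approximates z; the recursion defining the series
   makes (S n.+1)' = a (Z n) and (Z n)' = - q (S n) hold exactly. *)
Let S n (x : R) : R := \sum_(0 <= k < n) neumann k x.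
Let Z n (x : R) : R := z0 - \sum_(0 <= k < n) primitive (fun u => q u * neumann k u) x.

Let dZ n x : I x -> is_derive x 1 (Z n) (- (q x * S n x)).
Proof.
move=> Ix; elim: n => [|n IH].
  rewrite /S big_geq // mulr0 oppr0 (_ : Z 0%N = cst z0); first exact: is_derive_cst.
  by apply/funext => y; rewrite /Z big_geq // subr0.
have cqn := cM cq (@neumann_continuous n).
have := is_derive_sub IH ((primitiveP cqn).2 x Ix).
rewrite (_ : (fun y => Z n y - _) = Z n.+1).
  by rewrite /S big_nat_recr //= mulrDr opprD.
by apply/funext => y; rewrite /Z big_nat_recr //= opprD addrA.
Qed.

Let dS n x : I x -> is_derive x 1 (S n.+1) (a x * Z n x).
Proof.
move=> Ix; elim: n => [|n IH].
  rewrite /Z big_geq // subr0 (_ : S 1%N = neumann 0).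
    have := is_derive_add (is_derive_cst y0 x (1 : R))
      (is_derive_mul (is_derive_cst z0 x (1 : R)) ((primitiveP ca).2 x Ix)).
    by rewrite mul0r !add0r /cst mulrC.
  by apply/funext => y; rewrite /S big_nat1.
have cqn := cM ca (cprim (cM cq (@neumann_continuous n))).
have := is_derive_sub IH ((primitiveP cqn).2 x Ix).
rewrite (_ : (fun y => S n.+1 y - _) = S n.+2).
  by rewrite -mulrBr /Z big_nat_recr //= opprD addrA.
by apply/funext => y; rewrite /S [RHS]big_nat_recr.
Qed.

Let S_r0 n : S n.+1 r0 = y0.
Proof.
rewrite /S big_mkord big_ord_recl big1 /= => [|i _].
  by rewrite (primitiveP ca).1 mulr0 !addr0.
have cqn := cM ca (cprim (cM cq (@neumann_continuous i))).
by rewrite (primitiveP cqn).1 oppr0.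
Qed.

Let Z_r0 n : Z n r0 = z0.
Proof.
rewrite /Z big1 ?subr0 // => i _.
by rewrite (primitiveP (cM cq (@neumann_continuous i))).1.
Qed.

Section compact_interval.
Variables (s t : R).
Hypotheses (Is : I s) (It : I t) (sr : s <= r0) (rt : r0 <= t).

Let Ist x : s <= x <= t -> I x. Proof. exact: oitv0_convex. Qed.

(** Each term costs two integrations, each of which gains a factor 2 in the
    exponentially weighted norm. *)
Lemma neumann_bound : exists M C : R, [/\ 0 < M, 0 <= C,
  forall x, s <= x <= t -> `|a x| <= M,
  forall x, s <= x <= t -> `|q x| <= M &
  forall k x, s <= x <= t -> `|neumann k x| <= C / 4 ^+ k * expR (2 * M * `|x - r0|)].
Proof.
have st : s <= t := le_trans sr rt.
have [Ma Ma0 ha] := continuous_bounded_itv st (fun x h => ca (Ist h)).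
have [Mq Mq0 hq] := continuous_bounded_itv st (fun x h => cq (Ist h)).
have [C C0 hC] := continuous_bounded_itv st (fun x h => neumann_continuous (k := 0) (Ist h)).
have M0 : 0 < Ma + Mq by rewrite addr_gt0.
have ha' x : s <= x <= t -> `|a x| <= Ma + Mq by move=> h; rewrite (le_trans (ha x h)) // lerDl ltW.
have hq' x : s <= x <= t -> `|q x| <= Ma + Mq by move=> h; rewrite (le_trans (hq x h)) // lerDr ltW.
exists (Ma + Mq), C; split => //; first exact: ltW.
have rst : s <= r0 <= t by rewrite sr rt.
elim=> [|k IH] x xst.
  rewrite expr0 divr1; apply: (le_trans (hC _ xst)); rewrite ler_peMr ?(ltW C0) //.
  by rewrite -expR0 ler_expR mulr_ge0 // mulr_ge0 // ltW.
rewrite /= normrN.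
have cqn := cM cq (@neumann_continuous k).
have b1 : forall y, s <= y <= t ->
    `|primitive (fun u => q u * neumann k u) y| <= C / 4 ^+ k / 2 * expR (2 * (Ma + Mq) * `|y - r0|).
  apply: (primitive_bound rst M0 (primitiveP cqn).1).
    by move=> y yst; apply: (primitiveP cqn).2; exact: Ist.
  by move=> y yst; rewrite normrM; apply: ler_pM => //; [exact: hq'|exact: IH].
rewrite (_ : C / 4 ^+ k.+1 = C / 4 ^+ k / 2 / 2); last first.
  by rewrite exprS; field; rewrite expf_neq0.
have cqn' := cM ca (cprim cqn).
move: x xst; apply: (primitive_bound rst M0 (primitiveP cqn').1).
  by move=> y yst; apply: (primitiveP cqn').2; exact: Ist.
by move=> y yst; rewrite normrM; apply: ler_pM => //; [exact: ha'|exact: b1].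
Qed.

End compact_interval.

Let y (x : R) : R := limn (fun n => S n x).

Section compact_interval2.
Variables (s t : R).
Hypotheses (Is : I s) (It : I t) (sr : s <= r0) (rt : r0 <= t).
Variables (M C : R).
Hypotheses (M0 : 0 < M) (C0 : 0 <= C).
Hypothesis hN : forall k x, s <= x <= t -> `|neumann k x| <= C / 4 ^+ k * expR (2 * M * `|x - r0|).

Let tail_sum n j x : s <= x <= t ->
  `|S (n + j) x - S n x| <= 2 * C / 4 ^+ n * expR (2 * M * `|x - r0|).
Proof.
move=> xst; set e := expR _; have e0 : 0 <= e by exact: expR_ge0.
suff h : `|S (n + j) x - S n x| + 2 * C / 4 ^+ (n + j) * e <= 2 * C / 4 ^+ n * e.
  by apply: le_trans h; rewrite lerDl mulr_ge0 // divr_ge0 ?exprn_ge0 // mulr_ge0.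
elim: j => [|j IH]; first by rewrite addn0 subrr normr0 add0r.
apply: le_trans IH; rewrite addnS {1}/S big_nat_recr //= -/(S (n + j) x).
rewrite addrAC; have h1 := hN (n + j) xst; rewrite -/e in h1.
apply: (le_trans (lerD (ler_normD _ _) (lexx _))); rewrite -addrA lerD2l.
apply: (le_trans (lerD h1 (lexx _))); rewrite exprS -mulrDl ler_wpM2r //.
rewrite -subr_ge0 (_ : _ - _ = C / 4 ^+ (n + j) / 2).
  by rewrite divr_ge0 // divr_ge0 // exprn_ge0.
by field; rewrite expf_neq0.
Qed.

Let S_cvg x : s <= x <= t -> cvgn (fun n => S n x).
Proof.
move=> xst; suff : cvgn (series (fun k => neumann k x)) by [].
apply: normed_cvg.
apply: (@series_le_cvg _ _ (geometric (C * expR (2 * M * `|x - r0|)) 4^-1)).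
- by move=> n; exact: normr_ge0.
- by move=> n; apply: geometric_ge0; rewrite ?mulr_ge0 ?expR_ge0 ?invr_ge0.
- by move=> n; apply: (le_trans (hN n xst)); rewrite /= exprVn mulrAC.
- by apply: is_cvg_geometric_series; rewrite ger0_norm ?invr_ge0 // invf_lt1 ?ltr1n.
Qed.

Lemma neumann_limit_bound n x : s <= x <= t ->
  `|y x - S n x| <= 2 * C / 4 ^+ n * expR (2 * M * `|x - r0|).
Proof.
move=> xst; have hS := S_cvg xst.
have h : (fun j => `|S (n + j)%N x - S n x|) @ \oo --> `|y x - S n x|.
  apply: cvg_norm; apply: cvgB; last exact: cvg_cst.
  under eq_fun do rewrite addnC.
  exact: (@cvg_comp _ _ _ (fun j => (j + n)%N) (fun m => S m x) _ _ _ (cvg_addnr n) hS).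
rewrite -(cvg_lim _ h) //; apply: limr_le; first by apply/cvg_ex; eexists; exact: h.
by apply: nearW => j; exact: tail_sum.
Qed.

End compact_interval2.

(** The equation is linear, so the Neumann series converges on every compact
    subinterval, and the solution exists on the whole interval. The weighted bounds
    are used once for the continuity of the limit and once to pass to the limit in
    the system. *)
Lemma linear_system_exists : exists y z : R -> R, [/\ y r0 = y0, z r0 = z0,
  forall x, I x -> is_derive x 1 y (a x * z x) &
  forall x, I x -> is_derive x 1 z (- (q x * y x))].
Proof.
have around x : I x -> exists s t, [/\ I s, I t, s <= r0, r0 <= t & s < x < t].
  move=> Ix.
  have [s smin Is] : exists2 s, s < Num.min x r0 & I s.
    by apply: oitv0_lt; case: (leP x r0).
  have [t tmax It] : exists2 t, Num.max x r0 < t & I t.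
    by apply: oitv0_gt; case: (leP x r0).
  move: smin tmax; rewrite lt_min gt_max => /andP[sx sr] /andP[xt rt].
  by exists s, t; split => //; rewrite ?ltW // sx.
have small K : 0 <= K -> forall e : R, 0 < e -> exists n : nat, K / 4 ^+ n <= e.
  move=> K0 e e0; have q1 : `|4^-1 : R| < 1.
    by rewrite ger0_norm ?invr_ge0 // invf_lt1 ?ltr1n.
  have /cvgrPdist_le/(_ e e0)[n _ /(_ n (leqnn n))] := cvg_geometric K q1.
  move=> h; exists n; apply: le_trans h.
  by rewrite sub0r normrN /= exprVn ler_norm.
have cS n x : I x -> {for x, continuous (S n)}.
  move=> Ix; rewrite /S; elim: n => [|n IH].
    rewrite (_ : (fun _ => _) = cst 0); first exact: cvg_cst.
    by apply/funext => u; rewrite big_geq.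
  rewrite (_ : (fun _ => _) = (fun u => \sum_(0 <= k < n) neumann k u + neumann n u)).
    by apply: continuousD => //; exact: neumann_continuous.
  by apply/funext => u; rewrite big_nat_recr.
have cy x : I x -> {for x, continuous y}.
  move=> Ix; have [s [t [Is It sr rt /andP[sx xt]]]] := around x Ix.
  have [M [C [M0 C0 _ _ hN]]] := neumann_bound Is It sr rt.
  have st : s <= t := le_trans sr rt.
  have [E E0 hE] : exists2 E : R, 0 < E & forall u, s <= u <= t -> expR (2 * M * `|u - r0|) <= E.
    exists (expR (2 * M * (t - s))); first exact: expR_gt0.
    move=> u /andP[su ut]; rewrite ler_expR ler_wpM2l //; first by rewrite mulr_ge0 // ltW.
    by rewrite ler_norml; apply/andP; split; lra.
  apply/cvgrPdist_le => e e0.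
  have e3 : 0 < e / 3 by rewrite divr_gt0.
  have [n hn] := small (2 * C * E) (mulr_ge0 (mulr_ge0 (ler0n R 2) C0) (ltW E0)) _ e3.
  have bd u : s <= u <= t -> `|y u - S n u| <= e / 3.
    move=> ust; apply: le_trans hn; apply: (le_trans (neumann_limit_bound C0 hN n ust)).
    rewrite [leRHS]mulrAC; apply: ler_wpM2l (hE u ust).
    by rewrite divr_ge0 ?exprn_ge0 // mulr_ge0.
  have /cvgrPdist_le/(_ _ e3) := cS n x Ix.
  move=> cSn; near=> u.
  have ust : s <= u <= t.
    by apply/andP; split; near: u; [exact: lt_le_nbhsr|exact: lt_le_nbhsl].
  have xst : s <= x <= t by rewrite !ltW.
  have h1 := bd u ust; have h2 := bd x xst.
  have h3 : `|S n x - S n u| <= e / 3 by near: u.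
  rewrite (_ : y x - y u = (y x - S n x) + (S n x - S n u) - (y u - S n u)); last by ring.
  rewrite (le_trans (ler_normB _ _)) //.
  have := ler_normD (y x - S n x) (S n x - S n u).
  by move: h1 h2 h3; lra.
have cqy := cM cq cy; have [Q0 dQ] := primitiveP cqy.
pose z x := z0 - primitive (fun u => q u * y u) x.
have dz x : I x -> is_derive x 1 z (- (q x * y x)).
  move=> Ix; have := is_derive_sub (is_derive_cst z0 x (1 : R)) (dQ x Ix).
  by rewrite sub0r.
have cz x : I x -> {for x, continuous z} by move=> Ix; exact: is_derive_continuous (dz x Ix).
have [P0 dP] := primitiveP (cM ca cz).
pose y' x := y0 + primitive (fun u => a u * z u) x.
have dy' x : I x -> is_derive x 1 y' (a x * z x).
  move=> Ix; have := is_derive_add (is_derive_cst y0 x (1 : R)) (dP x Ix).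
  by rewrite add0r.
have yy' x : I x -> y' x = y x.
  move=> Ix; have [s [t [Is It sr rt /andP[/ltW sx /ltW xt]]]] := around x Ix.
  have [M [C [M0 C0 ha hq hN]]] := neumann_bound Is It sr rt.
  have rst : s <= r0 <= t by rewrite sr rt.
  have Ist u : s <= u <= t -> I u by exact: oitv0_convex.
  have bz n u : s <= u <= t ->
      `|z u - Z n u| <= 2 * C / 4 ^+ n / 2 * expR (2 * M * `|u - r0|).
    move: u; apply: (primitive_bound (F := fun u => - (q u * y u) - - (q u * S n u)) rst M0).
    - by rewrite Z_r0 /z Q0 subr0 subrr.
    - by move=> u ust; apply: is_derive_sub; [exact/dz/Ist|exact/dZ/Ist].
    move=> u ust; rewrite opprK addrC -mulrBr normrM; apply: ler_pM => //; first exact: hq.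
    by rewrite -normrN opprB; exact: (neumann_limit_bound C0 hN).
  have by' n u : s <= u <= t ->
      `|y' u - S n.+1 u| <= 2 * C / 4 ^+ n / 2 / 2 * expR (2 * M * `|u - r0|).
    move: u; apply: (primitive_bound (F := fun u => a u * z u - a u * Z n u) rst M0).
    - by rewrite S_r0 /y' P0 addr0 subrr.
    - by move=> u ust; apply: is_derive_sub; [exact/dy'/Ist|exact/dS/Ist].
    move=> u ust; rewrite -mulrBr normrM; apply: ler_pM => //; first exact: ha.
    exact: bz.
  apply/eqP; rewrite -subr_eq0 -normr_le0; apply/ler_addgt0Pr => e e0; rewrite add0r.
  set w := expR (2 * M * `|x - r0|).
  have w0 : 0 < w by exact: expR_gt0.
  have [n hn] := small (C * w) (mulr_ge0 C0 (ltW w0)) e e0.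
  have xst : s <= x <= t by rewrite sx xt.
  apply: le_trans hn.
  have h1 := by' n x xst; have h2 := neumann_limit_bound C0 hN n.+1 xst; rewrite -/w in h1 h2.
  rewrite (_ : y' x - y x = (y' x - S n.+1 x) - (y x - S n.+1 x)); last by ring.
  rewrite (le_trans (ler_normB _ _)) // (le_trans (lerD h1 h2)) //.
  rewrite exprS le_eqVlt; apply/orP; left; apply/eqP; field; by rewrite expf_neq0.
exists y', z; split.
- by rewrite /y' P0 addr0.
- by rewrite /z Q0 subr0.
- exact: dy'.
- by move=> x Ix; rewrite yy' //; exact: dz.
Unshelve. all: by end_near. Qed.

End linear_system.

(** * Compactly supported functions on (0, rho) *)
Section compactly_supported.
Variables (R : realType) (rho : \bar R).
Implicit Types (F G v y : R -> R).
Local Notation I := (oitv0 rho).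
Local Notation J := (@integral_line R).

Definition Cc F := continuous F /\ exists s t, [/\ I s, I t & vanish_outside s t F].

Lemma vanish_outsideW s t s' t' F : s' <= s -> t <= t' ->
  vanish_outside s t F -> vanish_outside s' t' F.
Proof.
move=> ss tt h x /orP[xs|tx]; apply: h.
  by rewrite (lt_le_trans xs ss).
by rewrite (le_lt_trans tt tx) orbT.
Qed.

Lemma Cc_off F x : Cc F -> ~ I x -> F x = 0.
Proof. by move=> [_ [s [t [Is It h]]]] nIx; apply: h; exact: oitv0_outside nIx. Qed.

Lemma vanish_outside_common F G : Cc F -> Cc G ->
  exists s t, [/\ I s, I t, vanish_outside s t F & vanish_outside s t G].
Proof.
move=> [_ [s [t [Is It hF]]]] [_ [s' [t' [Is' It' hG]]]].
exists (Num.min s s'), (Num.max t t'); split.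
- by case: leP.
- by case: leP.
- by apply: vanish_outsideW hF; [rewrite ge_min lexx|rewrite le_max lexx].
- by apply: vanish_outsideW hG; [rewrite ge_min lexx orbT|rewrite le_max lexx orbT].
Qed.

Lemma vanish_outside_near s t F x : vanish_outside s t F -> (x < s) || (t < x) ->
  \forall y \near x, F y = 0.
Proof.
by move=> h /orP[xs|tx]; near=> y; apply: h; apply/orP; [left|right];
  near: y; [exact: lt_nbhsl|exact: lt_nbhsr].
Unshelve. all: by end_near. Qed.

Lemma vanish_outside_continuous s t F : I s -> I t -> vanish_outside s t F ->
  (forall x, I x -> {for x, continuous F}) -> continuous F.
Proof.
move=> Is It h cF x; have [xst|] := boolP (s <= x <= t).
  by apply: cF; exact: oitv0_convex xst.
rewrite negb_and -!ltNge => xst; have e := h x xst.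
have := vanish_outside_near h xst; rewrite /continuous_at e => near0.
exact: (@cvg_near_cst R R 0 F (nbhs x) _ near0).
Qed.

Lemma Cc_mul (g F : R -> R) : (forall x, I x -> {for x, continuous g}) -> Cc F -> Cc (fun x => g x * F x).
Proof.
move=> cg [cF [s [t [Is It h]]]].
have h' : vanish_outside s t (fun x => g x * F x) by move=> x /h ->; rewrite mulr0.
split; last by exists s, t.
apply: (vanish_outside_continuous Is It h') => x Ix.
by apply: continuousM; [exact: cg|exact: cF].
Qed.

Lemma CcM F G : Cc F -> Cc G -> Cc (fun x => F x * G x).
Proof. by move=> [cF _]; apply: Cc_mul => x _; exact: cF. Qed.

Lemma Cc_sqr F : Cc F -> Cc (fun x => F x ^+ 2).
Proof. exact: (fun h => CcM h h). Qed.

Lemma CcZ c F : Cc F -> Cc (fun x => c * F x).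
Proof. by apply: Cc_mul => x _; exact: cvg_cst. Qed.

Lemma CcD F G : Cc F -> Cc G -> Cc (fun x => F x + G x).
Proof.
move=> hF hG; have [s [t [Is It h h']]] := vanish_outside_common hF hG.
split; last by exists s, t; split => // x xst; rewrite h // h' // addr0.
by move=> x; apply: continuousD; [exact: hF.1|exact: hG.1].
Qed.

Lemma CcB F G : Cc F -> Cc G -> Cc (fun x => F x - G x).
Proof.
move=> hF hG; have := CcD hF (CcZ (-1) hG).
by rewrite (_ : (fun _ => _) = fun x => F x - G x) //; apply/funext => x; rewrite mulN1r.
Qed.

Lemma integral_CcD F G : Cc F -> Cc G -> J (fun x => F x + G x) = J F + J G.
Proof.
move=> hF hG; have [s [t [Is It h h']]] := vanish_outside_common hF hG.
by rewrite (integral_lineD _ _ h h') //; [exact: hF.1|exact: hG.1].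
Qed.

Lemma integral_CcB F G : Cc F -> Cc G -> J (fun x => F x - G x) = J F - J G.
Proof.
move=> hF hG; have [s [t [Is It h h']]] := vanish_outside_common hF hG.
by rewrite (integral_lineB _ _ h h') //; [exact: hF.1|exact: hG.1].
Qed.

Lemma integral_CcZ c F : Cc F -> J (fun x => c * F x) = c * J F.
Proof. by move=> [cF [s [t [Is It h]]]]; rewrite (integral_lineZ _ _ h). Qed.

Lemma integral_Cc_le F G : Cc F -> Cc G -> (forall x, F x <= G x) -> J F <= J G.
Proof.
move=> hF hG; have [s [t [Is It h h']]] := vanish_outside_common hF hG.
by apply: (integral_line_le _ _ h h') => //; [exact: hF.1|exact: hG.1].
Qed.

Lemma integral_derive G F s t : I s -> I t -> vanish_outside s t G -> Cc F ->
  (forall x, I x -> is_derive x 1 G (F x)) -> J F = 0.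
Proof.
move=> Is It hG hF dG; have [cF [s' [t' [Is' It' hF']]]] := hF.
apply: (integral_line_derive (s := s) (t := t) (G := G)) => // x.
have [Ix|nIx] := pselect (I x); first exact: dG.
have out := oitv0_outside Is It nIx.
rewrite hF' ?(oitv0_outside Is' It') //; apply: is_derive_near (is_derive_cst (0 : R) x (1 : R)).
by apply: filterS (vanish_outside_near hG out) => y ->.
Qed.

Lemma integral_ub F s t (M : R) : s <= t -> continuous F -> vanish_outside s t F ->
  (forall x, s <= x <= t -> F x <= M) -> J F <= M * (t - s).
Proof.
move=> st cF h hM; rewrite (integral_line_itv h).
have -> : M * (t - s) = \int[lebesgue_measure]_(x in `[s, t]) M.
  rewrite Rintegral_cst //= lebesgue_measure_itv /= lte_fin.
  case: ltP => // ts; rewrite /= (_ : t - s = 0) //.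
  by apply/eqP; rewrite subr_eq0 eq_le st ts.
apply: le_Rintegral => //.
- by apply: itv_integrable => x _; exact: cF.
- by apply: itv_integrable => x _; exact: cvg_cst.
Qed.

Lemma integral_lb F s t (M : R) : s <= t -> Cc F -> (forall x, 0 <= F x) ->
  (forall x, s <= x <= t -> M <= F x) -> M * (t - s) <= J F.
Proof.
move=> st [cF [s' [t' [_ _ h]]]] F0 hM.
have -> : M * (t - s) = \int[lebesgue_measure]_(x in `[s, t]) M.
  rewrite Rintegral_cst //= lebesgue_measure_itv /= lte_fin.
  case: ltP => // ts; rewrite /= (_ : t - s = 0) //.
  by apply/eqP; rewrite subr_eq0 eq_le st ts.
rewrite Rintegral_mkcond.
have mI : measurable (`[s, t]%classic : set (measurableTypeR R)) by exact: measurable_itv.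
apply: le_Rintegral => //.
- rewrite -restrict_EFin.
  refine ((integrable_mkcond (mu := lebesgue_measure) (EFin \o (fun=> M)) mI).1 _).
  by apply: itv_integrable => x _; exact: cvg_cst.
- exact: (vanish_outside_integrable cF h).
- move=> x _; rewrite patchE; case: ifPn => [|_] //.
  by rewrite inE /= in_itv /= => /hM.
Qed.

Definition test_line v := smooth_on setT v /\ exists s t, [/\ I s, I t & vanish_outside s t v].

Lemma test_line_Cc v : test_line v -> Cc v.
Proof. by move=> [sv hv]; split => // x; exact: smooth_on_continuous sv _. Qed.

Lemma test_line_is_derive v (x : R) : test_line v -> is_derive x 1 v (derive1 v x).
Proof. by move=> [sv _]; exact: smooth_on_is_derive sv _. Qed.

Lemma test_line_derive1 v : test_line v -> test_line (derive1 v).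
Proof.
move=> [sv [s [t [Is It h]]]]; split; first exact: smooth_on_derive1.
exists s, t; split => // x xst; apply: is_derive1E.
apply: is_derive_near (is_derive_cst (0 : R) x (1 : R)).
by apply: filterS (vanish_outside_near h xst) => y ->.
Qed.

Lemma smooth_vanish_outside s t v : I s -> I t -> vanish_outside s t v ->
  smooth_on I v -> smooth_on setT v.
Proof.
move=> Is It h sv k x _.
have [xst|] := boolP (s <= x <= t).
  by apply: sv; exact: oitv0_convex xst.
rewrite negb_and -!ltNge => xst.
have oA : open [set y : R | (y < s) || (t < y)].
  rewrite (_ : [set _ | _] = `]-oo, s[%classic `|` `]t, +oo[%classic).
    by apply: openU; [exact: lray_open|exact: rray_open].
  apply/seteqP; split => y /=; rewrite !in_itv /= andbT.
    by move/orP.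
  by move=> [->//|->]; rewrite orbT.
have := @smooth_on_ext R _ (fun=> 0) v oA _ (@smooth_on_cst R _ 0).
by apply => // y /h ->.
Qed.

Lemma test_line_mul (g v : R -> R) : smooth_on I g -> test_line v -> test_line (fun x => g x * v x).
Proof.
move=> sg [sv [s [t [Is It h]]]].
have h' : vanish_outside s t (fun x => g x * v x) by move=> x /h ->; rewrite mulr0.
split; last by exists s, t.
apply: (smooth_vanish_outside Is It h').
apply: smooth_onM => //; first exact: oitv0_open.
exact: smooth_on_subset sv.
Qed.

Lemma test_lineD v w : test_line v -> test_line w -> test_line (fun x => v x + w x).
Proof.
move=> hv hw; split.
  by apply: smooth_onD; [exact: openT|exact: hv.1|exact: hw.1].
by have [_] := CcD (test_line_Cc hv) (test_line_Cc hw).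
Qed.

Lemma test_line_plateau a0 a1 b1 b0 : a0 < a1 -> b1 < b0 -> I a0 -> I b0 ->
  test_line (plateau a0 a1 b1 b0).
Proof.
move=> a01 b10 Ia Ib; split; first exact: smooth_plateau.
exists a0, b0; split => // x /orP[/ltW xa|/ltW bx].
  by rewrite plateau0l.
by rewrite plateau0r.
Qed.

End compactly_supported.

(** * Disconjugacy *)
Section disconjugacy.
Variables (R : realType) (rho : \bar R) (n : nat) (W : R -> R).
Hypothesis sW : smooth_on (oitv0 rho) W.
Implicit Types (F G v y z : R -> R) (c : R).
Local Notation I := (oitv0 rho).
Local Notation J := (@integral_line R).
Local Notation Cc := (Cc rho).
Local Notation test_line := (test_line rho).

Definition energy v := J (fun r => r ^+ n * derive1 v r ^+ 2).
Definition potential v := J (fun r => r ^+ n * (W r * v r ^+ 2)).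

Let oI : open I. Proof. exact: oitv0_open. Qed.

Let sX m : smooth_on I (fun r : R => r ^+ m).
Proof. exact: smooth_onX oI (smooth_on_id oI). Qed.

Let sXV : smooth_on I (fun r : R => r ^- n).
Proof.
apply: (smooth_onV (f := fun r => r ^+ n) oI _ (@sX n)) => x [x0 _].
by rewrite expf_neq0 // gt_eqF.
Qed.

Let cX m x : I x -> {for x, continuous (fun r : R => r ^+ m)}.
Proof. by move=> Ix; exact: smooth_on_continuous (@sX m) Ix. Qed.

Let cW x : I x -> {for x, continuous W}.
Proof. by move=> Ix; exact: smooth_on_continuous sW Ix. Qed.

Lemma Cc_energy v : test_line v -> Cc (fun r => r ^+ n * derive1 v r ^+ 2).
Proof.
move=> hv; apply: Cc_mul; first exact: cX.
exact/Cc_sqr/test_line_Cc/test_line_derive1.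
Qed.

Lemma Cc_potential v : test_line v -> Cc (fun r => r ^+ n * (W r * v r ^+ 2)).
Proof.
move=> hv; apply: Cc_mul; first exact: cX.
by apply: Cc_mul => //; exact/Cc_sqr/test_line_Cc.
Qed.

Section solution.
Variables (c : R) (y z : R -> R).
Hypothesis dy : forall x, I x -> is_derive x 1 y (x ^- n * z x).
Hypothesis dz : forall x, I x -> is_derive x 1 z (- (c * x ^+ n * W x * y x)).

Let pos x : I x -> 0 < x. Proof. by case. Qed.

Let scW : smooth_on I (fun r => c * r ^+ n * W r).
Proof. exact: smooth_onM oI (smooth_onM oI (@smooth_on_cst R I c) (@sX n)) sW. Qed.

Lemma solution_smooth : smooth_on I y /\ smooth_on I z.
Proof.
suff h k : cn k I y /\ cn k I z by split; apply/smooth_onP => k; have [] := h k.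
elim: k => [|k [hy hz]]; first by split=> -[].
have /smooth_onP/(_ k) h1 := sXV; have /smooth_onP/(_ k) h2 := scW.
split; [apply: (cn_derive oI dy)|apply: (cn_derive oI dz)]; first exact: cnM.
have := cnM oI (@cn_cst R k I (-1)) (cnM oI h2 hy).
by apply: cn_ext => // x _; rewrite mulN1r.
Qed.

(** Picone's identity: r^n (y f)'^2 - c r^n W (y f)^2 differs from
    r^n y^2 f'^2 by the total derivative of z y f^2. *)
Lemma solution_energy f : test_line f ->
  test_line (fun r => y r * f r) /\
  energy (fun r => y r * f r) - c * potential (fun r => y r * f r) =
  J (fun r => r ^+ n * (y r * derive1 f r) ^+ 2).
Proof.
have [sy sz] := solution_smooth; move=> hf.
have hv := test_line_mul sy hf; split=> //.
have cy x : I x -> {for x, continuous y} by exact: smooth_on_continuous sy.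
have CE := Cc_energy hv; have CP := Cc_potential hv.
have CF : Cc (fun r => r ^+ n * (y r * derive1 f r) ^+ 2).
  by apply: Cc_mul; [exact: cX|exact/Cc_sqr/Cc_mul/test_line_Cc/test_line_derive1].
rewrite /energy /potential -(integral_CcZ _ CP) -(integral_CcB CE (CcZ c CP)).
apply/eqP; rewrite -subr_eq0 -(integral_CcB (CcB CE (CcZ c CP)) CF); apply/eqP.
have [_ [s [t [Is It h]]]] := hf.
apply: (@integral_derive R rho (fun r => z r * (y r * f r ^+ 2)) _ s t Is It).
- by move=> x /h ->; rewrite expr0n /= !mulr0.
- exact: CcB (CcB CE (CcZ c CP)) CF.
move=> x Ix.
have df := test_line_is_derive x hf.
have -> : derive1 (fun r => y r * f r) x = x ^- n * z x * f x + y x * derive1 f x.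
  exact: is_derive1E (is_derive_mul (dy Ix) df).
have := is_derive_mul (dz Ix) (is_derive_mul (dy Ix) (is_derive_pow 2 df)).
move=> [h1 h2]; apply: DeriveDef => //; rewrite h2 /=.
have X0 : x ^+ n != 0 by rewrite expf_neq0 // gt_eqF // pos.
by move: (x ^+ n) X0 => X X0; field.
Qed.

End solution.

Lemma integral_plateau_le (a0 a1 b1 b0 : R) : a0 < a1 -> b1 < b0 -> a0 <= b0 ->
  J (plateau a0 a1 b1 b0) <= b0 - a0.
Proof.
move=> a01 b10 ab; rewrite -[b0 - a0]mul1r; apply: integral_ub => //.
- by move=> x; exact: (smooth_on_continuous (@smooth_plateau R a0 a1 b1 b0) Logic.I).
- by move=> x /orP[/ltW h|/ltW h]; [rewrite plateau0l|rewrite plateau0r].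
- by move=> x _; exact: plateau_le1.
Qed.

Lemma derive1_plateau0 (a0 a1 b1 b0 x : R) : a0 < a1 -> b1 < b0 ->
  [|| x < a0, a1 < x < b1 | b0 < x] -> derive1 (plateau a0 a1 b1 b0) x = 0.
Proof.
move=> a01 b10 hx; apply: is_derive1E.
have flat_f (A : set R) (k : R) : open A -> A x -> (forall u, A u -> plateau a0 a1 b1 b0 u = k) ->
    is_derive x 1 (plateau a0 a1 b1 b0) 0.
  move=> oA Ax fk; apply: (is_derive_open (f := cst k) oA Ax) => u Au.
  by rewrite fk.
case/or3P: hx => hx.
- apply: (flat_f `]-oo, a0[%classic 0); [exact: lray_open|by rewrite /= in_itv|].
  by move=> u /=; rewrite in_itv /= => /ltW ua; rewrite plateau0l.
- apply: (flat_f `]a1, b1[%classic 1); [exact: itv_open|by rewrite /= in_itv|].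
  by move=> u /=; rewrite in_itv /= => /andP[/ltW u1 /ltW u2]; rewrite plateau1.
- apply: (flat_f `]b0, +oo[%classic 0); [exact: rray_open|by rewrite /= in_itv /= hx|].
  by move=> u /=; rewrite in_itv /= andbT => /ltW ua; rewrite plateau0r.
Qed.

(** Cutting off y, vanishing at a and b, at distance e from the two zeros costs
    O(e): on the two transition layers y = O(e), the cutoff has slope O(1/e), and
    the layers have length e. *)
Lemma cutoff_energy_le y (a b L : R) : 0 < L -> I a -> I b -> a < b ->
  (forall x, I x -> {for x, continuous y}) ->
  (forall x, a <= x <= b -> `|y x| <= L * (x - a) /\ `|y x| <= L * (b - x)) ->
  exists2 B : R, 0 <= B & forall e, 0 < e -> 5 * e < b - a ->
    J (fun r => r ^+ n * (y r * derive1 (plateau (a + e) (a + 2 * e) (b - 2 * e) (b - e)) r) ^+ 2)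
      <= B * (6 * e).
Proof.
move=> L0 Ia Ib ab cy hy; have a0 : 0 < a by case: Ia.
have brk (e : R) : 0 < e -> 5 * e < b - a ->
    [/\ [/\ a < a + e, a + e < a + 2 * e, a + 2 * e < a + 3 * e & a + 3 * e < b],
        [/\ b - e < b, b - 2 * e < b - e, b - 3 * e < b - 2 * e & a < b - 3 * e] &
        a + 2 * e < b - 2 * e].
  by move=> e0 ele; split; [split; lra|split; lra|lra].
have len (e : R) : [/\ a + 2 * e - (a + e) = e, b - e - (b - 2 * e) = e,
    a + 3 * e - a + (b - (b - 3 * e)) = 6 * e, a + 2 * e - a = 2 * e & b - (b - 2 * e) = 2 * e].
  by split; ring.
have [K K0 hK] := derive1_step_bounded R.
pose B := b ^+ n * (L * 2 * (2 * K)) ^+ 2.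
have B0 : 0 <= B by rewrite mulr_ge0 ?sqr_ge0 // exprn_ge0 // ltW // (lt_trans a0 ab).
exists B => // e e0 ele; set f := plateau (a + e) _ _ _.
have [[l1 l2 l3 l4] [l5 l6 l7 l8] l9] := brk e e0 ele.
have [len1 len2 len3 len4 len5] := len e.
have l1' := ltW l1; have l2' := ltW l2; have l3' := ltW l3.
have Iab x : a <= x -> x <= b -> I x by move=> ax xb; apply: (oitv0_convex Ia Ib); rewrite ax.
have Ia3 : I (a + 3 * e) by apply: Iab; rewrite ?(ltW l4) // (le_trans l1') // (le_trans l2').
have Ib3 : I (b - 3 * e) by apply: Iab; rewrite ?(ltW l8) // (le_trans (ltW l7)) // (le_trans (ltW l6)) // ltW.
have Iae : I (a + e) by apply: Iab => //; rewrite (le_trans l2') // (le_trans l3') // ltW.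
have Ibe : I (b - e) by apply: Iab; rewrite ?(ltW l5) // (le_trans (ltW l8)) // (le_trans (ltW l7)) // ltW.
pose p1 := plateau a (a + e) (a + 2 * e) (a + 3 * e).
pose p2 := plateau (b - 3 * e) (b - 2 * e) (b - e) b.
have C1 : Cc p1 by exact/test_line_Cc/test_line_plateau.
have C2 : Cc p2 by exact/test_line_Cc/test_line_plateau.
have Cf : test_line f by exact: test_line_plateau.
have CF : Cc (fun r => r ^+ n * (y r * derive1 f r) ^+ 2).
  by apply: Cc_mul; [exact: cX|exact/Cc_sqr/Cc_mul/test_line_Cc/test_line_derive1].
apply: (@le_trans _ _ (J (fun x => B * (p1 x + p2 x)))); last first.
  rewrite (integral_CcZ _ (CcD C1 C2)) (integral_CcD C1 C2); apply: ler_wpM2l => //.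
  have h1 : J p1 <= a + 3 * e - a.
    by apply: integral_plateau_le => //; rewrite (le_trans l1') // (le_trans l2') // ltW.
  have h2 : J p2 <= b - (b - 3 * e).
    by apply: integral_plateau_le => //; rewrite (le_trans (ltW l7)) // (le_trans (ltW l6)) // ltW.
  by rewrite (le_trans (lerD h1 h2)) // len3.
apply: integral_Cc_le CF (CcZ _ (CcD C1 C2)) _ => x.
have p10 : 0 <= p1 x by exact: plateau_ge0.
have p20 : 0 <= p2 x by exact: plateau_ge0.
have dK : `|derive1 f x| <= 2 * K / e.
  by apply: derive1_plateau_le => //; rewrite ?len1 ?len2.
have bound : a <= x <= b -> `|y x| <= L * (2 * e) ->
    x ^+ n * (y x * derive1 f x) ^+ 2 <= B.
  move=> /andP[ax xb] yx; have x0 : 0 <= x by exact: le_trans (ltW a0) ax.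
  apply: ler_pM; [exact: exprn_ge0|exact: sqr_ge0| |].
    by apply: lerXn2r; rewrite ?nnegrE // (le_trans x0).
  rewrite -real_normK ?num_real //; apply: lerXn2r; rewrite ?nnegrE //.
    by rewrite !mulr_ge0 // ltW.
  rewrite normrM (_ : L * 2 * (2 * K) = L * (2 * e) * (2 * K / e)); first exact: ler_pM.
  by field; rewrite gt_eqF.
have flat0 : derive1 f x = 0 -> x ^+ n * (y x * derive1 f x) ^+ 2 <= B * (p1 x + p2 x).
  by move=> ->; rewrite mulr0 expr0n mulr0 mulr_ge0 ?addr_ge0.
have [xa|xa] := ltP x (a + e); first by apply: flat0; rewrite derive1_plateau0 // xa.
have ax : a <= x by exact: le_trans (ltW l1) xa.
have [xa'|xa'] := leP x (a + 2 * e).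
  have -> : p1 x = 1 by rewrite /p1 plateau1.
  have xb : x <= b.
    by rewrite (le_trans xa') // (le_trans (ltW l9)) // (le_trans (ltW l6)) // ltW.
  apply: (le_trans (bound _ _)); first by rewrite ax.
    have [h _] := hy x (introT andP (conj ax xb)); apply: (le_trans h).
    by rewrite ler_pM2l // -len4 lerD2r.
  by rewrite mulrDr mulr1 lerDl mulr_ge0.
have [xb|xb] := ltP x (b - 2 * e); first by apply: flat0; rewrite derive1_plateau0 // xa' xb orbT.
have [xb'|xb'] := leP x (b - e).
  have -> : p2 x = 1 by rewrite /p2 plateau1.
  have xb2 : x <= b by exact: le_trans xb' (ltW l5).
  apply: (le_trans (bound _ _)); first by rewrite ax.
    have [_ h] := hy x (introT andP (conj ax xb2)); apply: (le_trans h).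
    by rewrite ler_pM2l // -len5 lerD2l lerN2.
  by rewrite mulrDr mulr1 lerDr mulr_ge0.
by apply: flat0; rewrite derive1_plateau0 // xb' !orbT.
Qed.

(** If y vanishes at a and b, cutting y off near its zeros gives test functions
    whose energy minus c/2 times their potential is O(e). The inequality with the
    constant c makes this difference at least half of the energy, which stays
    bounded below around any point of the interval where z does not vanish. *)
Lemma disconjugate c y z (a b m : R) : 0 < c ->
  (forall v, test_line v -> c * potential v <= energy v) ->
  (forall x, I x -> is_derive x 1 y (x ^- n * z x)) ->
  (forall x, I x -> is_derive x 1 z (- (c / 2 * x ^+ n * W x * y x))) ->
  I a -> I b -> y a = 0 -> y b = 0 -> a < m < b -> z m = 0.
Proof.
move=> c0 hc dy dz Ia Ib ya yb /andP[am mb].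
apply/eqP/negPn/negP => zm0.
have [sy sz] := solution_smooth dy dz.
have Iab x : a <= x <= b -> I x by exact: oitv0_convex.
have ab : a <= b by lra.
have a0 : 0 < a by case: Ia.
have [L L0 hL] : exists2 L : R, 0 < L & forall x, a <= x <= b -> `|x ^- n * z x| <= L.
  apply: continuous_bounded_itv => // x /Iab Ix.
  exact: (smooth_on_continuous (smooth_onM oI sXV sz) Ix).
have lip u w : a <= u -> u <= w -> w <= b -> `|y w - y u| <= L * (w - u).
  move=> au; rewrite le_eqVlt => /predU1P[-> _|uw wb]; first by rewrite !subrr normr0 mulr0.
  have h x : u <= x <= w -> is_derive x 1 y (x ^- n * z x).
    by move=> /andP[ux xw]; apply/dy/Iab; rewrite (le_trans au ux) (le_trans xw wb).
  have [x /andP[ux xw] ->] := MVT_is_derive uw h.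
  rewrite normrM (ger0_norm (_ : 0 <= w - u)); last lra.
  by rewrite ler_wpM2r ?hL //; [lra|apply/andP; split; lra].
have hy x : a <= x <= b -> `|y x| <= L * (x - a) /\ `|y x| <= L * (b - x).
  move=> /andP[ax xb]; split.
    by have := lip a x (lexx _) ax xb; rewrite ya subr0.
  by have := lip x b ax xb (lexx _); rewrite yb sub0r normrN.
have cy x : I x -> {for x, continuous y} by exact: smooth_on_continuous sy.
have [B B0 upper] := cutoff_energy_le L0 Ia Ib (lt_trans am mb) cy hy.
pose f e := plateau (a + e) (a + 2 * e) (b - 2 * e) (b - e).
have tf e : 0 < e -> 5 * e < b - a -> test_line (f e).
  move=> e0 ele.
  by apply: test_line_plateau; [lra|lra|apply: Iab; lra|apply: Iab; lra].
have Im : I m by apply: Iab; lra.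
have [tau [tau0 tam tbm [k k0 hk]]] : exists tau : R, [/\ 0 < tau, a < m - tau, m + tau < b &
    exists2 k : R, 0 < k & forall x, m - tau <= x <= m + tau -> k <= x ^+ n * (x ^- n * z x) ^+ 2].
  pose g x := x ^+ n * (x ^- n * z x) ^+ 2.
  have g0 : 0 < g m.
    have mn : 0 < m ^+ n by rewrite exprn_gt0 //; lra.
    by rewrite mulr_gt0 // exprn_even_gt0 //= mulf_neq0 // invr_eq0 gt_eqF.
  have cg : {for m, continuous g}.
    have s2 : smooth_on I (fun x : R => (x ^- n * z x) ^+ 2).
      exact: smooth_onX oI (smooth_onM oI sXV sz).
    exact: (smooth_on_continuous (smooth_onM oI (@sX n) s2) Im).
  have g2 : 0 < g m / 2 by lra.
  have /cvgrPdist_lt/(_ _ g2)/nbhs_ballP[e /= e0 he] := cg.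
  exists (Num.min e (Num.min (m - a) (b - m)) / 2).
  have [h1 h2 h3] : [/\ Num.min e (Num.min (m - a) (b - m)) <= e,
      Num.min e (Num.min (m - a) (b - m)) <= m - a & Num.min e (Num.min (m - a) (b - m)) <= b - m].
    by split; rewrite !ge_min lexx ?orbT.
  have h0 : 0 < Num.min e (Num.min (m - a) (b - m)).
    by rewrite !lt_min e0 /=; apply/andP; split; lra.
  split; [lra|lra|lra|].
  exists (g m / 2) => // x xm.
  have := he x _; rewrite /ball /= => h.
  have : `|g m - g x| < g m / 2 by apply: h; rewrite ltr_norml; lra.
  by rewrite ltr_norml => /andP[_]; rewrite -/(g x); lra.
have lower e : 0 < e -> 5 * e < b - a -> 2 * e < m - tau - a -> 2 * e < b - (m + tau) ->
    k * (2 * tau) <= energy (fun r => y r * f e r).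
  move=> e0 e5 e1 e2.
  have tv : test_line (fun r => y r * f e r) by apply: test_line_mul => //; exact: tf.
  rewrite (_ : 2 * tau = m + tau - (m - tau)); last by ring.
  apply: integral_lb; [lra|exact: Cc_energy| |].
    move=> x; have [Ix|nIx] := pselect (I x); last by rewrite (Cc_off (Cc_energy tv) nIx).
    by rewrite mulr_ge0 ?sqr_ge0 // exprn_ge0 // ltW //; case: Ix.
  move=> x xm; rewrite (_ : derive1 _ x = x ^- n * z x); first exact: hk.
  apply: is_derive1E.
  have oA : open (`]a + 2 * e, b - 2 * e[%classic : set R) by exact: itv_open.
  have Ax : `]a + 2 * e, b - 2 * e[%classic x by rewrite /= in_itv /=; lra.
  apply: (is_derive_open oA Ax (f := y)); last by apply/dy/Iab; lra.
  move=> u; rewrite /= in_itv /= => /andP[/ltW u1 /ltW u2].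
  by rewrite /f plateau1 ?mulr1 //; lra.
have contra e : 0 < e -> 5 * e < b - a -> 2 * e < m - tau - a -> 2 * e < b - (m + tau) ->
    k * (2 * tau) <= B * 12 * e.
  move=> e0 e1 e2 e3.
  have [tv id1] := solution_energy dy dz (tf e e0 e1).
  have := upper e e0 e1; rewrite -id1 => h1.
  have h2 := lower e e0 e1 e2 e3; have h3 := hc _ tv.
  by move: h1 h2 h3; set E := energy _; set P := potential _; move=> h1 h2 h3; lra.
have kt : 0 < k * (2 * tau) by rewrite mulr_gt0 // mulr_gt0.
pose e := Num.min (k * (2 * tau) / (B * 12 + 1) / 2) (Num.min (tau / 4) (Num.min ((m - tau - a) / 4) ((b - (m + tau)) / 4))).
have B1 : 0 < B * 12 + 1 by lra.
have q0 : 0 < k * (2 * tau) / (B * 12 + 1) / 2 by rewrite divr_gt0 // divr_gt0.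
have e0 : 0 < e by rewrite !lt_min q0 /=; apply/and3P; split; lra.
have [h1 h2 h3 h4] : [/\ e <= k * (2 * tau) / (B * 12 + 1) / 2, e <= tau / 4, e <= (m - tau - a) / 4 & e <= (b - (m + tau)) / 4].
  by split; rewrite !ge_min lexx ?orbT.
have := contra e e0; move=> /(_ _ _ _)h.
have h5 : k * (2 * tau) <= B * 12 * e by apply: h; lra.
have h6 : (B * 12 + 1) * e <= k * (2 * tau) / 2.
  rewrite -ler_pdivlMl //; apply: (le_trans h1); rewrite le_eqVlt; apply/orP; left; apply/eqP; field.
  by rewrite gt_eqF.
by lra.
Qed.

End disconjugacy.

(** * Positive solutions *)
Section positive_solution.
Variables (R : realType) (rho : \bar R) (n : nat) (W : R -> R).
Hypothesis rho0 : (0 < rho)%E.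
Hypothesis sW : smooth_on (oitv0 rho) W.
Local Notation I := (oitv0 rho).

Lemma oitv0_nonempty : exists r, I r.
Proof.
move: rho0; case: rho => [r| |] //; rewrite ?lte_fin => r0.
  by exists (r / 2); split; [lra|rewrite lte_fin; lra].
by exists 1; split; [exact: ltr01|rewrite ltry].
Qed.

Lemma oitv0_zero (f : R -> R) (a b : R) : I a -> I b -> a < b ->
  (forall x, I x -> {for x, continuous f}) -> f a * f b < 0 ->
  exists2 x, a < x < b & f x = 0.
Proof.
move=> Ia Ib ab cf fab.
have cfab : {within `[a, b], continuous f}.
  apply: continuous_in_subspaceT => x; rewrite inE /= in_itv /= => xab.
  by apply: cf; exact: oitv0_convex xab.
have fa0 : f a != 0 by apply: contraTneq fab => ->; rewrite mul0r ltxx.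
have fb0 : f b != 0 by apply: contraTneq fab => ->; rewrite mulr0 ltxx.
have [] := @IVT R f a b 0 (ltW ab) cfab.
  rewrite ge_min le_max; case: (ltgtP (f a) 0) fa0 => // fa _.
    by rewrite nmulr_rlt0 // in fab; rewrite /= ltW.
  by rewrite pmulr_rlt0 // in fab; rewrite /= (ltW fab).
move=> x; rewrite in_itv /= => /andP[ax xb] fx; exists x => //.
rewrite !lt_neqAle ax xb !andbT; apply/andP; split.
  by apply: contraNneq fa0 => ->; rewrite fx.
by apply: contraNneq fb0 => <-; rewrite fx.
Qed.

(** Let y1 and y2 be the solutions with data (1, 0) and (0, 1) at r0. No nontrivial
    solution vanishes twice, so y2 has the sign of x - r0 and y1 + t y2 is positive
    on the right of r0 if t > - y1/y2 there, and on the left if t < - y1/y2 there.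
    The solution that vanishes at a point b on the right is positive on the whole
    left side, so that all the values of - y1/y2 on the right are below those on
    the left: their supremum is a suitable t. *)
Lemma positive_solution c : 0 < c ->
  (forall v, test_line rho v -> c * potential n W v <= energy n v) ->
  exists y z : R -> R, forall x, I x -> [/\ 0 < y x, is_derive x 1 y (x ^- n * z x) &
    is_derive x 1 z (- (c / 2 * x ^+ n * W x * y x))].
Proof.
move=> c0 hc; have [r0 Ir] := oitv0_nonempty.
have oI : open I by exact: oitv0_open.
have sX : smooth_on I (fun r : R => r ^+ n) by exact: smooth_onX oI (smooth_on_id oI).
have ca x : I x -> {for x, continuous (fun r : R => r ^- n)}.
  move=> Ix; apply: (smooth_on_continuous _ Ix).
  by apply: (smooth_onV (f := fun r => r ^+ n)) => // u Iu; rewrite expf_neq0 // gt_eqF //; case: Iu.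
have cq x : I x -> {for x, continuous (fun r : R => c / 2 * r ^+ n * W r)}.
  move=> Ix; apply: (smooth_on_continuous _ Ix).
  exact: smooth_onM oI (smooth_onM oI (@smooth_on_cst R I (c / 2)) sX) sW.
have [y1 [z1 [y1r z1r dy1 dz1]]] := linear_system_exists Ir ca cq 1 0.
have [y2 [z2 [y2r z2r dy2 dz2]]] := linear_system_exists Ir ca cq 0 1.
pose y t x := y1 x + t * y2 x; pose z t x := z1 x + t * z2 x.
have dy t x : I x -> is_derive x 1 (y t) (x ^- n * z t x).
  move=> Ix; have := is_derive_add (dy1 x Ix) (is_derive_mul (is_derive_cst t x (1 : R)) (dy2 x Ix)).
  by move=> [h1 h2]; apply: DeriveDef => //; rewrite h2 /cst /z; ring.
have dz t x : I x -> is_derive x 1 (z t) (- (c / 2 * x ^+ n * W x * y t x)).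
  move=> Ix; have := is_derive_add (dz1 x Ix) (is_derive_mul (is_derive_cst t x (1 : R)) (dz2 x Ix)).
  by move=> [h1 h2]; apply: DeriveDef => //; rewrite h2 /cst /y; ring.
have cy t x : I x -> {for x, continuous (y t)} by move=> Ix; exact: is_derive_continuous (dy t x Ix).
have wronskian x : I x -> y1 x * z2 x - y2 x * z1 x = 1.
  move=> Ix.
  pose w u := y1 u * z2 u - y2 u * z1 u.
  have dw u : I u -> is_derive u 1 w 0.
    move=> Iu; have := is_derive_sub (is_derive_mul (dy1 u Iu) (dz2 u Iu)) (is_derive_mul (dy2 u Iu) (dz1 u Iu)).
    by move=> [h1 h2]; apply: DeriveDef => //; rewrite h2; ring.
  have w0 : y1 r0 * z2 r0 - y2 r0 * z1 r0 = 1 by rewrite y1r z2r y2r; ring.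
  rewrite -w0; have [xr|/ltW rx] := leP x r0.
    by apply: (@is_derive0_cst R w _ _ xr) => u uxr; apply: dw; exact: oitv0_convex uxr.
  by apply/esym; apply: (@is_derive0_cst R w _ _ rx) => u uxr; apply: dw; exact: oitv0_convex uxr.
(* two zeros of y would kill y and z at their midpoint *)
have nodouble (yy zz w v : R -> R) a b : (forall x, I x -> is_derive x 1 yy (x ^- n * zz x)) ->
    (forall x, I x -> is_derive x 1 zz (- (c / 2 * x ^+ n * W x * yy x))) ->
    (forall x, I x -> yy x * v x - w x * zz x != 0) ->
    I a -> I b -> a < b -> yy a = 0 -> yy b != 0.
  move=> dyy dzz wN0 Ia Ib ab ya; apply/eqP => yb.
  have z0 x : a < x < b -> zz x = 0 by exact: (disconjugate sW c0 hc dyy dzz Ia Ib ya yb).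
  have [am mb] : a < (a + b) / 2 /\ (a + b) / 2 < b by split; lra.
  have Iam x : a <= x <= (a + b) / 2 -> I x.
    by move=> /andP[ax xm]; apply: (oitv0_convex Ia Ib); rewrite ax (le_trans xm) // ltW.
  have [x /andP[ax xm]] := MVT_is_derive am (fun x h => dyy x (Iam x h)).
  rewrite z0; last by rewrite ax (lt_trans xm mb).
  rewrite mulr0 mul0r ya subr0 => ym.
  have Im : I ((a + b) / 2) by apply: Iam; rewrite lexx ltW.
  have := wN0 _ Im; rewrite ym z0; last by rewrite am mb.
  by rewrite mul0r mulr0 subrr eqxx.
have nodouble_t t a b : I a -> I b -> a < b -> y t a = 0 -> y t b != 0.
  apply: (nodouble (y t) (z t) y2 z2 a b (dy t) (dz t)) => x Ix.
  rewrite (_ : _ - _ = y1 x * z2 x - y2 x * z1 x); last by rewrite /y /z; ring.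
  by rewrite wronskian // oner_eq0.
have nodouble_2 a b : I a -> I b -> a < b -> y2 a = 0 -> y2 b != 0.
  apply: (nodouble y2 z2 y1 z1 a b dy2 dz2) => x Ix.
  by rewrite -opprB oppr_eq0 wronskian // oner_eq0.
have cy2 x : I x -> {for x, continuous y2} by move=> Ix; exact: is_derive_continuous (dy2 x Ix).
have ytr t : y t r0 = 1 by rewrite /y y1r y2r mulr0 addr0.
have cz2 : {for r0, continuous z2} by exact: is_derive_continuous (dz2 r0 Ir).
have [e e0 z2pos] : exists2 e : R, 0 < e & forall x, `|r0 - x| < e -> 0 < z2 x.
  have /cvgrPdist_lt/(_ 1 ltr01)/nbhs_ballP[e /= e0 he] := cz2.
  exists e => // x xe; have := he x xe; rewrite z2r ltr_norml => /andP[_].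
  by rewrite ltrBlDr ltrDl.
have xn_gt0 x : I x -> 0 < x ^- n by move=> [x0 _]; rewrite invr_gt0 exprn_gt0.
have y2_right b : I b -> r0 < b -> 0 < y2 b.
  move=> Ib rb; pose d := Num.min (r0 + e / 2) b.
  have rd : r0 < d by rewrite lt_min rb andbT ltrDl divr_gt0.
  have db : d <= b by rewrite ge_min lexx orbT.
  have de : d <= r0 + e / 2 by rewrite ge_min lexx.
  have Ird x : r0 <= x <= d -> I x.
    by move=> /andP[rx xd]; apply: (oitv0_convex Ir Ib); rewrite rx (le_trans xd).
  have [x /andP[rx xd]] := MVT_is_derive rd (fun x h => dy2 x (Ird x h)).
  rewrite y2r subr0 => y2d.
  have y2d0 : 0 < y2 d.
    rewrite y2d; apply: mulr_gt0; last by rewrite subr_gt0.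
    apply: mulr_gt0; first by apply/xn_gt0/Ird; rewrite !ltW.
    by apply: z2pos; rewrite ltr0_norm; lra.
  have Id : I d by apply: Ird; rewrite lexx ltW.
  rewrite ltNge; apply/negP; rewrite le_eqVlt (negbTE (nodouble_2 _ _ Ir Ib rb y2r)) /= => y2b.
  have ltdb : d < b by rewrite lt_neqAle db andbT; apply: contraTneq y2d0 => ->; rewrite -leNgt ltW.
  have [u /andP[du ub] y2u] := oitv0_zero Id Ib ltdb cy2 (ltac:(by rewrite pmulr_rlt0)).
  have Iu : I u by apply: (oitv0_convex Id Ib); rewrite !ltW.
  by have := nodouble_2 _ _ Ir Iu (lt_trans rd du) y2r; rewrite y2u eqxx.
have y2_left a : I a -> a < r0 -> y2 a < 0.
  move=> Ia ar; pose d := Num.max (r0 - e / 2) a.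
  have rd : d < r0 by rewrite gt_max ar andbT ltrBlDr ltrDl divr_gt0.
  have db : a <= d by rewrite le_max lexx orbT.
  have de : r0 - e / 2 <= d by rewrite le_max lexx.
  have Ird x : d <= x <= r0 -> I x.
    by move=> /andP[dx xr]; apply: (oitv0_convex Ia Ir); rewrite xr (le_trans db).
  have [x /andP[rx xd]] := MVT_is_derive rd (fun x h => dy2 x (Ird x h)).
  rewrite y2r sub0r => y2d.
  have y2d0 : y2 d < 0.
    rewrite -oppr_gt0 y2d; apply: mulr_gt0; last by rewrite subr_gt0.
    apply: mulr_gt0; first by apply/xn_gt0/Ird; rewrite !ltW.
    by apply: z2pos; rewrite gtr0_norm; lra.
  have Id : I d by apply: Ird; rewrite lexx ltW.
  have y2a0 : y2 a != 0 by apply/eqP => y2a; have := nodouble_2 _ _ Ia Ir ar y2a; rewrite y2r eqxx.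
  rewrite ltNge; apply/negP; rewrite le_eqVlt eq_sym (negbTE y2a0) /= => y2a.
  have ltad : a < d by rewrite lt_neqAle db andbT; apply: contraTneq y2d0 => <-; rewrite -leNgt ltW.
  have [u /andP[au ud] y2u] := oitv0_zero Ia Id ltad cy2 (ltac:(by rewrite pmulr_rlt0)).
  have Iu : I u by apply: (oitv0_convex Ia Id); rewrite !ltW.
  by have := nodouble_2 _ _ Iu Ir (lt_trans ud rd) y2u; rewrite y2r eqxx.
pose q x := - (y1 x / y2 x).
have yq x : y2 x != 0 -> y (q x) x = 0 by move=> h; rewrite /y /q mulNr divfK // subrr.
(* y (q b) is 1 at r0 and vanishes at b only, so it is positive on the component of
   the complement of b that contains r0 *)
have pos_left b a : I a -> I b -> a < r0 -> r0 < b -> 0 < y (q b) a.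
  move=> Ia Ib ar rb; have yb := yq b (lt0r_neq0 (y2_right b Ib rb)).
  have yN0 u : I u -> u < b -> y (q b) u != 0.
    by move=> Iu ub; apply/eqP => yu; have := nodouble_t _ _ _ Iu Ib ub yu; rewrite yb eqxx.
  have ya0 := yN0 a Ia (lt_trans ar rb).
  rewrite ltNge; apply/negP; rewrite le_eqVlt (negbTE ya0) /= => ya.
  have [u /andP[au ur] yu] := oitv0_zero Ia Ir ar (cy (q b)) (ltac:(by rewrite ytr mulr1)).
  have Iu : I u by apply: (oitv0_convex Ia Ir); rewrite !ltW.
  by have := yN0 u Iu (lt_trans ur rb); rewrite yu eqxx.
have pos_right b b' : I b -> I b' -> r0 < b -> b < b' -> 0 < y (q b') b.
  move=> Ib Ib' rb bb'; have yb' := yq b' (lt0r_neq0 (y2_right b' Ib' (lt_trans rb bb'))).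
  have yN0 u : I u -> u < b' -> y (q b') u != 0.
    by move=> Iu ub; apply/eqP => yu; have := nodouble_t _ _ _ Iu Ib' ub yu; rewrite yb' eqxx.
  have yb0 := yN0 b Ib bb'.
  rewrite ltNge; apply/negP; rewrite le_eqVlt (negbTE yb0) /= => yb.
  have [u /andP[ru ub] yu] := oitv0_zero Ir Ib rb (cy (q b')) (ltac:(by rewrite ytr mul1r)).
  have Iu : I u by apply: (oitv0_convex Ir Ib); rewrite !ltW.
  by have := yN0 u Iu (lt_trans ub bb'); rewrite yu eqxx.
have pos_left' a a' : I a -> I a' -> a' < a -> a < r0 -> 0 < y (q a') a.
  move=> Ia Ia' aa' ar; have ya' := yq a' (ltr0_neq0 (y2_left a' Ia' (lt_trans aa' ar))).
  have yN0 u : I u -> a' < u -> y (q a') u != 0.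
    by move=> Iu ub; exact: nodouble_t _ _ _ Ia' Iu ub ya'.
  have ya0 := yN0 a Ia aa'.
  rewrite ltNge; apply/negP; rewrite le_eqVlt (negbTE ya0) /= => ya.
  have [u /andP[au ur] yu] := oitv0_zero Ia Ir ar (cy (q a')) (ltac:(by rewrite ytr mulr1)).
  have Iu : I u by apply: (oitv0_convex Ia Ir); rewrite !ltW.
  by have := yN0 u Iu (lt_trans aa' au); rewrite yu eqxx.
have yE s t x : y t x = y s x + (t - s) * y2 x by rewrite /y; ring.
have qle a b : I a -> I b -> a < r0 -> r0 < b -> q b <= q a.
  move=> Ia Ib ar rb; have y2a := y2_left a Ia ar; have := pos_left b a Ia Ib ar rb.
  rewrite (yE (q a)) (yq a (ltr0_neq0 y2a)) add0r (nmulr_lgt0 _ y2a) subr_lt0.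
  exact: ltW.
have [b0 rb0 Ib0] := oitv0_gt Ir; have [a0 ar0 Ia0] := oitv0_lt Ir.
pose S : set R := [set q b | b in [set b | I b /\ r0 < b]].
have supS : has_sup S.
  split; first by exists (q b0), b0.
  by exists (q a0) => _ [b [Ib rb] <-]; exact: qle.
exists (y (sup S)), (z (sup S)) => x Ix; split; [|exact: dy|exact: dz].
have [xr|rx|->] := ltgtP x r0; last by rewrite ytr ltr01.
- have [a' ax Ia'] := oitv0_lt Ix.
  have le : sup S <= q a'.
    apply: ge_sup; first by exists (q b0), b0.
    by move=> _ [b [Ib rb] <-]; exact: qle (lt_trans ax xr) rb.
  rewrite (yE (q a')); apply: ltr_wpDr; last exact: pos_left'.
  by apply: mulr_le0; [rewrite subr_le0|exact/ltW/y2_left].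
- have [b' xb Ib'] := oitv0_gt Ix.
  have le : q b' <= sup S.
    by apply: ub_le_sup; [case: supS|exists b' => //; split => //; exact: lt_trans xb].
  rewrite (yE (q b')); apply: ltr_wpDr; last exact: pos_right.
  by apply: mulr_ge0; [rewrite subr_ge0|exact/ltW/y2_right].
Qed.

End positive_solution.

(** * From the one-dimensional form to Bessel pairs *)
Lemma line_form_bessel_pair (R : realType) (rho : \bar R) (N : nat) (W : R -> R) (c : R) :
  (0 < rho)%E -> smooth_on (oitv0 rho) W -> 0 < c ->
  (forall v, test_line rho v -> c * potential N.+1 W v <= energy N.+1 v) ->
  bessel_pair N.+2 rho (fun=> 1) (fun r => c / 2 * W r).
Proof.
move=> rho0 sW c0 hc; split=> [r _|]; first exact: ler01.
have [y [z yz]] := positive_solution rho0 sW c0 hc.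
exists y => /= r Ir; have [y0 dy dz] := yz r Ir.
have dflux : is_derive r 1 (fun r => r ^+ N.+1 * 1 * derive1 y r) (- (c / 2 * r ^+ N.+1 * W r * y r)).
  apply: (is_derive_open (oitv0_open (rho := rho)) Ir _ dz) => u Iu.
  have [_ /is_derive1E -> _] := yz u Iu.
  by rewrite mulr1 mulrA divff ?mul1r // expf_neq0 // gt_eqF //; case: Iu.
split; [exact: y0|by case: dy|by case: dflux|].
by rewrite (is_derive1E dflux); ring.
Qed.

Lemma hardy_arith (R : realFieldType) (a A B e : R) : 1 <= a -> 0 <= A ->
  a * A + 2 * B = 0 -> 0 <= e + a * B + (a / 2) ^+ 2 * A -> A <= 4 * e.
Proof.
move=> a1 A0 AB sq; have BE : B = - (a * A / 2) by lra.
have h : a ^+ 2 * A <= 4 * e.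
  rewrite -subr_ge0 (_ : _ - _ = 4 * (e + a * B + (a / 2) ^+ 2 * A)).
    by rewrite mulr_ge0.
  by rewrite BE; field.
apply: le_trans h; rewrite ler_peMl //.
exact: exprn_ege1.
Qed.

Section unconstrain.
Variables (R : realType) (rho : \bar R) (k : nat) (W : R -> R).
Hypothesis rho0 : (0 < rho)%E.
Hypothesis sW : smooth_on (oitv0 rho) W.
Local Notation I := (oitv0 rho).
Local Notation J := (@integral_line R).
Local Notation Cc := (Cc rho).
Local Notation test_line := (test_line rho).
Local Notation E := (energy k.+2).
Local Notation P := (potential k.+2 W).

Let oI : open I. Proof. exact: oitv0_open. Qed.

Let cX m x : I x -> {for x, continuous (fun r : R => r ^+ m)}.
Proof. by move=> Ix; exact: (smooth_on_continuous (smooth_onX oI (smooth_on_id oI)) Ix). Qed.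

Let cW x : I x -> {for x, continuous W}.
Proof. by move=> Ix; exact: smooth_on_continuous sW Ix. Qed.

Lemma Cc_bounded F : Cc F -> exists2 M : R, 0 < M & forall x, `|F x| <= M.
Proof.
move=> [cF [s [t [Is It h]]]].
have [st|ts] := leP s t.
  have [M M0 hM] := continuous_bounded_itv st (fun x _ => cF x).
  exists M => // x; have [xst|] := boolP (s <= x <= t); first exact: hM.
  by rewrite negb_and -!ltNge => /h ->; rewrite normr0 ltW.
exists 1 => // x; rewrite h ?normr0 //.
by have [//|/(lt_le_trans ts) ->] := ltP x s; rewrite orbT.
Qed.

(** The integral of r^k (r v' + (k + 1)/2 v)^2 is nonnegative, and its cross term
    is known from the total derivative of r^(k+1) v^2. *)
Lemma hardy_line v : test_line v -> J (fun r => r ^+ k * v r ^+ 2) <= 4 * E v.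
Proof.
move=> hv; have Cv := test_line_Cc hv; have Cv' := test_line_Cc (test_line_derive1 hv).
have CE : Cc (fun r => r ^+ k.+2 * derive1 v r ^+ 2) by apply: Cc_mul; [exact: cX|exact: Cc_sqr].
have C1 : Cc (fun r => r ^+ k * v r ^+ 2) by apply: Cc_mul; [exact: cX|exact: Cc_sqr].
have C2 : Cc (fun r => r ^+ k.+1 * (v r * derive1 v r)) by apply: Cc_mul; [exact: cX|exact: CcM].
set a : R := k.+1%:R; have a1 : 1 <= a by rewrite ler1n.
have CT : Cc (fun r => a * (r ^+ k * v r ^+ 2) + 2 * (r ^+ k.+1 * (v r * derive1 v r))).
  exact: CcD (CcZ _ C1) (CcZ _ C2).
have parts : a * J (fun r => r ^+ k * v r ^+ 2) + 2 * J (fun r => r ^+ k.+1 * (v r * derive1 v r)) = 0.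
  rewrite -(integral_CcZ _ C1) -(integral_CcZ _ C2) -(integral_CcD (CcZ _ C1) (CcZ _ C2)).
  have [_ [s [t [Is It h]]]] := hv.
  apply: (@integral_derive R rho (fun r => r ^+ k.+1 * v r ^+ 2) _ s t Is It) => //.
    by move=> x /h ->; rewrite expr0n mulr0.
  move=> x Ix; have := is_derive_mul (is_derive_pow k.+1 (is_derive_id x (1 : R)))
    (is_derive_pow 2 (test_line_is_derive x hv)).
  by move=> [h1 h2]; apply: DeriveDef => //; rewrite h2 /= -/a; ring.
have sq : 0 <= E v + a * J (fun r => r ^+ k.+1 * (v r * derive1 v r)) + (a / 2) ^+ 2 * J (fun r => r ^+ k * v r ^+ 2).
  rewrite -(integral_CcZ _ C1) -(integral_CcZ _ C2) -(integral_CcD CE (CcZ _ C2)).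
  rewrite -(integral_CcD (CcD CE (CcZ _ C2)) (CcZ _ C1)).
  apply: integral_line_ge0 => x; have [Ix|nIx] := pselect (I x).
    rewrite (_ : _ + _ = x ^+ k * (x * derive1 v x + a / 2 * v x) ^+ 2).
      by rewrite mulr_ge0 ?sqr_ge0 // exprn_ge0 // ltW //; case: Ix.
    by rewrite !exprS; field.
  by rewrite (Cc_off Cv nIx) (Cc_off Cv' nIx) mulr0 expr0n !mulr0 !addr0.
have J0 : 0 <= J (fun r => r ^+ k * v r ^+ 2).
  apply: integral_line_ge0 => x; have [Ix|nIx] := pselect (I x).
    by rewrite mulr_ge0 ?sqr_ge0 // exprn_ge0 // ltW //; case: Ix.
  by rewrite (Cc_off C1 nIx).
exact: hardy_arith a1 J0 parts sq.
Qed.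

Let q c v := E v - c * P v.

Lemma disjoint_supports (v w : R -> R) a s t b : I a -> I b -> a < s -> t < b ->
  test_line v -> test_line w ->
  vanish_outside s t v -> (forall x, a <= x <= b -> w x = 0) ->
  forall x, v x * w x = 0 /\ derive1 v x * derive1 w x = 0.
Proof.
move=> Ia Ib as' tb hv hw v0 w0 x.
have [xab|] := boolP (a < x < b).
  have [/ltW ax /ltW xb] := andP xab.
  rewrite w0 ?ax // mulr0; split=> //.
  rewrite (_ : derive1 w x = 0) ?mulr0 //; apply: is_derive1E.
  have oA : open (`]a, b[%classic : set R) by exact: itv_open.
  apply: (is_derive_open (f := cst (0 : R)) oA); first by rewrite /= in_itv.
  by move=> y; rewrite /= in_itv /= => /andP[/ltW ay /ltW yb]; rewrite w0 ?ay.
rewrite negb_and -!leNgt => xab.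
have xst : (x < s) || (t < x).
  by case/orP: xab => h; apply/orP; [left; exact: le_lt_trans as'|right; exact: lt_le_trans h].
rewrite v0 // mul0r; split=> //.
rewrite (_ : derive1 v x = 0) ?mul0r //; apply: is_derive1E.
apply: is_derive_near (is_derive_cst (0 : R) x (1 : R)).
by apply: filterS (vanish_outside_near v0 xst) => y ->.
Qed.

Lemma form_disjoint c (v w : R -> R) al be : test_line v -> test_line w ->
  (forall x, v x * w x = 0 /\ derive1 v x * derive1 w x = 0) ->
  q c (fun x => al * v x + be * w x) = al ^+ 2 * q c v + be ^+ 2 * q c w.
Proof.
move=> hv hw dis; have oT := @openT R.
have CEv := Cc_energy k.+2 hv; have CEw := Cc_energy k.+2 hw.
have CPv := Cc_potential k.+2 sW hv; have CPw := Cc_potential k.+2 sW hw.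
rewrite /q; have -> : E (fun x => al * v x + be * w x) = al ^+ 2 * E v + be ^+ 2 * E w.
  rewrite -(integral_CcZ _ CEv) -(integral_CcZ _ CEw) -(integral_CcD (CcZ _ CEv) (CcZ _ CEw)).
  rewrite /energy; congr integral_line; apply/funext => x.
  have := is_derive_add (is_derive_mul (is_derive_cst al x (1 : R)) (test_line_is_derive x hv))
    (is_derive_mul (is_derive_cst be x (1 : R)) (test_line_is_derive x hw)).
  rewrite !mul0r !add0r => /is_derive1E ->; rewrite /cst.
  have [_] := dis x; move: (derive1 v x) (derive1 w x) (x ^+ k.+2) => a b X d0.
  by rewrite sqrrD mulrACA d0 mulr0 mul0rn addr0; ring.
have -> : P (fun x => al * v x + be * w x) = al ^+ 2 * P v + be ^+ 2 * P w.
  rewrite -(integral_CcZ _ CPv) -(integral_CcZ _ CPw) -(integral_CcD (CcZ _ CPv) (CcZ _ CPw)).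
  rewrite /potential; congr integral_line; apply/funext => x.
  have [d0 _] := dis x; move: (v x) (w x) (x ^+ k.+2) (W x) d0 => a b X Y d0.
  by rewrite sqrrD mulrACA d0 mulr0 mul0rn addr0; ring.
by move: (E v) (E w) (P v) (P w) => *; ring.
Qed.

Definition moment v := J (fun r => r * v r).

(** The constraint is one linear condition: two disjointly supported directions
    of negativity would combine into a negative direction satisfying it. *)
Lemma form_nonneg_off_compact c : 0 < c ->
  (forall v, test_line v -> moment v = 0 -> c * P v <= E v) ->
  exists s t, [/\ I s, I t, s <= t & forall v, test_line v ->
    (forall x, s <= x <= t -> v x = 0) -> c * P v <= E v].
Proof.
move=> c0 hc; apply: contrapT => noc.
have neg s t : I s -> I t -> s <= t -> exists v, [/\ test_line v,
    forall x, s <= x <= t -> v x = 0 & q c v < 0].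
  move=> Is It st; apply: contrapT => h; apply: noc; exists s, t; split => // v hv v0.
  rewrite leNgt; apply/negP => qv; apply: h; exists v; split => //.
  by rewrite subr_lt0.
have [r0 Ir] := oitv0_nonempty rho0.
have [v1 [hv1 _ q1]] := neg r0 r0 Ir Ir (lexx _).
have [_ [s1 [t1 [Is1 It1 out1]]]] := hv1.
have [a ha Ia] : exists2 a, a < Num.min s1 t1 & I a by apply: oitv0_lt; case: leP.
have [b hb Ib] : exists2 b, Num.max s1 t1 < b & I b by apply: oitv0_gt; case: leP.
move: ha hb; rewrite lt_min gt_max => /andP[as1 at1] /andP[sb tb].
have [v2 [hv2 v20 q2]] := neg a b Ia Ib (ltW (lt_trans as1 sb)).
have dis := disjoint_supports Ia Ib as1 tb hv1 hv2 out1 v20.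
have cid x : I x -> {for x, continuous (fun r : R => r)} by move=> _; exact: cvg_id.
have C1 := Cc_mul cid (test_line_Cc hv1); have C2 := Cc_mul cid (test_line_Cc hv2).
pose m1 := moment v1; pose m2 := moment v2.
have [m10|m1N0] := eqVneq m1 0.
  by have := hc v1 hv1 m10; rewrite leNgt -subr_lt0 q1.
have sc (x : R) w : test_line w -> test_line (fun y => x * w y).
  by move=> hw; apply: test_line_mul hw; exact: smooth_on_cst.
have hv := test_lineD (sc m2 _ hv1) (sc (- m1) _ hv2).
have mv : moment (fun y => m2 * v1 y + - m1 * v2 y) = 0.
  rewrite (_ : moment _ = J (fun r => m2 * (r * v1 r) + - m1 * (r * v2 r))).
    by rewrite (integral_CcD (CcZ _ C1) (CcZ _ C2)) !(integral_CcZ _ C1, integral_CcZ _ C2) -/m1 -/m2 -/(moment v1) -/(moment v2) -/m1 -/m2; ring.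
  by rewrite /moment; congr integral_line; apply/funext => r; ring.
have := hc _ hv mv; rewrite leNgt -subr_lt0 -/(q c _) (form_disjoint _ _ _ hv1 hv2 dis) => /negP; apply.
rewrite sqrrN -[X in _ < X]addr0; apply: ler_ltD.
  by rewrite mulr_ge0_le0 ?sqr_ge0 // ltW.
by rewrite pmulr_rlt0 // exprn_even_gt0.
Qed.

(** Let chi vanish on the interval [s, t] where nothing is known and equal 1 outside
    a larger compact interval. The form is under control on chi v; what is missing,
    the potential of (1 - chi^2) v^2, and what is added, the energy of the
    derivative of chi, live on a compact set and are bounded by the energy of v
    through Hardy's inequality. *)
Lemma unconstrain c : 0 < c ->
  (forall v, test_line v -> moment v = 0 -> c * P v <= E v) ->
  exists2 c', 0 < c' & forall v, test_line v -> c' * P v <= E v.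
Proof.
move=> c0 hc; have [s [t [Is It st off]]] := form_nonneg_off_compact c0 hc.
have oT := @openT R.
have [a as' Ia] := oitv0_lt Is; have [b tb Ib] := oitv0_gt It.
pose p := plateau a s t b; pose chi (x : R) : R := 1 - p x.
have hp : test_line p by exact: test_line_plateau.
have schi : smooth_on setT chi by apply: smooth_onB oT (@smooth_on_cst R _ 1) hp.1.
have dchi (x : R) : is_derive x 1 chi (derive1 chi x) by exact: (smooth_on_is_derive schi).
have dchiE x : derive1 chi x = - derive1 p x.
  have := is_derive_sub (is_derive_cst (1 : R) x (1 : R)) (test_line_is_derive x hp).
  by rewrite sub0r => /is_derive1E.
have chi01 x : 0 <= chi x <= 1.
  by rewrite subr_ge0 plateau_le1 lerBlDr lerDl plateau_ge0.
have Cp := test_line_Cc hp; have Cp' := test_line_Cc (test_line_derive1 hp).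
have cc (u x : R) : I x -> {for x, continuous (fun r : R => u)} by move=> _; exact: cvg_cst.
have c1p x : I x -> {for x, continuous (fun r => 1 + chi r)}.
  move=> _; apply: continuousD; first exact: cvg_cst.
  exact: (smooth_on_continuous schi Logic.I).
(* 1 - chi^2 = (1 + chi) p *)
have CW : Cc (fun r => r ^+ 2 * (W r * ((1 + chi r) * p r))).
  by apply: Cc_mul; [exact: cX|apply: Cc_mul => //; exact: Cc_mul].
have [M1 M10 hM1] := Cc_bounded CW.
have CD : Cc (fun r => r ^+ 2 * derive1 p r ^+ 2) by apply: Cc_mul; [exact: cX|exact: Cc_sqr].
have [M2 M20 hM2] := Cc_bounded CD.
pose K := c^-1 * (2 * M2 * 4 + 2) + M1 * 4.
have K0 : 0 < K.
  by rewrite addr_gt0 ?mulr_gt0 ?invr_gt0 ?addr_gt0 ?mulr_gt0.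
exists K^-1 => [|v hv]; first by rewrite invr_gt0.
rewrite ler_pdivrMl //.
have hcv : test_line (fun x => chi x * v x) by apply: test_line_mul hv; exact: smooth_on_subset schi.
have Cv := test_line_Cc hv; have Cv' := test_line_Cc (test_line_derive1 hv).
have C0 : Cc (fun r => r ^+ k * v r ^+ 2) by apply: Cc_mul; [exact: cX|exact: Cc_sqr].
have CEv := Cc_energy k.+2 hv; have CPv := Cc_potential k.+2 sW hv.
have CEc := Cc_energy k.+2 hcv; have CPc := Cc_potential k.+2 sW hcv.
have H := hardy_line hv.
have b1 : c * P (fun x => chi x * v x) <= E (fun x => chi x * v x).
  by apply: off => // x /andP[sx xt]; rewrite /chi /p plateau1 // subrr mul0r.
have b2 : E (fun x => chi x * v x) <= (2 * M2 * 4 + 2) * E v.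
  apply: (@le_trans _ _ (J (fun r => 2 * M2 * (r ^+ k * v r ^+ 2) + 2 * (r ^+ k.+2 * derive1 v r ^+ 2)))).
    apply: (integral_Cc_le CEc (CcD (CcZ _ C0) (CcZ _ CEv))) => x.
    have [Ix|nIx] := pselect (I x); last first.
      rewrite (Cc_off CEc nIx).
      rewrite (Cc_off (CcD (CcZ (2 * M2) C0) (CcZ 2 CEv)) nIx).
      exact: lexx.
    have x0 : 0 < x by case: Ix.
    rewrite (is_derive1E (is_derive_mul (dchi x) (test_line_is_derive x hv))) dchiE.
    have := hM2 x; rewrite ger0_norm; last exact: mulr_ge0 (sqr_ge0 _) (sqr_ge0 _).
    move=> h2.
    have := chi01 x; move: (chi x) (derive1 p x) (v x) (derive1 v x) h2 => ch p' vx v' h2 ch01.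
    rewrite -subr_ge0 (_ : _ - _ = x ^+ k * (2 * vx ^+ 2 * (M2 - x ^+ 2 * p' ^+ 2)
       + 2 * (x * v') ^+ 2 * (1 - ch ^+ 2) + (x * p' * vx + x * ch * v') ^+ 2)).
      apply: mulr_ge0; first exact: exprn_ge0 (ltW x0).
      apply: addr_ge0 (sqr_ge0 _); apply: addr_ge0; apply: mulr_ge0.
      - exact: mulr_ge0 (ler0n _ 2) (sqr_ge0 _).
      - by rewrite subr_ge0.
      - exact: mulr_ge0 (ler0n _ 2) (sqr_ge0 _).
      - by case/andP: ch01 => ch0 ch1; rewrite subr_ge0 expr_le1.
    by rewrite !exprS; ring.
  rewrite (integral_CcD (CcZ _ C0) (CcZ _ CEv)) (integral_CcZ _ C0) (integral_CcZ _ CEv) -/(E v).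
  rewrite [leRHS]mulrDl; apply: lerD => //.
  by rewrite -[leRHS]mulrA ler_pM2l // mulr_gt0.
have b3 : P v <= P (fun x => chi x * v x) + M1 * (4 * E v).
  apply: (@le_trans _ _ (J (fun r => r ^+ k.+2 * (W r * (chi r * v r) ^+ 2) + M1 * (r ^+ k * v r ^+ 2)))); last first.
    by rewrite (integral_CcD CPc (CcZ _ C0)) (integral_CcZ _ C0) lerD2l ler_pM2l.
  apply: (integral_Cc_le CPv (CcD CPc (CcZ _ C0))) => x.
  have [Ix|nIx] := pselect (I x); last first.
    by rewrite (Cc_off CPv nIx) (Cc_off (CcD CPc (CcZ M1 C0)) nIx).
  have x0 : 0 < x by case: Ix.
  have := hM1 x; rewrite ler_norml => /andP[_ h1].
  rewrite -subr_ge0 (_ : _ - _ = x ^+ k * v x ^+ 2 * (M1 - x ^+ 2 * (W x * ((1 + chi x) * p x)))).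
    by rewrite mulr_ge0 ?subr_ge0 // mulr_ge0 ?sqr_ge0 // exprn_ge0 // ltW.
  have -> : p x = 1 - chi x by rewrite /chi opprB addrC subrK.
  by rewrite !exprS; ring.
apply: (le_trans b3); rewrite /K [leRHS]mulrDl; apply: lerD; last by rewrite mulrA.
by rewrite -[leRHS]mulrA ler_pdivlMl //; exact: le_trans b1 b2.
Qed.

End unconstrain.

(** * Measurability in R^n *)
Section measurable_continuous.
Variables (R : realType) (n : nat).
Implicit Types (U : set 'rV[R]_n) (g : 'rV[R]_n -> R).

Lemma rV_nbhsP (x : 'rV[R]_n) (A : set 'rV[R]_n) : nbhs x A <->
  exists2 e : R, 0 < e & forall y : 'rV[R]_n, (forall i, `|x ord0 i - y ord0 i| < e) -> A y.
Proof.
split=> [/nbhs_ballP[e /= e0 he]|[e e0 he]].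
  exists e => // y hy; apply: he; split=> // i j; rewrite (ord1 i); exact: hy.
apply/nbhs_ballP; exists e => // y [_ hy]; apply: he => i; exact: (hy ord0 i).
Qed.

(** The sigma-algebra is generated by the coordinates, so it contains boxes, and an
    open set is a countable union of boxes with rational centres. *)
Lemma open_measurable_rV U : open U -> measurable U.
Proof.
move=> oU.
have aux (a d b : R) : a - d < b -> b < a + d -> `|a - b| < d.
  by move=> h1 h2; rewrite ltr_norml; apply/andP; split; lra.
pose B (q : 'rV[rat]_n) (k : nat) : set 'rV[R]_n :=
  [set x | forall i, `|x ord0 i - ratr (q ord0 i)| < k.+1%:R^-1].
have mB q k : measurable (B q k).
  set d : R := k.+1%:R^-1.
  rewrite (_ : B q k = \big[setI/setT]_(i < n)
     (@rV_coord R n i @^-1` [set r : R | `|r - ratr (q ord0 i)| < d])).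
    apply: bigsetI_measurable => i _; rewrite -[X in measurable X]setTI.
    apply: measurable_rV_coord => //.
    rewrite (_ : [set _ | _] = `]ratr (q ord0 i) - d, ratr (q ord0 i) + d[%classic).
      exact: measurable_itv.
    by apply/seteqP; split=> r /=; rewrite in_itv /= ltr_norml => /andP[h1 h2];
      apply/andP; split; lra.
  rewrite -bigcap_seq; apply/seteqP; split=> x /=.
    by move=> h i _; exact: h.
  by move=> h i; apply: (h i); rewrite /= mem_index_enum.
pose F (m : nat) : set 'rV[R]_n :=
  if unpickle m is Some p then if `[< B p.1 p.2 `<=` U >] then B p.1 p.2 else set0 else set0.
rewrite (_ : U = \bigcup_m F m).
  apply: bigcup_measurable => m _; rewrite /F; case: unpickle => // p.
  by case: ifP.
apply/seteqP; split=> [x Ux|x [m _]]; last first.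
  rewrite /F; case: unpickle => // p; case: ifPn => // /asboolP; exact.
have [e e0 he] : exists2 e : R, 0 < e & forall y : 'rV[R]_n, (forall i, `|x ord0 i - y ord0 i| < e) -> U y.
  by apply/rV_nbhsP; exact: open_nbhs_nbhs.
have [k hk] : exists k : nat, k.+1%:R^-1 < e / 2.
  have e2 : 0 < e / 2 by rewrite divr_gt0.
  exists (Num.truncn (e / 2)^-1).
  rewrite invf_plt ?posrE // truncnS_gt //.
have qi i : exists q : rat, `|x ord0 i - ratr q| < k.+1%:R^-1.
  have k0 : 0 < k.+1%:R^-1 :> R by rewrite invr_gt0.
  have [|q] := @rat_in_itvoo R (x ord0 i - k.+1%:R^-1) (x ord0 i + k.+1%:R^-1); first by rewrite ltrBlDr -addrA ltrDl addr_gt0.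
  by rewrite in_itv /= => /andP[h1 h2]; exists q; exact: aux.
have [q0 hq0] := choice qi; pose q := \row_i q0 i.
have hq : B q k x by move=> i; rewrite mxE.
exists (pickle (q, k)) => //; rewrite /F pickleK /= ifT //; apply/asboolP => y hy.
apply: he => i; rewrite (_ : _ - _ = (x ord0 i - ratr (q ord0 i)) - (y ord0 i - ratr (q ord0 i))); last by ring.
apply: (le_lt_trans (ler_normB _ _)); have := hq i; have := hy i.
by move: hk; set a := _^-1; move=> *; lra.
Qed.

Lemma continuous_measurable_rV g : continuous g -> measurable_fun setT g.
Proof.
move=> cg; refine (@measurability _ _ 'rV[R]_n (measurableTypeR R) setT g
  (@measurable_realfun.RGenOpens.G R) (@measurable_realfun.RGenOpens.measurableE R) _).
move=> _ [_ [a [b ->]] <-]; rewrite setTI; apply: open_measurable_rV.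
by apply: open_comp => [x _|]; [exact: cg|exact: itv_open].
Qed.

End measurable_continuous.

(** * Integrals of compactly supported functions in R^n *)
Lemma finite_support_integrable d (T : measurableType d) (R : realType)
    (mu : {measure set T -> \bar R}) (f : T -> R) (A : set T) (M : R) :
  measurable A -> (mu A < +oo)%E -> measurable_fun setT f ->
  (forall x, `|f x| <= M) -> (forall x, ~ A x -> f x = 0) ->
  mu.-integrable setT (EFin \o f).
Proof.
move=> mA fA mf bf f0.
have -> : f = f \_ A.
  by apply/funext => x; rewrite patchE; case: ifPn => //; rewrite notin_setE => /f0.
rewrite -restrict_EFin; apply/(integrable_mkcond (EFin \o f) mA).
apply: measurable_bounded_integrable => //; first exact: measurable_funS mf.
exists M; split; first exact: num_real.
by move=> y My x _; apply: le_trans (ltW My); exact: bf.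
Qed.

Section boxes.
Variables (R : realType).
Implicit Types (n : nat) (a b t M : R).

Lemma rV_cons0 n t (x : 'rV[R]_n) : rV_cons (t, x) ord0 ord0 = t.
Proof.
have := row_mxEl (\row_(_ < 1) t) x ord0 ord0; rewrite mxE => {2}<-.
by rewrite /rV_cons; congr (row_mx _ _ _ _); exact: val_inj.
Qed.

Lemma rV_consS n t (x : 'rV[R]_n) j : rV_cons (t, x) ord0 (lift ord0 j) = x ord0 j.
Proof.
rewrite -(row_mxEr (\row_(_ < 1) t) x ord0 j).
by rewrite /rV_cons; congr (row_mx _ _ _ _); exact: val_inj.
Qed.

Lemma rV_forall_cons n (P : 'I_n.+1 -> Prop) : P ord0 -> (forall j, P (lift ord0 j)) -> forall i, P i.
Proof. by move=> P0 PS i; case: (unliftP ord0 i) => [j ->|->]. Qed.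

Definition box n a b : set 'rV[R]_n := [set x | forall i, a <= x ord0 i <= b].

Lemma measurable_box n a b : measurable (@box n a b).
Proof.
rewrite (_ : box a b = \big[setI/setT]_(i < n) (@rV_coord R n i @^-1` `[a, b]%classic)).
  apply: bigsetI_measurable => i _; rewrite -[X in measurable X]setTI.
  by apply: measurable_rV_coord => //; exact: measurable_itv.
rewrite -bigcap_seq; apply/seteqP; split=> x /=.
  by move=> h i _; rewrite /= in_itv; exact: h.
by move=> h i; have := h i; rewrite /= mem_index_enum in_itv; apply.
Qed.

Lemma preimage_box n a b : @rV_cons R n @^-1` box a b = `[a, b]%classic `*` box a b.
Proof.
apply/seteqP; split=> -[t x] /=; rewrite /= in_itv /=.
  move=> h; split; first by have := h ord0; rewrite rV_cons0.
  by move=> j; have := h (lift ord0 j); rewrite rV_consS.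
by move=> [h0 hS]; apply: rV_forall_cons => [|j]; rewrite ?rV_cons0 ?rV_consS.
Qed.

Lemma lebesgue_box n a b : a <= b -> lebesgue_rV R n (box a b) = ((b - a) ^+ n)%:E.
Proof.
move=> ab; elim: n => [|n IH].
  by rewrite /= diracE mem_set // => -[].
rewrite /= /rV_cons_measure /pushforward preimage_box.
rewrite product_measure1E; [|exact: measurable_itv|exact: measurable_box].
rewrite IH exprS EFinM; congr (_ * _)%E.
have := lebesgue_measure_itv `[a, b]; rewrite /= lte_fin.
have [ltab -> //|ba ->] := ltP a b.
by rewrite (_ : b - a = 0) //; apply/eqP; rewrite subr_eq0 eq_le ab ba.
Qed.

Lemma compact_box n a b : compact (@box n a b).
Proof.
have := @rV_compact R n (fun=> `[a, b]%classic) (fun=> @segment_compact R a b).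
by congr compact; apply/seteqP; split => x /= h i; have := h i; rewrite /= in_itv.
Qed.

End boxes.

Section compact_support_rV.
Variables (R : realType) (n : nat).
Implicit Types (f g : 'rV[R]_n -> R) (x : 'rV[R]_n).
Notation mu := (lebesgue_rV R n).

Definition ccsupp g := continuous g /\
  exists M : R, forall x i, M < `|x ord0 i| -> g x = 0.

Definition integral_rV g : R := \int[mu]_x g x.

Lemma ccsupp_box g : ccsupp g -> exists M : R, [/\ 0 < M, forall x, `|g x| <= M &
  forall x, ~ box (- M) M x -> g x = 0].
Proof.
move=> [cg [M hM]].
have out x : ~ box (- M) M x -> g x = 0.
  move=> nB; have [i hi] : exists i, ~~ (- M <= x ord0 i <= M).
    apply: contrapT => h; apply: nB => i; apply: contrapT => h'; apply: h; exists i.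
    exact/negP.
  by apply: (hM x i); rewrite ltNge ler_norml.
have [K [_ hK]] := compact_bounded (continuous_compact (continuous_subspaceT cg) (@compact_box R n (- M) M)).
pose L := Num.max (`|M|) (`|K|) + 1.
have L1 : `|M| < L by rewrite ltr_pwDr // le_max lexx.
have L2 : `|K| < L by rewrite ltr_pwDr // le_max lexx orbT.
have L0 : 0 < L by exact: le_lt_trans L1.
exists L; split => // [x|x nB].
  have [Bx|nBx] := pselect (box (- M) M x); last by rewrite out // normr0 ltW.
  by apply: (hK L _ (g x)); [exact: le_lt_trans (ler_norm K) L2|exists x].
apply: out => Bx; apply: nB => i; have /andP[h1 h2] := Bx i.
have ML : M <= L by exact: le_trans (ler_norm M) (ltW L1).
by rewrite (le_trans h2 ML) andbT (le_trans _ h1) // lerN2.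
Qed.

Lemma ccsupp_integrable g : ccsupp g -> mu.-integrable setT (EFin \o g).
Proof.
move=> hg; have [M [M0 bM out]] := ccsupp_box hg.
apply: (finite_support_integrable (A := box (- M) M) (M := M)) => //.
- exact: measurable_box.
- rewrite [X in (X < _)%E](_ : _ = ((M - - M) ^+ n)%:E); first exact: ltry.
  by apply: lebesgue_box; lra.
- exact: continuous_measurable_rV hg.1.
Qed.

Lemma integral_rV_fin g : ccsupp g -> (\int[mu]_x (g x)%:E = (integral_rV g)%:E)%E.
Proof. by move=> hg; rewrite fineK //; exact: integrable_fin_num (ccsupp_integrable hg). Qed.

Lemma ccsupp_mul f g : continuous f -> ccsupp g -> ccsupp (fun x => f x * g x).
Proof.
move=> cf [cg [M hM]]; split; first by move=> x; apply: continuousM; [exact: cf|exact: cg].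
by exists M => x i /hM ->; rewrite mulr0.
Qed.

Lemma ccsuppZ (c : R) g : ccsupp g -> ccsupp (fun x => c * g x).
Proof. by apply: ccsupp_mul; exact: cst_continuous. Qed.

Lemma ccsuppD f g : ccsupp f -> ccsupp g -> ccsupp (fun x => f x + g x).
Proof.
move=> [cf [M hM]] [cg [M' hM']]; split; first by move=> x; apply: continuousD; [exact: cf|exact: cg].
by exists (Num.max M M') => x i; rewrite gt_max => /andP[/hM -> /hM' ->]; rewrite addr0.
Qed.

Lemma ccsupp0 : ccsupp (fun=> 0 : R).
Proof. by split; [exact: cst_continuous|exists 0]. Qed.

Lemma ccsupp_sum (I : Type) (r : seq I) (F : I -> 'rV[R]_n -> R) :
  (forall i, ccsupp (F i)) -> ccsupp (fun x => \sum_(i <- r) F i x).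
Proof.
move=> hF; elim: r => [|i r IH].
  by under eq_fun do rewrite big_nil; exact: ccsupp0.
by under eq_fun do rewrite big_cons; exact: ccsuppD.
Qed.

Lemma integral_rVD f g : ccsupp f -> ccsupp g ->
  integral_rV (fun x => f x + g x) = integral_rV f + integral_rV g.
Proof. by move=> hf hg; apply: RintegralD => //; exact: ccsupp_integrable. Qed.

Lemma integral_rVB f g : ccsupp f -> ccsupp g ->
  integral_rV (fun x => f x - g x) = integral_rV f - integral_rV g.
Proof. by move=> hf hg; apply: RintegralB => //; exact: ccsupp_integrable. Qed.

Lemma integral_rVZ c g : ccsupp g -> integral_rV (fun x => c * g x) = c * integral_rV g.
Proof. by move=> hg; apply: RintegralZl => //; exact: ccsupp_integrable. Qed.

Lemma integral_rV_le f g : ccsupp f -> ccsupp g -> (forall x, f x <= g x) ->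
  integral_rV f <= integral_rV g.
Proof. by move=> hf hg h; apply: le_Rintegral => //; exact: ccsupp_integrable. Qed.

Lemma integral_rV_sum (I : Type) (r : seq I) (F : I -> 'rV[R]_n -> R) :
  (forall i, ccsupp (F i)) ->
  integral_rV (fun x => \sum_(i <- r) F i x) = \sum_(i <- r) integral_rV (F i).
Proof.
move=> hF; elim: r => [|i r IH].
  rewrite big_nil; under [X in integral_rV X]eq_fun do rewrite big_nil.
  by rewrite /integral_rV Rintegral_cst // mul0r.
rewrite big_cons -IH -integral_rVD //; last exact: ccsupp_sum.
by congr integral_rV; apply/funext => x; rewrite big_cons.
Qed.

Lemma integral_rV_lb (f : 'rV[R]_n -> R) a b : a <= b -> ccsupp f -> (forall x, 0 <= f x) ->
  (forall x, box a b x -> 1 <= f x) -> (b - a) ^+ n <= integral_rV f.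
Proof.
move=> ab cf f0 f1.
have mB := @measurable_box R n a b.
have -> : (b - a) ^+ n = \int[lebesgue_rV R n]_(x in box a b) 1.
  by rewrite Rintegral_cst // mul1r; exact: (congr1 fine (esym (lebesgue_box n ab))).
rewrite Rintegral_mkcond; apply: le_Rintegral => //.
- apply: (finite_support_integrable (A := box a b) (M := 1)) => //.
  + by rewrite [X in (X < _)%E](_ : _ = ((b - a) ^+ n)%:E); [exact: ltry|exact: lebesgue_box].
  + by apply/measurable_restrict => //; exact: measurable_cst.
  + by move=> x; rewrite patchE; case: ifP; rewrite ?normr1 ?normr0.
  + by move=> x nB; rewrite patchE ifF //; apply/negbTE/negP; rewrite in_setE.
- exact: ccsupp_integrable.
- move=> x _; rewrite patchE; case: ifPn => // xB; apply: f1.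
  by rewrite in_setE in xB.
Qed.

End compact_support_rV.

Section first_coordinate.
Variable R : realType.

Lemma integral_rV_cons n (g : 'rV[R]_n.+1 -> R) : ccsupp g ->
  ((@lebesgue_measure R \x lebesgue_rV R n)%E.-integrable setT (fun z => (g (rV_cons z))%:E)) /\
  (\int[lebesgue_rV R n.+1]_x (g x)%:E =
   \int[(@lebesgue_measure R \x lebesgue_rV R n)%E]_z (g (rV_cons z))%:E)%E.
Proof.
move=> hg; have [M [M0 bM out]] := ccsupp_box hg.
have mg := continuous_measurable_rV hg.1.
have MM : - M <= M by lra.
have ig : (@lebesgue_measure R \x lebesgue_rV R n)%E.-integrable setT
    (EFin \o (fun z => g (rV_cons z))).
  apply: (finite_support_integrable (A := @rV_cons R n @^-1` box (- M) M) (M := M)) => //.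
  - rewrite preimage_box; apply: measurableX; [exact: measurable_itv|exact: measurable_box].
  - by have := lebesgue_box n.+1 MM; rewrite /= /rV_cons_measure /pushforward => ->; rewrite ltry.
  - by apply: measurableT_comp mg _; exact: measurable_rV_cons.
  - by move=> z nB; apply: out.
split; first exact: ig.
have mEg := (measurable_EFinP _ _).2 mg.
have := @integral_pushforward _ _ _ _ R (@rV_cons R n) (@measurable_rV_cons R n)
  (@lebesgue_measure R \x lebesgue_rV R n)%E setT (EFin \o g) mEg.
rewrite preimage_setT => /(_ ig measurableT) <-.
by apply: eq_measure_integral => [|mc A mA _] //; exact: measurable_rV_cons.
Qed.

End first_coordinate.

(** * Integrals of partial derivatives *)
Section divergence.
Variable R : realType.

Lemma rV_cons_line n t (x : 'rV[R]_n) (h : R) (j : 'I_n) :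
  rV_cons (t, h *: delta_mx ord0 j + x) = h *: delta_mx ord0 (lift ord0 j) + rV_cons (t, x).
Proof.
apply/rowP; apply: rV_forall_cons => [|k]; rewrite [RHS]mxE [X in _ = X + _]mxE.
  by rewrite !rV_cons0 mxE /= mulr0 add0r.
by rewrite !rV_consS !mxE.
Qed.

Lemma rV_cons_line0 n (t : R) (x : 'rV[R]_n) (h : R) :
  rV_cons (h + t, x) = h *: delta_mx ord0 ord0 + rV_cons (t, x).
Proof.
apply/rowP; apply: rV_forall_cons => [|k]; rewrite [RHS]mxE [X in _ = X + _]mxE.
  by rewrite !rV_cons0 mxE /= mulr1.
by rewrite !rV_consS mxE /= mulr0 add0r.
Qed.

Lemma rV_cons_continuous_snd n (t : R) : continuous (fun x : 'rV[R]_n => rV_cons (t, x)).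
Proof.
move=> x A /rV_nbhsP[e e0 he]; apply/rV_nbhsP; exists e => // y hy; apply: he.
by apply: rV_forall_cons => [|j]; rewrite ?rV_cons0 ?subrr ?normr0 // !rV_consS.
Qed.

Lemma rV_cons_continuous_fst n (x : 'rV[R]_n) : continuous (fun t : R => rV_cons (t, x)).
Proof.
move=> t A /rV_nbhsP[e e0 he]; apply/nbhs_ballP; exists e => // s hs; apply: he.
apply: rV_forall_cons => [|j]; first by rewrite !rV_cons0.
by rewrite !rV_consS subrr normr0.
Qed.

(** Integrating first along the coordinate i leaves the integral over a line of the
    derivative of a compactly supported function. The product measure singles out
    the first coordinate only, hence the induction on the dimension. *)
Lemma integral_partial n (g dg : 'rV[R]_n -> R) (i : 'I_n) :
  (forall x, is_derive x (delta_mx ord0 i) g (dg x)) -> ccsupp g -> ccsupp dg ->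
  (\int[lebesgue_rV R n]_x (dg x)%:E = 0)%E.
Proof.
elim: n g dg i => [|n IH] g dg i; first by case: i.
move=> hd cg cdg; have [idg ->] := integral_rV_cons cdg.
have [j ij|i0] := unliftP ord0 i.
  rewrite -(integral12_prod_meas1 idg) /=; apply: integral0_eq => t _.
  apply: (IH (fun x => g (rV_cons (t, x))) (fun x => dg (rV_cons (t, x))) j).
  - move=> x; apply/is_derive_line0.
    have /is_derive_line0 := hd (rV_cons (t, x)).
    rewrite (_ : (fun s => _) = (fun s : R => g (rV_cons (t, s *: delta_mx ord0 j + x)))) //.
    by apply/funext => s; rewrite rV_cons_line ij.
  - split; first by move=> x; apply: continuous_comp; [exact: rV_cons_continuous_snd|exact: cg.1].
    case: cg => _ [M hM]; exists M => x k xk; apply: (hM _ (lift ord0 k)).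
    by rewrite rV_consS.
  - split; first by move=> x; apply: continuous_comp; [exact: rV_cons_continuous_snd|exact: cdg.1].
    case: cdg => _ [M hM]; exists M => x k xk; apply: (hM _ (lift ord0 k)).
    by rewrite rV_consS.
rewrite -(integral21_prod_meas1 idg) /=; apply: integral0_eq => x _.
have [M [M0 _ out]] := ccsupp_box cg; have [M' [M0' _ out']] := ccsupp_box cdg.
have cs : continuous (fun t => dg (rV_cons (t, x))).
  by move=> t; apply: continuous_comp; [exact: rV_cons_continuous_fst|exact: cdg.1].
have vg : vanish_outside (- M) M (fun t => g (rV_cons (t, x))).
  move=> t ht; apply: out => /(_ ord0); rewrite rV_cons0 => /andP[h1 h2].
  by case/orP: ht; rewrite ltNge ?h1 ?h2.
have vdg : vanish_outside (- M') M' (fun t => dg (rV_cons (t, x))).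
  move=> t ht; apply: out' => /(_ ord0); rewrite rV_cons0 => /andP[h1 h2].
  by case/orP: ht; rewrite ltNge ?h1 ?h2.
have J0 : integral_line (fun t => dg (rV_cons (t, x))) = 0.
  apply: (integral_line_derive _ cs vg) => t.
  have := is_derive_line g (rV_cons (0, x)) (delta_mx ord0 i) t (dg (rV_cons (t, x))).
  rewrite {1}i0 -rV_cons_line0 addr0 => -[+ _] => /(_ (hd _)).
  rewrite (_ : (fun s => _) = (fun s : R => g (rV_cons (s, x)))) //.
  by apply/funext => s; rewrite i0 -rV_cons_line0 addr0.
have ints := vanish_outside_integrable cs vdg.
rewrite -[LHS]fineK; last exact: integrable_fin_num ints.
by rewrite [fine _]J0.
Qed.

End divergence.

(** * The Euclidean norm and test functions *)
Section euclidean.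
Variables (R : realType) (n : nat).
Implicit Types (x v : 'rV[R]_n) (f g : 'rV[R]_n -> R) (i j : 'I_n).

Lemma is_derive_bigsum (I : Type) (r : seq I) (F : I -> 'rV[R]_n -> R) (dF : I -> R) x v :
  (forall k, is_derive x v (F k) (dF k)) ->
  is_derive x v (fun y => \sum_(k <- r) F k y) (\sum_(k <- r) dF k).
Proof.
move=> h; elim: r => [|i r IH].
  rewrite big_nil (_ : (fun y => _) = cst 0); first exact: is_derive_cst.
  by apply/funext => y; rewrite big_nil.
rewrite big_cons (_ : (fun y => _) = (fun y => F i y + \sum_(j <- r) F j y)).
  exact: is_derive_add.
by apply/funext => y; rewrite big_cons.
Qed.

Lemma continuous_bigsum (I : Type) (r : seq I) (F : I -> 'rV[R]_n -> R) x :
  (forall k, {for x, continuous (F k)}) ->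
  {for x, continuous (fun y => \sum_(k <- r) F k y)}.
Proof.
move=> h; elim: r => [|i r IH].
  rewrite (_ : (fun y => _) = cst 0); first exact: cst_continuous.
  by apply/funext => y; rewrite big_nil.
rewrite (_ : (fun y => _) = (fun y => F i y + \sum_(j <- r) F j y)).
  by apply: continuousD.
by apply/funext => y; rewrite big_cons.
Qed.

Lemma is_derive_coord x i j :
  is_derive x (delta_mx ord0 i) (fun y : 'rV[R]_n => y ord0 j) (i == j)%:R.
Proof.
apply/is_derive_line0.
rewrite (_ : (fun t => _) = (fun t : R => t * (i == j)%:R + cst (x ord0 j) t)).
  have := is_derive_add (is_derive_mul (is_derive_id (0 : R) (1 : R))
    (is_derive_cst ((i == j)%:R : R) (0 : R) (1 : R))) (is_derive_cst (x ord0 j) (0 : R) (1 : R)).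
  by rewrite mul1r mulr0 !addr0.
by apply/funext => t; rewrite !mxE eqxx eq_sym.
Qed.

Lemma coord_cont i : continuous (fun x : 'rV[R]_n => x ord0 i).
Proof. exact: coord_continuous. Qed.

Lemma sum_sqr_ge0 x : 0 <= \sum_(i < n) x ord0 i ^+ 2.
Proof. by apply: sumr_ge0 => i _; exact: sqr_ge0. Qed.

Lemma enorm_sqr x : enorm x ^+ 2 = \sum_(i < n) x ord0 i ^+ 2.
Proof. by rewrite sqr_sqrtr // sum_sqr_ge0. Qed.

Lemma enorm_ge0 x : 0 <= enorm x. Proof. exact: sqrtr_ge0. Qed.

Lemma coord_le_enorm x i : `|x ord0 i| <= enorm x.
Proof.
rewrite -(@ler_pXn2r _ 2) ?nnegrE ?enorm_ge0 // enorm_sqr real_normK ?num_real //.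
by rewrite (bigD1 i) //= lerDl sumr_ge0 // => j _; exact: sqr_ge0.
Qed.

Lemma enorm0 : enorm (0 : 'rV[R]_n) = 0.
Proof. by rewrite /enorm big1 ?sqrtr0 // => i _; rewrite mxE expr0n. Qed.

Lemma enorm_eq0 x : enorm x = 0 -> x = 0.
Proof.
move=> x0; apply/rowP => i; rewrite mxE; apply/eqP; rewrite -normr_le0 -x0.
exact: coord_le_enorm.
Qed.

Lemma enorm_gt0 x : (0 < enorm x) = (x != 0).
Proof.
rewrite lt_neqAle enorm_ge0 andbT eq_sym; apply/idP/idP; apply: contra => /eqP.
  by move=> ->; rewrite enorm0.
by move/enorm_eq0 => ->.
Qed.

Lemma enorm_continuous : continuous (@enorm R n).
Proof.
move=> x; apply: (continuous_comp (f := fun y : 'rV[R]_n => \sum_(i < n) y ord0 i ^+ 2)).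
  apply: (continuous_bigsum (F := fun i (y : 'rV[R]_n) => y ord0 i ^+ 2)) => i.
  by apply: continuousM; exact: coord_cont.
exact: sqrt_continuous.
Qed.

Lemma is_derive_sum_sqr x i :
  is_derive x (delta_mx ord0 i) (fun y : 'rV[R]_n => \sum_(j < n) y ord0 j ^+ 2) (2 * x ord0 i).
Proof.
have := is_derive_bigsum (index_enum 'I_n)
  (fun j => is_derive_pow 2 (is_derive_coord x i j)).
rewrite (bigD1 i) //= eqxx mulr1 big1 ?addr0 // => j /negbTE.
by rewrite eq_sym => ->; rewrite mulr0.
Qed.

Lemma is_derive_enorm x i : x != 0 ->
  is_derive x (delta_mx ord0 i) (@enorm R n) (x ord0 i / enorm x).
Proof.
rewrite -enorm_gt0 => x0.
have s0 : 0 < \sum_(j < n) x ord0 j ^+ 2 by rewrite -enorm_sqr exprn_gt0.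
have := is_derive_comp (is_derive_sum_sqr x i) (is_derive1_sqrt s0).
move=> [h1 h2]; apply: DeriveDef => //; rewrite h2 -/(enorm x).
by field; rewrite gt_eqF.
Qed.

Lemma is_derive_radial x i (f : R -> R) df : x != 0 -> is_derive (enorm x) 1 f df ->
  is_derive x (delta_mx ord0 i) (fun y => f (enorm y)) (df * (x ord0 i / enorm x)).
Proof. by move=> x0 hf; exact: is_derive_comp (is_derive_enorm i x0) hf. Qed.

End euclidean.

Section test_functions.
Variables (R : realType) (n : nat) (rho : \bar R).
Implicit Types (x v : 'rV[R]_n) (f g u : 'rV[R]_n -> R) (i j : 'I_n) (K : set 'rV[R]_n).
Local Notation Om := (eball rho `\ (0 : 'rV[R]_n)).

Lemma OmP x : Om x <-> oitv0 rho (enorm x).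
Proof.
rewrite /oitv0 /eball; split=> -[] /=.
  by move=> xr x0; split => //; rewrite enorm_gt0; apply/eqP.
by rewrite enorm_gt0 => x0 xr; split => //; apply/eqP.
Qed.

Lemma Om_neq0 x : Om x -> x != 0.
Proof. by move=> /OmP[]; rewrite enorm_gt0. Qed.

Lemma near_off_closed K f x : closed K -> (forall y, ~ K y -> f y = 0) -> ~ K x ->
  \forall y \near x, f y = 0.
Proof.
move=> cK f0 nKx; have oC : open (~` K) by exact: closed_openC.
by apply: filterS (open_nbhs_nbhs (conj oC nKx)) => y; exact: f0.
Qed.

Lemma partial_off_closed K f i x : closed K -> (forall y, ~ K y -> f y = 0) -> ~ K x ->
  partial i f x = 0.
Proof.
move=> cK f0 nK; apply: derive_val; apply: (near_eq_is_derive (f := cst 0)).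
by apply: filterS (near_off_closed cK f0 nK) => y ->.
Qed.

Lemma continuous_patch K f : closed K -> K `<=` Om -> (forall x, ~ K x -> f x = 0) ->
  (forall x, Om x -> {for x, continuous f}) -> continuous f.
Proof.
move=> cK KO f0 cf x; have [Kx|nKx] := pselect (K x); first exact/cf/KO.
have := near_off_closed cK f0 nKx; rewrite /continuous_at f0 //.
exact: (@cvg_near_cst 'rV[R]_n R 0 f (nbhs x) _).
Qed.

Lemma is_derive_patch K f df v x : closed K -> K `<=` Om -> (forall x, ~ K x -> f x = 0) ->
  (forall x, ~ K x -> df x = 0) ->
  (forall x, Om x -> is_derive x v f (df x)) -> is_derive x v f (df x).
Proof.
move=> cK KO f0 df0 hf; have [Kx|nKx] := pselect (K x); first exact/hf/KO.
rewrite df0 //; apply: (near_eq_is_derive (f := cst 0)).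
by apply: filterS (near_off_closed cK f0 nKx) => y ->.
Qed.

Lemma ccsupp_compact K f : compact K -> (forall x, ~ K x -> f x = 0) -> continuous f -> ccsupp f.
Proof.
move=> cK f0 cf; split => //.
have cE : compact (@enorm R n @` K).
  by apply: continuous_compact => //; apply: continuous_subspaceT; exact: enorm_continuous.
have [M [_ hM]] := compact_bounded cE.
exists (`|M| + 1) => x i xM; apply: f0 => Kx.
have M1 : M < `|M| + 1 by rewrite ltr_pwDr // ler_norm.
have : `|enorm x| <= `|M| + 1 by apply: hM => //; exists x.
rewrite ger0_norm ?enorm_ge0 // => h1.
by have := lt_le_trans (lt_le_trans xM (coord_le_enorm x i)) h1; rewrite ltxx.
Qed.

Section one_test_function.
Variable u : 'rV[R]_n -> R.
Hypothesis hu : test_function Om u.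
Let K := closure [set x | u x != 0].

Lemma test_smooth : smooth u. Proof. by case: hu. Qed.
Lemma test_compact : compact K. Proof. by case: hu. Qed.
Lemma test_sub : K `<=` Om. Proof. by case: hu. Qed.
Lemma test_closed : closed K. Proof. exact: closed_closure. Qed.

Lemma test_off x : ~ K x -> u x = 0.
Proof.
by move=> nK; apply/eqP/negPn/negP => ux; apply: nK; exact: subset_closure.
Qed.

Lemma test_partial i x : is_derive x (delta_mx ord0 i) u (partial i u x).
Proof. by apply: derivableP; have [_] := test_smooth [::]; apply. Qed.

Lemma test_continuous : continuous u.
Proof. by have [] := test_smooth [::]. Qed.

Lemma test_ccsupp : ccsupp u.
Proof. exact: ccsupp_compact test_compact test_off test_continuous. Qed.

Lemma test_partial_off i x : ~ K x -> partial i u x = 0.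
Proof. exact: partial_off_closed test_closed test_off. Qed.

Lemma test_partial_test i : test_function Om (partial i u).
Proof.
have sub : [set x | partial i u x != 0] `<=` K.
  move=> x; apply: contraPP => nK; rewrite /= test_partial_off //; apply/negP.
  by rewrite eqxx.
have subK : closure [set x | partial i u x != 0] `<=` K.
  by move=> x /(closure_subset sub); have := (closure_id K).1 test_closed => <-.
split.
- move=> s; have := test_smooth (rcons s i); rewrite foldr_rcons.
  exact.
- exact: (subclosed_compact (@closed_closure _ _) test_compact).
- exact: subset_trans subK test_sub.
Qed.

End one_test_function.

End test_functions.

(** * Hardy and Rellich identities in R^n *)
Section hardy.
Variables (R : realType) (n : nat) (rho : \bar R).
Implicit Types (x v : 'rV[R]_n) (f g u : 'rV[R]_n -> R) (i j : 'I_n) (K : set 'rV[R]_n).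
Local Notation Om := (eball rho `\ (0 : 'rV[R]_n)).
Local Notation I := (oitv0 rho).
Local Notation mu := (lebesgue_rV R n).
Local Notation supp u := (closure [set x | u x != 0]).

Lemma integral_rV_partial i g dg : (forall x, is_derive x (delta_mx ord0 i) g (dg x)) ->
  ccsupp g -> ccsupp dg -> integral_rV dg = 0.
Proof. by move=> hd cg cdg; rewrite /integral_rV /Rintegral (integral_partial hd). Qed.

Lemma integral_eball g : ccsupp g -> (forall x, ~ eball rho x -> g x = 0) ->
  (\int[mu]_(x in eball rho) (g x)%:E = (integral_rV g)%:E)%E.
Proof.
move=> cg g0; rewrite -integral_rV_fin // integral_mkcond; apply: eq_integral => x _.
by rewrite patchE; case: ifPn => //; rewrite notin_setE => /g0 ->.
Qed.

Section weights.
Variable u : 'rV[R]_n -> R.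
Hypothesis hu : test_function Om u.

Lemma test_weight (q : R -> R) f : (forall r, I r -> {for r, continuous q}) ->
  (forall x, ~ supp u x -> f x = 0) -> continuous f -> ccsupp (fun x => q (enorm x) * f x).
Proof.
move=> cq f0 cf; have f0' x : ~ supp u x -> q (enorm x) * f x = 0 by move/f0 ->; rewrite mulr0.
apply: (ccsupp_compact (test_compact hu) f0').
apply: (continuous_patch (@test_closed _ _ u) (test_sub hu) f0') => x /OmP Ox.
apply: continuousM; last exact: cf.
by apply: continuous_comp; [exact: enorm_continuous|exact: cq].
Qed.

(** The pointwise inequality |grad u - k u x|^2 >= 0, integrated: the vector field
    u^2 k(|x|) x has zero total divergence, and the Riccati inequality for
    r k(r) = phi'/phi is what remains of the equation satisfied by phi. *)
Lemma hardy_riccati (k dk q : R -> R) :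
  (forall r, I r -> is_derive r 1 k (dk r)) ->
  (forall r, I r -> {for r, continuous dk}) ->
  (forall r, I r -> {for r, continuous q}) ->
  (forall r, I r -> r * dk r + n%:R * k r + r ^+ 2 * k r ^+ 2 + q r <= 0) ->
  integral_rV (fun x => q (enorm x) * u x ^+ 2) <=
  integral_rV (fun x => \sum_i partial i u x ^+ 2).
Proof.
move=> hk cdk cq ric.
have ck r : I r -> {for r, continuous k} by move=> Ir; exact: is_derive_continuous (hk r Ir).
have cu := test_continuous hu; have u0 := @test_off _ _ u.
have cpu i := test_continuous (test_partial_test hu i).
have cid i : continuous (fun x : 'rV[R]_n => x ord0 i) by exact: coord_cont.
have cdr r : I r -> {for r, continuous (fun s => dk s / s)}.
  move=> Ir; apply: continuousM; first exact: cdk.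
  by apply: continuousV; [case: Ir => r0 _; rewrite gt_eqF|exact: cvg_id].
pose F i x := k (enorm x) * (u x ^+ 2 * x ord0 i).
pose dF i x := dk (enorm x) / enorm x * (x ord0 i ^+ 2 * u x ^+ 2) +
  k (enorm x) * (u x ^+ 2 + 2 * u x * partial i u x * x ord0 i).
have sq_cont f : continuous f -> continuous (fun x => f x ^+ 2).
  by move=> cf x; apply: continuousM; exact: cf.
have mul_cont f g : continuous f -> continuous g -> continuous (fun x => f x * g x).
  by move=> cf cg x; apply: continuousM; [exact: cf|exact: cg].
have add_cont f g : continuous f -> continuous g -> continuous (fun x => f x + g x).
  by move=> cf cg x; apply: continuousD; [exact: cf|exact: cg].
have CF i : ccsupp (F i).
  apply: test_weight ck _ _; first by move=> x /u0 ->; rewrite expr0n mul0r.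
  by apply: mul_cont => //; exact: sq_cont.
have CdF i : ccsupp (dF i).
  apply: ccsuppD.
    apply: (test_weight (q := fun s => dk s / s)) => //.
      by move=> x /u0 ->; rewrite expr0n mulr0.
    by apply: mul_cont; exact: sq_cont.
  apply: (test_weight (f := fun x => u x ^+ 2 + 2 * u x * partial i u x * x ord0 i) ck).
    by move=> x /u0 ->; rewrite expr0n mulr0 !mul0r addr0.
  apply: (add_cont (fun x => u x ^+ 2)); first exact: sq_cont.
  apply: (mul_cont (fun x => 2 * u x * partial i u x)) => //.
  apply: (mul_cont (fun x => 2 * u x)) => //.
  by apply: (mul_cont (fun=> 2)) => //; exact: cst_continuous.
have dFE i x : is_derive x (delta_mx ord0 i) (F i) (dF i x).
  apply: (is_derive_patch (f := F i) (df := dF i) x (@test_closed _ _ u) (test_sub hu)).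
  - by move=> y /u0; rewrite /F => ->; rewrite expr0n mul0r mulr0.
  - by move=> y /u0; rewrite /dF => ->; rewrite expr0n !(mulr0, mul0r, addr0).
  move=> y Oy; have y0 := Om_neq0 Oy; have /OmP Iy := Oy.
  have := is_derive_mul (is_derive_radial i y0 (hk _ Iy))
    (is_derive_mul (is_derive_pow 2 (test_partial hu i y)) (is_derive_coord y i i)).
  move=> [h1 h2]; apply: DeriveDef => //; rewrite h2 eqxx /dF /=.
  have r0 : enorm y != 0 by rewrite gt_eqF // enorm_gt0.
  by field.
pose T x := \sum_i dF i x.
have CT : ccsupp T by exact: ccsupp_sum.
have T0 : integral_rV T = 0.
  rewrite integral_rV_sum // big1 // => i _.
  exact: integral_rV_partial (dFE i) (CF i) (CdF i).
have Cq : ccsupp (fun x => q (enorm x) * u x ^+ 2).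
  by apply: test_weight => //; [move=> x /u0 ->; rewrite expr0n|exact: sq_cont].
have CD : ccsupp (fun x => \sum_i partial i u x ^+ 2).
  apply: ccsupp_sum => i; apply: ccsupp_mul; first exact: cpu.
  exact: test_ccsupp (test_partial_test hu i).
rewrite -[leLHS]addr0 -[X in _ + X <= _]T0 -integral_rVD //; apply: integral_rV_le => //; first exact: ccsuppD.
move=> x; have [Kx|nKx] := pselect (supp u x); last first.
  rewrite (u0 x nKx) expr0n mulr0 add0r /T big1 => [|i _].
    by apply: sumr_ge0 => i _; exact: sqr_ge0.
  by rewrite /dF (u0 x nKx) expr0n !(mulr0, mul0r, addr0).
have /OmP Ix := test_sub hu Kx; have r0 : 0 < enorm x by case: Ix.
have := ric _ Ix; set r := enorm x in r0 *; set a := dk r; set b := k r; set c := q r.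
pose S := \sum_i x ord0 i * partial i u x.
have -> : T x = (r * a + n%:R * b) * u x ^+ 2 + 2 * b * u x * S.
  rewrite /T /dF -/r -/a -/b big_split /= -mulr_sumr -mulr_suml -enorm_sqr -/r.
  rewrite -mulr_sumr big_split /= sumr_const card_ord.
  rewrite (_ : \sum_(i < n) _ = 2 * u x * S); last first.
    by rewrite /S mulr_sumr; apply: eq_bigr => i _; ring.
  rewrite -mulr_natr; field; by rewrite gt_eqF.
have sq : 0 <= \sum_i (partial i u x - b * u x * x ord0 i) ^+ 2.
  by apply: sumr_ge0 => i _; exact: sqr_ge0.
have sqE : \sum_i (partial i u x - b * u x * x ord0 i) ^+ 2 =
    \sum_i partial i u x ^+ 2 - 2 * b * u x * S + b ^+ 2 * u x ^+ 2 * r ^+ 2.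
  rewrite /r enorm_sqr /S !mulr_sumr -sumrB -big_split /=; apply: eq_bigr => i _; ring.
rewrite sqE in sq; clear sqE; clearbody S.
move: sq; move: (\sum_i partial i u x ^+ 2) => D sq ric'.
have : (r * a + n%:R * b + r ^+ 2 * b ^+ 2 + c) * u x ^+ 2 <= 0 by rewrite mulr_le0_ge0 // sqr_ge0.
rewrite -subr_ge0 => h; rewrite -subr_ge0; apply: le_trans (addr_ge0 sq h) _.
by rewrite le_eqVlt; apply/orP; left; apply/eqP; ring.
Qed.

End weights.

Lemma rV_near_two i j x (h c d : R) : 0 < c < h -> 0 < d < h ->
  forall l, `|x ord0 l - (c *: delta_mx ord0 i + (d *: delta_mx ord0 j + x)) ord0 l| < 2 * h.
Proof.
move=> /andP[c0 ch] /andP[d0 dh] l; rewrite !mxE /=.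
case: (l == i); case: (l == j); rewrite ?mulr1 ?mulr0 ltr_norml; apply/andP; split; lra.
Qed.

(** The mean value theorem, once in each direction. *)
Lemma mixed_difference u i j x (h : R) : smooth u -> 0 < h ->
  exists c d, [/\ 0 < c < h, 0 < d < h &
    u (h *: delta_mx ord0 i + (h *: delta_mx ord0 j + x)) - u (h *: delta_mx ord0 i + x)
    - (u (h *: delta_mx ord0 j + x) - u x) =
    h ^+ 2 * partial j (partial i u) (c *: delta_mx ord0 i + (d *: delta_mx ord0 j + x))].
Proof.
move=> su h0.
have du y : is_derive y (delta_mx ord0 i) u (partial i u y).
  by apply: derivableP; have [_] := su [::]; apply.
have ddu y : is_derive y (delta_mx ord0 j) (partial i u) (partial j (partial i u) y).
  by apply: derivableP; have [_] := su [:: i]; apply.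
pose A s := u (s *: delta_mx ord0 i + (h *: delta_mx ord0 j + x)) - u (s *: delta_mx ord0 i + x).
pose dA s := partial i u (s *: delta_mx ord0 i + (h *: delta_mx ord0 j + x)) - partial i u (s *: delta_mx ord0 i + x).
have hA (s : R) : is_derive s 1 A (dA s).
  exact: is_derive_sub ((is_derive_line u _ _ _ _).1 (du _)) ((is_derive_line u _ _ _ _).1 (du _)).
have [c /andP[c0 ch] eA] := MVT_is_derive h0 (fun s _ => hA s).
pose B t := partial i u (t *: delta_mx ord0 j + (c *: delta_mx ord0 i + x)).
have hB (t : R) : is_derive t 1 B (partial j (partial i u) (t *: delta_mx ord0 j + (c *: delta_mx ord0 i + x))).
  exact: (is_derive_line (partial i u) _ _ _ _).1 (ddu _).
have [d /andP[d0 dh] eB] := MVT_is_derive h0 (fun t _ => hB t).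
exists c, d; split; [by rewrite c0|by rewrite d0|].
move: eA eB; rewrite /A /dA /B !scale0r !add0r !subr0 => ->.
rewrite (addrCA (h *: _)) => ->; rewrite (addrCA (d *: _)); ring.
Qed.

(** The second difference in the directions i and j is symmetric in i and j, and both
    mixed derivatives are limits of its quotient by h^2. *)
Lemma partial_comm u i j x : smooth u -> partial j (partial i u) x = partial i (partial j u) x.
Proof.
move=> su; apply/eqP; rewrite -subr_eq0 -normr_le0; apply/ler_addgt0Pr => e e0; rewrite add0r.
have e2 : 0 < e / 2 by rewrite divr_gt0.
have cont a b : exists2 d : R, 0 < d & forall y : 'rV[R]_n, (forall l, `|x ord0 l - y ord0 l| < d) ->
    `|partial a (partial b u) x - partial a (partial b u) y| < e / 2.
  have [c _] := su [:: a; b].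
  by have /cvgrPdist_lt/(_ _ e2)/rV_nbhsP := c x.
have [d1 d10 h1] := cont j i; have [d2 d20 h2] := cont i j.
pose h := Num.min d1 d2 / 2.
have h0 : 0 < h by rewrite divr_gt0 // lt_min d10.
have hd1 : 2 * h <= d1 by rewrite /h mulrC divfK // ge_min lexx.
have hd2 : 2 * h <= d2 by rewrite /h mulrC divfK // ge_min lexx orbT.
have [c [d [cb db E1]]] := mixed_difference i j x su h0.
have [c' [d' [cb' db' E2]]] := mixed_difference j i x su h0.
have E : partial j (partial i u) (c *: delta_mx ord0 i + (d *: delta_mx ord0 j + x)) =
    partial i (partial j u) (c' *: delta_mx ord0 j + (d' *: delta_mx ord0 i + x)).
  have hN0 : h ^+ 2 != 0 by rewrite expf_neq0 // gt_eqF.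
  apply: (mulfI hN0); apply: etrans (esym E1) _; apply: etrans _ E2.
  rewrite (addrCA (h *: delta_mx ord0 j) (h *: delta_mx ord0 i) x).
  by move: (u _) (u _) (u _) (u _) => a1 a2 a3 a4; ring.
have b1 := h1 _ (fun l => lt_le_trans (rV_near_two i j x cb db l) hd1).
have b2 := h2 _ (fun l => lt_le_trans (rV_near_two j i x cb' db' l) hd2).
rewrite E in b1; move: b1 b2; set p := partial j _ _; set q := partial i _ _; set m := partial i _ _.
move=> b1 b2; clear E E1 E2 h1 h2; clearbody p q m.
rewrite (_ : p - m = (p - q) - (m - q)); last by ring.
by apply: (le_trans (ler_normB _ _)); rewrite [leRHS]splitr; exact: lerD (ltW b1) (ltW b2).
Qed.

Section rellich.
Variable u : 'rV[R]_n -> R.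
Hypothesis hu : test_function Om u.

Lemma integral_parts f g i : test_function Om f -> test_function Om g ->
  integral_rV (fun x => partial i f x * g x) = - integral_rV (fun x => f x * partial i g x).
Proof.
move=> hf hg.
have C1 : ccsupp (fun x => partial i f x * g x).
  by apply: ccsupp_mul (test_ccsupp hg); exact: test_continuous (test_partial_test hf i).
have C2 : ccsupp (fun x => f x * partial i g x).
  by apply: ccsupp_mul (test_continuous hf) (test_ccsupp (test_partial_test hg i)).
apply/eqP; rewrite -addr_eq0 -integral_rVD //; apply/eqP.
apply: (@integral_rV_partial i (fun x => f x * g x)).
- by move=> x; exact: is_derive_mul (test_partial hf i x) (test_partial hg i x).
- exact: ccsupp_mul (test_continuous hf) (test_ccsupp hg).
- exact: ccsuppD.
Qed.

(** Two integrations by parts turn the product of the i-th and the j-th pure second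
    derivatives into the square of the mixed one. *)
Lemma integral_laplacian_sqr :
  integral_rV (fun x => laplacian u x ^+ 2) =
  integral_rV (fun x => \sum_i \sum_j partial j (partial i u) x ^+ 2).
Proof.
have hp i := test_partial_test hu i.
have hpp i j := test_partial_test (hp i) j.
have C i j k l : ccsupp (fun x => partial j (partial i u) x * partial l (partial k u) x).
  by apply: ccsupp_mul (test_continuous (hpp i j)) (test_ccsupp (hpp k l)).
rewrite (_ : (fun x => laplacian u x ^+ 2) = (fun x => \sum_i \sum_j
    partial i (partial i u) x * partial j (partial j u) x)); last first.
  apply/funext => x; rewrite expr2 /laplacian mulr_suml; apply: eq_bigr => i _.
  by rewrite mulr_sumr.
have Cs (F : 'I_n -> 'I_n -> 'rV[R]_n -> R) : (forall i j, ccsupp (F i j)) ->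
    integral_rV (fun x => \sum_i \sum_j F i j x) = \sum_i \sum_j integral_rV (F i j).
  move=> hF; rewrite integral_rV_sum; last by move=> i; exact: ccsupp_sum.
  by apply: eq_bigr => i _; rewrite integral_rV_sum.
have E1 := Cs (fun i j x => partial i (partial i u) x * partial j (partial j u) x) (fun i j => C i i j j).
have E2 := Cs (fun i j x => partial j (partial i u) x ^+ 2) (fun i j => C i j i j).
apply: etrans E1 _; apply: etrans _ (esym E2).
apply: eq_bigr => i _; apply: eq_bigr => j _.
have P1 := @integral_parts (partial i u) (partial j (partial j u)) i (hp i) (hpp j j).
have P2 := @integral_parts (partial i (partial j u)) (partial i u) j (hpp j i) (hp i).
have F : (fun x => partial i u x * partial i (partial j (partial j u)) x) =
    (fun x => partial j (partial i (partial j u)) x * partial i u x).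
  by apply/funext => x; rewrite mulrC (partial_comm j i x (test_smooth (hp j))).
have G : (fun x => partial i (partial j u) x * partial j (partial i u) x) =
    (fun x => partial j (partial i u) x ^+ 2).
  by apply/funext => x; rewrite expr2 (partial_comm j i x (test_smooth hu)).
exact: (etrans P1 (etrans (congr1 (fun f => - integral_rV f) F)
  (etrans (congr1 -%R P2) (etrans (opprK _) (congr1 (@integral_rV R n) G))))).
Qed.

End rellich.

End hardy.

(** * From Bessel pairs to inequalities in R^n *)
Section bessel_to_inequalities.
Variables (R : realType) (rho : \bar R) (W : R -> R).
Hypothesis sW : smooth_on (oitv0 rho) W.
Local Notation I := (oitv0 rho).

Let cW r : I r -> {for r, continuous W}.
Proof. by move=> Ir; exact: smooth_on_continuous sW Ir. Qed.

(** r k(r) = phi'/phi solves the Riccati equation of the Bessel pair. *)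
Lemma bessel_riccati n c : bessel_pair n.+1 rho (fun=> 1) (fun r => c * W r) ->
  exists k dk : R -> R, forall r, I r -> [/\ is_derive r 1 k (dk r), {for r, continuous dk} &
    r * dk r + n.+1%:R * k r + r ^+ 2 * k r ^+ 2 + c * W r = 0].
Proof.
move=> [_ [phi /= hphi]].
have oI : open I by exact: oitv0_open.
pose f1 := derive1 phi; pose f2 r := - (c * (W r * phi r)) - n%:R * (r^-1 * f1 r).
have pos r : I r -> 0 < r by case.
have d0 (r : R) : I r -> is_derive r 1 phi (f1 r).
  by move=> /hphi[_ h _ _]; exact: derivable_is_derive.
have d1 (r : R) : I r -> is_derive r 1 f1 (f2 r).
  move=> Ir; have [_ _ hflux e] := hphi r Ir; have r0 := pos r Ir.
  have dflux := derivable_is_derive hflux.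
  have xn0 : r ^+ n != 0 by rewrite expf_neq0 // gt_eqF.
  have dV := @is_derive_inv R R (fun y : R => y ^+ n) r 1 _ xn0 (is_derive_pow n (is_derive_id r (1 : R))).
  have h := is_derive_mul dflux dV.
  have {}h : is_derive r 1 f1 (derive1 (fun r0 : R => r0 ^+ n * 1 * derive1 phi r0) r * r ^- n +
      r ^+ n * 1 * derive1 phi r * (- (n%:R * r ^+ n.-1 * 1) / r ^+ n ^+ 2)).
    apply: (is_derive_open oI Ir _ h) => u Iu.
    by rewrite mulr1 mulrAC divff ?mul1r // expf_neq0 // gt_eqF // pos.
  move: h => [h1 h2]; apply: DeriveDef => //; rewrite h2.
  have -> : derive1 (fun r0 : R => r0 ^+ n * 1 * derive1 phi r0) r = - (r ^+ n * (c * W r) * phi r).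
    by apply/eqP; rewrite -addr_eq0 e.
  rewrite /f2 /f1; move: (derive1 phi r) (W r) (phi r) => p w f.
  case: (n) xn0 => [|j] xn0; first by rewrite !expr0 /=; field; rewrite gt_eqF.
  rewrite /= exprS; have xj : r ^+ j != 0 by rewrite expf_neq0 // gt_eqF.
  move: (r ^+ j) xj => X X0; field; by rewrite X0 gt_eqF.
have c0 r : I r -> {for r, continuous phi} by move=> Ir; exact: is_derive_continuous (d0 r Ir).
have c1 r : I r -> {for r, continuous f1} by move=> Ir; exact: is_derive_continuous (d1 r Ir).
have cM (f g : R -> R) r : {for r, continuous f} -> {for r, continuous g} -> {for r, continuous (fun x => f x * g x)}.
  by move=> cf cg; exact: continuousM.
have cV r : I r -> {for r, continuous (fun x : R => x^-1)}.
  by move=> Ir; apply: continuousV; [rewrite gt_eqF // pos|exact: cvg_id].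
have cc (a : R) r : {for r, continuous (fun _ : R => a)} by exact: cst_continuous.
have c2 r : I r -> {for r, continuous f2}.
  move=> Ir; apply: (@continuousB _ _ _ (fun r => - (c * (W r * phi r))) (fun r => n%:R * (r^-1 * f1 r))).
    by apply: continuousN; apply: (cM) => //; apply: (cM); [exact: cW|exact: c0].
  by apply: (cM) => //; apply: (cM); [exact: cV|exact: c1].
pose d r := r * phi r; pose dd r := 1 * phi r + r * f1 r.
have hd (r : R) : I r -> is_derive r 1 d (dd r).
  by move=> Ir; exact: is_derive_mul (is_derive_id r (1 : R)) (d0 r Ir).
have dN0 r : I r -> d r != 0.
  by move=> Ir; have [p0 _ _ _] := hphi r Ir; rewrite mulf_neq0 // gt_eqF // pos.
have cdd r : I r -> {for r, continuous dd}.
  move=> Ir; apply: (@continuousD _ _ _ (fun r => 1 * phi r) (fun r => r * f1 r)).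
    by apply: (cM) => //; exact: c0.
  by apply: (cM (fun r => r)); [exact: cvg_id|exact: c1].
have cd r : I r -> {for r, continuous d} by move=> Ir; exact: is_derive_continuous (hd r Ir).
exists (fun r => f1 r * (d r)^-1), (fun r => f2 r * (d r)^-1 + f1 r * (- dd r / d r ^+ 2)) => r Ir.
have cdV : {for r, continuous (fun r => (d r)^-1)}.
  by apply: continuousV; [exact: dN0|exact: cd].
split.
- exact: is_derive_mul (d1 r Ir) (is_derive_inv (dN0 r Ir) (hd r Ir)).
- apply: (@continuousD _ _ _ (fun r => f2 r * (d r)^-1) (fun r => f1 r * (- dd r / d r ^+ 2))).
    by apply: (cM) => //; exact: c2.
  apply: (cM); first exact: c1.
  apply: (cM (fun r => - dd r)); first by apply: continuousN; exact: cdd.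
  apply: continuousV; first by rewrite expf_neq0 // dN0.
  by apply: (cM); exact: cd.
- have r0 := pos r Ir; have [p0 _ _ _] := hphi r Ir.
  rewrite /f2 /dd /d; move: (f1 r) (phi r) (W r) p0 => a p w p0.
  rewrite -natr1; field; by rewrite !gt_eqF.
Qed.

Lemma hardy_of_bessel n c (u : 'rV[R]_n.+1 -> R) :
  bessel_pair n.+1 rho (fun=> 1) (fun r => c * W r) ->
  test_function (eball rho `\ (0 : 'rV[R]_n.+1)) u ->
  c * integral_rV (fun x => W (enorm x) * u x ^+ 2) <=
  integral_rV (fun x => \sum_i partial i u x ^+ 2).
Proof.
move=> /bessel_riccati[k [dk hk]] hu.
have CW : ccsupp (fun x => W (enorm x) * u x ^+ 2).
  apply: (test_weight hu) => //; first by move=> x /test_off ->; rewrite expr0n.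
  by move=> x; apply: continuousM; exact: (test_continuous hu).
rewrite -integral_rVZ //.
rewrite (_ : (fun x => c * _) = (fun x => (fun r => c * W r) (enorm x) * u x ^+ 2)); last first.
  by apply/funext => x; rewrite mulrA.
apply: (hardy_riccati hu (k := k) (dk := dk) (q := fun r => c * W r)).
- by move=> r /hk[].
- by move=> r /hk[].
- by move=> r Ir; apply: continuousM; [exact: cst_continuous|exact: cW].
- by move=> r /hk[_ _ ->].
Qed.

(** Lowering the dimension by two turns the Riccati solution k into k + 1/r^2 at
    the price of a term (n-1)/r^2; since squares are convex, this price is paid by
    averaging with the Riccati solution of Hardy's inequality, at the expense of
    the constant. *)
Lemma hardy_of_bessel_two_dims_up n c : (2 < n)%N -> 0 < c ->
  bessel_pair n.+2 rho (fun=> 1) (fun r => c * W r) ->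
  exists2 c' : R, 0 < c' & forall u : 'rV[R]_n -> R, test_function (eball rho `\ (0 : 'rV[R]_n)) u ->
  c' * integral_rV (fun x => W (enorm x) * u x ^+ 2) <=
  integral_rV (fun x => \sum_i partial i u x ^+ 2).
Proof.
move=> n2 c0 /bessel_riccati[k [dk hk]].
have N2 : 2 < n%:R :> R by rewrite ltr_nat.
(* k + 1/r^2 leaves (N - 1)/r^2 in the Riccati equation, and Hardy's solution
   - b/r^2 leaves - b^2/r^2; the weight th makes these cancel *)
set N : R := n%:R in N2 *; pose b := (N - 2) / 2; pose th := b ^+ 2 / (b ^+ 2 + (N - 1)).
have b0 : 0 < b by rewrite /b; lra.
have D0 : 0 < b ^+ 2 + (N - 1) by rewrite addr_gt0 ?exprn_gt0 //; lra.
have th0 : 0 < th by rewrite divr_gt0 // exprn_gt0.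
have th1 : th <= 1 by rewrite ler_pdivrMr // mul1r lerDl; lra.
have thE : th * (N - 1) = (1 - th) * b ^+ 2.
  by rewrite /th; field; rewrite gt_eqF.
exists (th * c) => [|u hu]; first exact: mulr_gt0.
have CW : ccsupp (fun x => W (enorm x) * u x ^+ 2).
  apply: (test_weight hu) => //; first by move=> x /test_off ->; rewrite expr0n.
  by move=> x; apply: continuousM; exact: (test_continuous hu).
rewrite -integral_rVZ //.
rewrite (_ : (fun x => th * c * _) = (fun x => (fun r => th * c * W r) (enorm x) * u x ^+ 2)); last first.
  by apply/funext => x; rewrite mulrA.
pose m := th - (1 - th) * b.
pose K r := th * k r + m * r ^- 2; pose dK r := th * dk r + m * (- (2 * r) / r ^+ 4).
have pos r : I r -> 0 < r by case.
apply: (hardy_riccati hu (k := K) (dk := dK) (q := fun r => th * c * W r)).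
- move=> r Ir; have r0 := pos r Ir; have [hdk _ _] := hk r Ir.
  have r2 : r ^+ 2 != 0 by rewrite expf_neq0 // gt_eqF.
  have dV := @is_derive_inv R R (fun y : R => y ^+ 2) r 1 _ r2 (is_derive_pow 2 (is_derive_id r (1 : R))).
  have := is_derive_add (is_derive_mul (is_derive_cst th r (1 : R)) hdk)
    (is_derive_mul (is_derive_cst m r (1 : R)) dV).
  move=> [h1 h2]; apply: DeriveDef => //; rewrite h2 /dK /cst /=; field; by rewrite gt_eqF.
- move=> r Ir; have r0 := pos r Ir; have [_ cdk _] := hk r Ir.
  apply: (@continuousD _ _ _ (fun r => th * dk r) (fun r => m * (- (2 * r) / r ^+ 4))).
    by apply: continuousM => //; exact: cst_continuous.
  apply: continuousM; first exact: cst_continuous.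
  have r4 : r ^+ 4 != 0 by rewrite expf_neq0 // gt_eqF.
  have s1 := is_derive_continuous (@is_derive_inv R R (fun y : R => y ^+ 4) r 1 _ r4 (is_derive_pow 4 (is_derive_id r (1 : R)))).
  have cM (f g : R -> R) w : {for w, continuous f} -> {for w, continuous g} -> {for w, continuous (fun x => f x * g x)}.
    by move=> cf cg; exact: continuousM.
  apply: (cM (fun r => - (2 * r)) (fun r => r ^- 4)) => //.
  by apply: continuousN; apply: continuousM; [exact: cst_continuous|exact: cvg_id].
- by move=> r Ir; apply: continuousM; [exact: cst_continuous|exact: cW].
- move=> r Ir; have r0 := pos r Ir; have [_ _ e] := hk r Ir.
  have e' : r * dk r + (N + 2) * k r + r ^+ 2 * k r ^+ 2 + c * W r = 0.
    by rewrite -e /N -[n.+2]addn2 natrD.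
  rewrite -/N /K /dK /m; move: (dk r) (k r) (W r) e' => a p w e'.
  have aE : r * a = - ((N + 2) * p + r ^+ 2 * p ^+ 2 + c * w) by lra.
  have -> : a = - ((N + 2) * p + r ^+ 2 * p ^+ 2 + c * w) / r.
    by rewrite -aE; field; rewrite gt_eqF.
  rewrite (_ : _ + _ = - (th * (1 - th) * (r * p + r^-1 + b * r^-1) ^+ 2) + (th * (N - 1) - (1 - th) * b ^+ 2) * r ^- 2).
    rewrite thE subrr mul0r addr0 oppr_le0; apply: mulr_ge0 (sqr_ge0 _).
    by apply: mulr_ge0; [exact: ltW|rewrite subr_ge0].
  rewrite /b; field; by rewrite gt_eqF.
Qed.

(** The inequality for the gradient follows from the scalar one, applied to each
    partial derivative, because the Laplacian and the Hessian have the same norm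
    in L^2. *)
Lemma rellich_of_bessel n c : (2 < n)%N -> 0 < c ->
  bessel_pair n.+2 rho (fun=> 1) (fun r => c * W r) ->
  exists2 c' : R, 0 < c' & forall u : 'rV[R]_n -> R, test_function (eball rho `\ (0 : 'rV[R]_n)) u ->
  c' * integral_rV (fun x => W (enorm x) * \sum_i partial i u x ^+ 2) <=
  integral_rV (fun x => laplacian u x ^+ 2).
Proof.
move=> n2 c0 hb; have [c' c'0 hc'] := hardy_of_bessel_two_dims_up n2 c0 hb.
exists c' => // u hu; rewrite (integral_laplacian_sqr hu).
have hp i := test_partial_test hu i.
have C1 i : ccsupp (fun x => W (enorm x) * partial i u x ^+ 2).
  apply: (test_weight (hp i)) => //; first by move=> x /test_off ->; rewrite expr0n.
  by move=> x; apply: continuousM; exact: (test_continuous (hp i)).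
have C2 i : ccsupp (fun x => \sum_j partial j (partial i u) x ^+ 2).
  apply: ccsupp_sum => j; have hpp := test_partial_test (hp i) j.
  exact: ccsupp_mul (test_continuous hpp) (test_ccsupp hpp).
rewrite integral_rV_sum // (_ : (fun x => W _ * _) = (fun x => \sum_i W (enorm x) * partial i u x ^+ 2)).
  by rewrite integral_rV_sum // mulr_sumr; apply: ler_sum => i _; exact: hc'.
by apply/funext => x; rewrite mulr_sumr.
Qed.

End bessel_to_inequalities.

(** * Radial functions *)
Section compact_primitive.
Variables (R : realType) (rho : \bar R).
Local Notation I := (oitv0 rho).

(** The antiderivative that vanishes on the left of the support of H is constant on
    the right of it, equal to the integral of H. *)
Lemma compact_primitive H : Cc rho H -> integral_line H = 0 ->
  exists P : R -> R, (forall x : R, is_derive x 1 P (H x)) /\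
    exists s t, [/\ I s, I t & vanish_outside s t P].
Proof.
move=> [cH [s [t [Is It hH]]]] JH.
have [|P0 dP0] := @antiderivative_exists R +oo%E H; first by move=> x _; exact: cH.
have s0 : 0 < s by case: Is.
have pinf x : 0 < x -> oitv0 (+oo%E : \bar R) x by move=> x0; split => //; rewrite ltry.
pose P x := if s <= x then P0 x - P0 s else 0.
have left0 x : 0 < x -> x <= s -> P0 x = P0 s.
  rewrite le_eqVlt => x0 /predU1P[->//|xs].
  have [y /andP[xy ys]] := MVT_is_derive xs (fun y h => dP0 y (pinf y (lt_le_trans x0 (andP h).1))).
  by rewrite hH ?ys // mul0r => /eqP; rewrite subr_eq0 => /eqP.
have PE x : 0 < x -> P x = P0 x - P0 s.
  by rewrite /P; case: ifPn => // + x0; rewrite -ltNge => /ltW/(left0 x x0) ->; rewrite subrr.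
have dP (x : R) : is_derive x 1 P (H x).
  have [x0|x0] := ltP 0 x.
    have := is_derive_sub (dP0 x (pinf x x0)) (is_derive_cst (P0 s) x (1 : R)).
    rewrite subr0; apply: is_derive_near; near=> y; rewrite PE //.
    by near: y; exact: lt_nbhsr.
  have xs : x < s by exact: le_lt_trans s0.
  rewrite hH ?xs //; apply: is_derive_near (is_derive_cst (0 : R) x (1 : R)).
  near=> y; rewrite /P ifF //; apply/negbTE; rewrite -ltNge.
  by near: y; exact: lt_nbhsl.
have [t' t'max It'] : exists2 t', Num.max s t < t' & I t' by apply: oitv0_gt; case: leP.
move: t'max; rewrite gt_max => /andP[st' tt'].
exists P; split => //; exists s, t'; split => // x /orP[xs|t'x].
  by rewrite /P ifF //; apply/negbTE; rewrite -ltNge.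
have Pt' : P t' = 0.
  have := is_derive_FTC2 st' dP cH.
  rewrite -(integral_line_itv (vanish_outsideW (lexx s) (ltW tt') hH)) JH.
  by rewrite {2}/P lexx subrr subr0 => <-.
rewrite -Pt'; apply/esym; apply: (@is_derive0_cst R P _ _ (ltW t'x)) => y /andP[t'y _].
by have := dP y; rewrite hH // (lt_le_trans tt' t'y) orbT.
Unshelve. all: by end_near. Qed.

End compact_primitive.

Section radial_functions.
Variables (R : realType) (n : nat) (rho : \bar R).
Implicit Types (x : 'rV[R]_n) (u : 'rV[R]_n -> R) (f df : R -> R).
Local Notation I := (oitv0 rho).
Local Notation Om := (eball rho `\ (0 : 'rV[R]_n)).

Lemma Cc_at0 F : Cc rho F -> F 0 = 0.
Proof. by move=> [_ [s [t [[s0 _] _ h]]]]; rewrite h // s0. Qed.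

Lemma ccsupp_radial F : Cc rho F -> ccsupp (fun x : 'rV[R]_n => F (enorm x)).
Proof.
move=> [cF [s [t [_ _ h]]]]; split.
  by move=> x; apply: continuous_comp; [exact: enorm_continuous|exact: cF].
exists t => x i txi; apply: h; apply/orP; right; exact: lt_le_trans txi (coord_le_enorm x i).
Qed.

Lemma is_derive_radial_supp f df x i : Cc rho f -> Cc rho df ->
  (forall r, I r -> is_derive r 1 f (df r)) ->
  is_derive x (delta_mx ord0 i) (fun y : 'rV[R]_n => f (enorm y)) ((enorm x)^-1 * df (enorm x) * x ord0 i).
Proof.
move=> [_ [s [t [Is It h]]]] Cdf hf.
have [Ix|nIx] := pselect (I (enorm x)).
  have x0 : x != 0 by rewrite -enorm_gt0; case: Ix.
  have := is_derive_radial i x0 (hf _ Ix).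
  by move=> [h1 h2]; apply: DeriveDef => //; rewrite h2; ring.
have out := oitv0_outside Is It nIx.
rewrite (Cc_off Cdf nIx) mulr0 mul0r.
have near0 : \forall y \near x, (cst 0 : 'rV[R]_n -> R) y = f (enorm y).
  have near1 : \forall y \near x, f (enorm y) = 0.
    exact: (enorm_continuous (vanish_outside_near h out)).
  by apply: filterS near1 => y fy; exact/esym.
exact: near_eq_is_derive near0 (is_derive_cst _ _ _).
Qed.

(** A class closed under partial derivatives, hence made of smooth functions. The
    singularity of |x| at 0 is harmless because the radial factors vanish near 0. *)
Inductive radial_poly : ('rV[R]_n -> R) -> Prop :=
| radial_poly_base f : test_line rho f -> radial_poly (fun x => f (enorm x))
| radial_poly_mul i u : radial_poly u -> radial_poly (fun x => x ord0 i * u x)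
| radial_poly_add u v : radial_poly u -> radial_poly v -> radial_poly (fun x => u x + v x).

Lemma test_line_invr f : test_line rho f -> test_line rho (fun r => r^-1 * f r).
Proof.
apply: test_line_mul; apply: (smooth_onV (f := fun r => r)).
- exact: oitv0_open.
- by move=> r [r0 _]; rewrite gt_eqF.
- by apply: smooth_on_id; exact: oitv0_open.
Qed.

Lemma radial_poly_continuous u : radial_poly u -> continuous u.
Proof.
elim=> [f hf|i v _ IH|v w _ IHv _ IHw].
- exact: (ccsupp_radial (test_line_Cc hf)).1.
- by move=> x; apply: continuousM; [exact: coord_cont|exact: IH].
- by move=> x; apply: continuousD; [exact: IHv|exact: IHw].
Qed.

Lemma radial_poly_partial u i : radial_poly u -> exists2 du, radial_poly du &
  forall x, is_derive x (delta_mx ord0 i) u (du x).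
Proof.
elim=> [f hf|j v hv [dv hdv IH]|v w hv [dv hdv IHv] hw [dw hdw IHw]].
- exists (fun x => x ord0 i * ((enorm x)^-1 * derive1 f (enorm x))).
    exact: (radial_poly_mul i (radial_poly_base (test_line_invr (test_line_derive1 hf)))).
  move=> x; rewrite mulrC; apply: is_derive_radial_supp.
  + exact: test_line_Cc.
  + exact/test_line_Cc/test_line_derive1.
  + by move=> r _; exact: test_line_is_derive hf.
- have [<-|ij] := eqVneq i j.
    exists (fun x => v x + x ord0 i * dv x); first exact: radial_poly_add hv (radial_poly_mul i hdv).
    move=> x; have := is_derive_mul (is_derive_coord x i i) (IH x).
    by rewrite eqxx mul1r.
  exists (fun x => x ord0 j * dv x); first exact: radial_poly_mul.
  move=> x; have := is_derive_mul (is_derive_coord x i j) (IH x).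
  by rewrite (negbTE ij) mul0r add0r.
- exists (fun x => dv x + dw x); first exact: radial_poly_add.
  by move=> x; exact: is_derive_add.
Qed.

Lemma radial_poly_foldr u s : radial_poly u -> radial_poly (foldr (@partial R n) u s).
Proof.
move=> hu; elim: s => //= i s IH; have [du hdu e] := radial_poly_partial i IH.
rewrite (_ : partial i _ = du) //; apply/funext => x.
by have [_ <-] := e x.
Qed.

Lemma radial_poly_smooth u : radial_poly u -> smooth u.
Proof.
move=> hu s; have hs := radial_poly_foldr s hu; split; first exact: radial_poly_continuous.
by move=> i x; have [du _ e] := radial_poly_partial i hs; have [] := e x.
Qed.

Lemma radial_test f : test_line rho f -> test_function Om (fun x : 'rV[R]_n => f (enorm x)).
Proof.
move=> hf; have [_ [s [t [Is It h]]]] := hf.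
pose A := [set x : 'rV[R]_n | s <= enorm x <= t].
have cA : closed A.
  rewrite (_ : A = @enorm R n @^-1` `[s, t]%classic).
    by apply: closed_comp => [x _|]; [exact: enorm_continuous|exact: itv_closed].
  by apply/seteqP; split=> x; rewrite /A /= in_itv.
have sub : closure [set x : 'rV[R]_n | f (enorm x) != 0] `<=` A.
  rewrite [X in _ `<=` X](closure_id A).1 //; apply: closure_subset => x /= fx.
  apply/negPn/negP => nA; move/negP: fx; apply; rewrite h //.
  by move: nA; rewrite negb_and -!ltNge.
have cptA : compact A.
  apply: (subclosed_compact cA (@compact_box R n (- t) t)) => x /andP[_ xt] i.
  by rewrite -ler_norml (le_trans (coord_le_enorm x i)).
split.
- exact/radial_poly_smooth/radial_poly_base.
- exact: (subclosed_compact (@closed_closure _ _) cptA).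
- by move=> x /sub /(oitv0_convex Is It) /OmP.
Qed.

Lemma partial_radial f i x : test_line rho f ->
  partial i (fun y : 'rV[R]_n => f (enorm y)) x = (enorm x)^-1 * derive1 f (enorm x) * x ord0 i.
Proof.
move=> hf; apply: derive_val; apply: is_derive_radial_supp.
- exact: test_line_Cc.
- exact/test_line_Cc/test_line_derive1.
- by move=> r _; exact: test_line_is_derive hf.
Qed.

(** The left-hand side integrates the divergence of the field g(|x|) x. *)
Lemma radial_divergence g dg : Cc rho g -> Cc rho dg ->
  (forall r, I r -> is_derive r 1 g (dg r)) ->
  integral_rV (fun x : 'rV[R]_n => enorm x * dg (enorm x) + n%:R * g (enorm x)) = 0.
Proof.
move=> Cg Cdg hg.
have CV : Cc rho (fun r => r^-1 * dg r).
  apply: Cc_mul => // r [r0 _]; apply: continuousV; [by rewrite gt_eqF|exact: cvg_id].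
pose F i x := g (enorm x) * x ord0 i.
pose dF i x := (enorm x)^-1 * dg (enorm x) * x ord0 i * x ord0 i + g (enorm x) * 1.
have mulC (f h : 'rV[R]_n -> R) : ccsupp f -> continuous h -> ccsupp (fun x => f x * h x).
  by move=> cf ch; under eq_fun do rewrite mulrC; exact: ccsupp_mul.
have CF i : ccsupp (F i) by apply: mulC; [exact: ccsupp_radial|exact: coord_cont].
have CdF i : ccsupp (dF i).
  apply: ccsuppD.
    by do 2! [apply: (mulC _ (fun x => x ord0 i)); last exact: coord_cont]; exact: (ccsupp_radial CV).
  by apply: mulC; [exact: ccsupp_radial|exact: cst_continuous].
have dFE i x : is_derive x (delta_mx ord0 i) (F i) (dF i x).
  have := is_derive_mul (is_derive_radial_supp x i Cg Cdg hg) (is_derive_coord x i i).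
  by rewrite eqxx.
rewrite (_ : (fun x => _) = (fun x => \sum_i dF i x)).
  by rewrite integral_rV_sum // big1 // => i _; exact: integral_rV_partial (dFE i) (CF i) (CdF i).
apply/funext => x; rewrite /dF big_split /= sumr_const card_ord mulr1 mulr_natl.
congr (_ + _); under eq_bigr do rewrite -mulrA -expr2.
rewrite -mulr_sumr -enorm_sqr; have [x0|x0] := eqVneq (enorm x) 0.
  by rewrite x0 (Cc_at0 Cdg) !mulr0 mul0r.
by field.
Qed.

End radial_functions.

(** * Polar coordinates and radial test functions *)
Section polar_coordinates.
Variables (R : realType) (n : nat).
Local Notation pinfty := (+oo%E : \bar R).
Local Notation J := (@integral_line R).

Let Ipinf r : 0 < r -> oitv0 pinfty r.
Proof. by move=> r0; split => //; rewrite ltry. Qed.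

Lemma Cc_pinfty rho (F : R -> R) : Cc rho F -> Cc pinfty F.
Proof.
by move=> [cF [s [t [[s0 _] [t0 _] h]]]]; split => //; exists s, t; split => //; exact: Ipinf.
Qed.

Let cX m x : oitv0 pinfty x -> {for x, continuous (fun r : R => r ^+ m)}.
Proof.
move=> Ix; have oI := oitv0_open (rho := pinfty).
exact: (smooth_on_continuous (smooth_onX oI (smooth_on_id oI)) Ix).
Qed.

(** A profile F with zero moment int F r^n dr is the divergence of a compactly
    supported radial field. *)
Lemma radial_integral0 F : Cc pinfty F -> J (fun r => r ^+ n * F r) = 0 ->
  integral_rV (fun x : 'rV[R]_n.+1 => F (enorm x)) = 0.
Proof.
move=> CF JF.
have CH : Cc pinfty (fun r => r ^+ n * F r) by apply: Cc_mul => // x; exact: cX.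
have [P [dP [s [t [Is It hP]]]]] := compact_primitive CH JF.
have CP : Cc pinfty P.
  by split; [move=> x; exact: is_derive_continuous (dP x)|exists s, t].
have cV m x : oitv0 pinfty x -> {for x, continuous (fun r : R => r ^- m)}.
  move=> [x0 _]; have xm : x ^+ m != 0 by rewrite expf_neq0 // gt_eqF.
  exact: is_derive_continuous (@is_derive_inv R R (fun y : R => y ^+ m) x 1 _ xm (is_derive_pow m (is_derive_id x (1 : R)))).
pose g r := r ^- n.+1 * P r; pose dg r := r^-1 * F r - n.+1%:R * (r ^- n.+2 * P r).
have Cg : Cc pinfty g by apply: Cc_mul => // x; exact: cV.
have Cdg : Cc pinfty dg.
  apply: CcB; last by apply: CcZ; apply: Cc_mul => // x; exact: cV.
  apply: Cc_mul => // r [r0 _]; apply: continuousV; [by rewrite gt_eqF|exact: cvg_id].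
have hg (r : R) : oitv0 pinfty r -> is_derive r 1 g (dg r).
  move=> [r0 _]; have rm : r ^+ n.+1 != 0 by rewrite expf_neq0 // gt_eqF.
  have := is_derive_mul (@is_derive_inv R R (fun y : R => y ^+ n.+1) r 1 _ rm (is_derive_pow n.+1 (is_derive_id r (1 : R)))) (dP r).
  move=> [h1 h2]; apply: DeriveDef => //; rewrite h2 /dg /=.
  have rn : r ^+ n != 0 by rewrite expf_neq0 // gt_eqF.
  rewrite !exprS; move: (r ^+ n) rn (F r) (P r) => X X0 f p.
  by field; rewrite X0 gt_eqF.
rewrite -(radial_divergence n.+1 Cg Cdg hg); congr integral_rV; apply/funext => x.
have [x0|x0] := eqVneq (enorm x) 0; first by rewrite x0 (Cc_at0 CF) (Cc_at0 Cg) mul0r mulr0 addr0.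
have xn : enorm x ^+ n != 0 by rewrite expf_neq0.
rewrite /g /dg !exprS; move: (enorm x ^+ n) (enorm x) xn x0 => X r X0 r0.
by move: (F r) (P r) (n.+1%:R : R) => f p a; field; rewrite X0 r0.
Qed.

(** Subtracting a multiple of one fixed profile B makes the moment of F vanish, so
    both sides are proportional to the moment of F. The constant K, which is the
    area of the unit sphere, does not depend on F; it is positive because the
    plateau B is 1 on the cube [1, 2]^(n+1). *)
Lemma polar_coordinates : exists2 K : R, 0 < K & forall rho (F : R -> R), Cc rho F ->
  integral_rV (fun x : 'rV[R]_n.+1 => F (enorm x)) = K * J (fun r => r ^+ n * F r).
Proof.
pose d : R := n.+1%:R; have d1 : 1 <= d by rewrite ler1n.
pose B := plateau (2^-1 : R) 1 (2 * d) (2 * d + 1).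
have h01 : 2^-1 < 1 :> R by lra.
have h10 : 2 * d < 2 * d + 1 by lra.
have CB : Cc pinfty B by apply/test_line_Cc/test_line_plateau => //; apply: Ipinf; lra.
have CnB : Cc pinfty (fun r => r ^+ n * B r) by apply: Cc_mul => // x; exact: cX.
have B0 x : 0 <= B x by exact: plateau_ge0.
have b0 : 0 < J (fun r => r ^+ n * B r).
  apply: (@lt_le_trans _ _ (1 * (2 * d - 1))); first by rewrite mul1r; lra.
  apply: (@integral_lb R pinfty) => //; first lra.
    move=> x; have [x0|x0] := ltP 0 x; first by rewrite mulr_ge0 // exprn_ge0 // ltW.
    by rewrite /B plateau0l ?mulr0 //; lra.
  by move=> x /andP[x1 x2]; rewrite /B plateau1 // mulr1 exprn_ege1.
set b := J _ in b0 *.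
have Bint : 0 < integral_rV (fun x : 'rV[R]_n.+1 => B (enorm x)).
  apply: (@lt_le_trans _ _ ((2 - 1) ^+ n.+1)); first by rewrite exprn_gt0 //; lra.
  apply: integral_rV_lb; [lra|exact: ccsupp_radial CB|by move=> x; exact: B0|].
  move=> x hx; rewrite /B plateau1 //.
    apply: le_trans (coord_le_enorm x ord0); have /andP[h _] := hx ord0.
    by rewrite ger0_norm //; lra.
  rewrite -(@ler_pXn2r _ 2) ?nnegrE ?enorm_ge0 //; last by lra.
  rewrite enorm_sqr; apply: (@le_trans _ _ (\sum_(i < n.+1) 4)).
    apply: ler_sum => i _; have /andP[h1 h2] := hx i.
    rewrite (_ : 4 = 2 ^+ 2); last by ring.
    by apply: lerXn2r => //; rewrite nnegrE; lra.
  rewrite sumr_const card_ord -[leLHS]mulr_natr -/d exprMn (_ : 2 ^+ 2 = 4); last by ring.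
  by apply: ler_wpM2l => //; rewrite expr2 ler_peMl //; lra.
exists (integral_rV (fun x : 'rV[R]_n.+1 => B (enorm x)) / b); first by rewrite divr_gt0.
move=> rho F /Cc_pinfty CF; have CnF : Cc pinfty (fun r => r ^+ n * F r).
  by apply: Cc_mul => // x; exact: cX.
pose a := J (fun r => r ^+ n * F r) / b.
have C0 : Cc pinfty (fun r => F r - a * B r) by apply: CcB => //; exact: CcZ.
have J0 : J (fun r => r ^+ n * (F r - a * B r)) = 0.
  rewrite (_ : (fun r => _) = (fun r => r ^+ n * F r - a * (r ^+ n * B r))).
    rewrite (integral_CcB CnF (CcZ _ CnB)) (integral_CcZ _ CnB) /a -/b divfK ?subrr //.
    by rewrite gt_eqF.
  by apply/funext => r; rewrite mulrBr mulrCA.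
have := radial_integral0 C0 J0.
rewrite integral_rVB; [|exact: ccsupp_radial CF|exact: ccsuppZ (ccsupp_radial _ CB)].
rewrite integral_rVZ; last exact: ccsupp_radial CB.
move/eqP; rewrite subr_eq0 => /eqP ->; rewrite /a.
by rewrite mulrAC [RHS]mulrAC [in RHS](mulrC (integral_rV _)).
Qed.

End polar_coordinates.

Section radial_to_line.
Variables (R : realType) (rho : \bar R) (W : R -> R).
Hypothesis sW : smooth_on (oitv0 rho) W.
Local Notation I := (oitv0 rho).
Local Notation J := (@integral_line R).

Let cW r : I r -> {for r, continuous W}.
Proof. by move=> Ir; exact: smooth_on_continuous sW Ir. Qed.

Let cX m x : I x -> {for x, continuous (fun r : R => r ^+ m)}.
Proof.
move=> Ix; have oI := oitv0_open (rho := rho).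
exact: (smooth_on_continuous (smooth_onX oI (smooth_on_id oI)) Ix).
Qed.

Lemma sum_sqr_radial n (a : R) (x : 'rV[R]_n) : \sum_i (a * x ord0 i) ^+ 2 = (a * enorm x) ^+ 2.
Proof. by under eq_bigr do rewrite exprMn; rewrite -mulr_sumr -enorm_sqr exprMn. Qed.

(** For u = v(|x|) the gradient has length |v'|, and polar coordinates apply. *)
Lemma line_form_of_radial_hardy n c :
  (forall u : 'rV[R]_n.+1 -> R, test_function (eball rho `\ (0 : 'rV[R]_n.+1)) u -> radial u ->
    c * integral_rV (fun x => W (enorm x) * u x ^+ 2) <=
    integral_rV (fun x => \sum_i partial i u x ^+ 2)) ->
  forall v, test_line rho v -> c * potential n W v <= energy n v.
Proof.
move=> hc v hv; have [K K0 polar] := polar_coordinates R n.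
have Cv := test_line_Cc hv; have Cv' := test_line_Cc (test_line_derive1 hv).
have CP : Cc rho (fun r => W r * v r ^+ 2) by apply: Cc_mul => //; exact: Cc_sqr.
have := hc _ (radial_test n.+1 hv) (ex_intro _ v (fun=> erefl)).
rewrite (polar rho (fun r => W r * v r ^+ 2) CP) -/(potential n W v).
rewrite (_ : (fun x => \sum_i _) = (fun x : 'rV[R]_n.+1 => derive1 v (enorm x) ^+ 2)); last first.
  apply/funext => x; under eq_bigr do rewrite (partial_radial _ _ hv).
  rewrite sum_sqr_radial; have [x0|x0] := eqVneq (enorm x) 0.
    by rewrite x0 mulr0 (Cc_at0 Cv').
  by congr (_ ^+ 2); field.
rewrite (polar rho (fun r => derive1 v r ^+ 2) (Cc_sqr Cv')) -/(energy n v).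
by rewrite mulrCA ler_pM2l.
Qed.

(** For u = U(|x|) with U' = r v(r), the gradient has length r|v| and the Laplacian
    is r v' + n v; a total derivative separates int |Lap u|^2 from the energy of v
    in two more dimensions. The function U has compact support away from the origin
    exactly when v has zero moment. *)
Lemma line_form_of_radial_rellich n c :
  (forall u : 'rV[R]_n.+1 -> R, test_function (eball rho `\ (0 : 'rV[R]_n.+1)) u -> radial u ->
    c * integral_rV (fun x => W (enorm x) * \sum_i partial i u x ^+ 2) <=
    integral_rV (fun x => laplacian u x ^+ 2)) ->
  forall v, test_line rho v -> moment v = 0 -> c * potential n.+2 W v <= energy n.+2 v.
Proof.
move=> hc v hv mv; have [K K0 polar] := polar_coordinates R n.
have Cv := test_line_Cc hv; have Cv' := test_line_Cc (test_line_derive1 hv).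
have hrv : test_line rho (fun r => r * v r).
  by apply: test_line_mul hv; apply: smooth_on_id; exact: oitv0_open.
have [U [dU [s [t [Is It hU]]]]] := compact_primitive (test_line_Cc hrv) mv.
have tU : test_line rho U.
  split; last by exists s, t.
  exact: smooth_on_antiderivative (@openT R) (fun x _ => dU x) hrv.1.
have dUE : derive1 U = fun r => r * v r by apply/funext => r; exact: is_derive1E.
pose u (x : 'rV[R]_n.+1) := U (enorm x).
have puE i : partial i u = fun x => v (enorm x) * x ord0 i.
  apply/funext => x; rewrite (partial_radial _ _ tU) dUE.
  have [x0|x0] := eqVneq (enorm x) 0; first by rewrite x0 (Cc_at0 Cv) !(mulr0, mul0r).
  by field.
have gradE x : \sum_i partial i u x ^+ 2 = enorm x ^+ 2 * v (enorm x) ^+ 2.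
  by under eq_bigr do rewrite puE; rewrite sum_sqr_radial exprMn mulrC.
have lapE x : laplacian u x = enorm x * derive1 v (enorm x) + n.+1%:R * v (enorm x).
  rewrite /laplacian.
  have e i : partial i (partial i u) x =
      (enorm x)^-1 * derive1 v (enorm x) * x ord0 i ^+ 2 + v (enorm x).
    rewrite puE; apply: derive_val.
    have := is_derive_mul (is_derive_radial_supp x i Cv Cv' (fun r _ => test_line_is_derive r hv))
      (is_derive_coord x i i).
    by rewrite eqxx mulr1 expr2 mulrA.
  rewrite (eq_bigr _ (fun i _ => e i)) big_split /= sumr_const card_ord mulr_natl.
  rewrite -mulr_sumr -enorm_sqr; congr (_ + _).
  have [x0|x0] := eqVneq (enorm x) 0; first by rewrite x0 (Cc_at0 Cv') !(mulr0, mul0r).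
  by field.
have CP : Cc rho (fun r => W r * (r ^+ 2 * v r ^+ 2)).
  by apply: Cc_mul => //; apply: Cc_mul; [exact: cX|exact: Cc_sqr].
have CL : Cc rho (fun r => r * derive1 v r + n.+1%:R * v r).
  by apply: CcD; [apply: Cc_mul => // x _; exact: cvg_id|exact: CcZ].
have := hc _ (radial_test n.+1 tU) (ex_intro _ U (fun=> erefl)).
rewrite -/u (_ : (fun x => W (enorm x) * _) = (fun x => W (enorm x) * (enorm x ^+ 2 * v (enorm x) ^+ 2))); last first.
  by apply/funext => x; rewrite gradE.
rewrite (polar rho (fun r => W r * (r ^+ 2 * v r ^+ 2)) CP).
rewrite (_ : (fun x => laplacian u x ^+ 2) = (fun x => (enorm x * derive1 v (enorm x) + n.+1%:R * v (enorm x)) ^+ 2)); last first.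
  by apply/funext => x; rewrite lapE.
rewrite (polar rho (fun r => (r * derive1 v r + n.+1%:R * v r) ^+ 2) (Cc_sqr CL)).
rewrite mulrCA ler_pM2l // => h.
have PE : J (fun r => r ^+ n * (W r * (r ^+ 2 * v r ^+ 2))) = potential n.+2 W v.
  by congr integral_line; apply/funext => r; rewrite !exprS; ring.
have EE : J (fun r => r ^+ n * (r * derive1 v r + n.+1%:R * v r) ^+ 2) = energy n.+2 v.
  have C1 : Cc rho (fun r => r ^+ n * (r * derive1 v r + n.+1%:R * v r) ^+ 2).
    by apply: Cc_mul; [exact: cX|exact: Cc_sqr].
  have C2 := Cc_energy n.+2 hv.
  apply/eqP; rewrite -subr_eq0 -(integral_CcB C1 C2); apply/eqP.
  have [_ [s' [t' [Is' It' h']]]] := hv.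
  apply: (@integral_derive R rho (fun r => n.+1%:R * (r ^+ n.+1 * v r ^+ 2)) _ s' t' Is' It').
  - by move=> x /h' ->; rewrite expr0n !mulr0.
  - exact: CcB.
  move=> x Ix; have := is_derive_mul (is_derive_cst (n.+1%:R : R) x (1 : R))
    (is_derive_mul (is_derive_pow n.+1 (is_derive_id x (1 : R))) (is_derive_pow 2 (test_line_is_derive x hv))).
  move=> [h1 h2]; apply: DeriveDef => //; rewrite h2 /cst /= !exprS.
  by move: (x ^+ n) (v x) (derive1 v x) (n.+1%:R : R) => X a b m; ring.
by move: h; rewrite PE EE.
Qed.

End radial_to_line.

(** * The equivalence *)
Section integrals_over_ball.
Variables (R : realType) (n : nat) (rho : \bar R) (W : R -> R) (u : 'rV[R]_n -> R).
Hypothesis sW : smooth_on (oitv0 rho) W.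
Hypothesis hu : test_function (eball rho `\ (0 : 'rV[R]_n)) u.
Local Notation mu := (lebesgue_rV R n).

Let cW r : oitv0 rho r -> {for r, continuous W}.
Proof. by move=> Ir; exact: smooth_on_continuous sW Ir. Qed.

Let off x : ~ eball rho x -> ~ closure [set x | u x != 0] x.
Proof. by move=> nx /(test_sub hu)[]. Qed.

Let u0 x : ~ eball rho x -> u x = 0.
Proof. by move/off/test_off. Qed.

Let pu0 i x : ~ eball rho x -> partial i u x = 0.
Proof. by move/off/test_partial_off. Qed.

Let gradE x : enorm (grad u x) ^+ 2 = \sum_i partial i u x ^+ 2.
Proof. by rewrite enorm_sqr; apply: eq_bigr => i _; rewrite mxE. Qed.

Let Cgrad : ccsupp (fun x => \sum_i partial i u x ^+ 2).
Proof.
apply: ccsupp_sum => i; have hp := test_partial_test hu i.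
exact: ccsupp_mul (test_continuous hp) (test_ccsupp hp).
Qed.

Lemma hardy_ballE c :
  (c%:E * \int[mu]_(x in eball rho) (W (enorm x) * `|u x| ^+ 2)%:E <=
     \int[mu]_(x in eball rho) (enorm (grad u x) ^+ 2)%:E)%E =
  (c * integral_rV (fun x => W (enorm x) * u x ^+ 2) <=
     integral_rV (fun x => \sum_i partial i u x ^+ 2)).
Proof.
under eq_integral do rewrite real_normK ?num_real //.
under [X in (_ <= X)%E]eq_integral do rewrite gradE.
rewrite !integral_eball ?lee_fin //.
- by move=> x nx; rewrite big1 // => i _; rewrite pu0 // expr0n.
- apply: (test_weight hu cW) => [x /test_off ->|]; first by rewrite expr0n.
  by move=> x; apply: continuousM; exact: test_continuous hu _.
- by move=> x /u0 ->; rewrite expr0n mulr0.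
Qed.

Lemma rellich_ballE c :
  (c%:E * \int[mu]_(x in eball rho) (W (enorm x) * enorm (grad u x) ^+ 2)%:E <=
     \int[mu]_(x in eball rho) (`|laplacian u x| ^+ 2)%:E)%E =
  (c * integral_rV (fun x => W (enorm x) * \sum_i partial i u x ^+ 2) <=
     integral_rV (fun x => laplacian u x ^+ 2)).
Proof.
under eq_integral do rewrite gradE.
under [X in (_ <= X)%E]eq_integral do rewrite real_normK ?num_real //.
have hpp i := test_partial_test (test_partial_test hu i) i.
have CL : ccsupp (laplacian u) by apply: ccsupp_sum => i; exact: test_ccsupp (hpp i).
rewrite !integral_eball ?lee_fin //.
- exact: ccsupp_mul CL.1 CL.
- move=> x /off nx; rewrite /laplacian big1 ?expr0n // => i _.
  have off1 y : ~ closure [set x | u x != 0] y -> partial i u y = 0.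
    exact: test_partial_off.
  exact: (partial_off_closed i (@test_closed _ _ u) off1 nx).
- apply: (test_weight hu cW) => [x nx|]; last exact: Cgrad.1.
  by rewrite big1 // => i _; rewrite test_partial_off // expr0n.
- by move=> x nx; rewrite big1 ?mulr0 // => i _; rewrite pu0 // expr0n.
Qed.

End integrals_over_ball.

Unset Implicit Arguments.

Theorem theorem1p12 (R : realType) (N : nat) (rho : \bar R) (W2 : R -> R)
    (hN : (5 <= N)%N) (hrho : (0 < rho)%E) (hW2 : smooth_on (oitv0 rho) W2) :
  [<-> exists2 c : R, 0 < c & forall u : 'rV[R]_N -> R,
         test_function (eball rho `\ 0) u ->
         (\int[lebesgue_rV R N]_(x in eball rho) (`|laplacian u x| ^+ 2)%:E >=
          c%:E * \int[lebesgue_rV R N]_(x in eball rho)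
                   (W2 (enorm x) * enorm (grad u x) ^+ 2)%:E)%E;
       exists2 c : R, 0 < c & forall u : 'rV[R]_N -> R,
         test_function (eball rho `\ 0) u -> radial u ->
         (\int[lebesgue_rV R N]_(x in eball rho) (`|laplacian u x| ^+ 2)%:E >=
          c%:E * \int[lebesgue_rV R N]_(x in eball rho)
                   (W2 (enorm x) * enorm (grad u x) ^+ 2)%:E)%E;
       exists2 c : R, 0 < c & forall u : 'rV[R]_N.+2 -> R,
         test_function (eball rho `\ 0) u ->
         (\int[lebesgue_rV R N.+2]_(x in eball rho)
             (enorm (grad u x) ^+ 2)%:E >=
          c%:E * \int[lebesgue_rV R N.+2]_(x in eball rho)
                   (W2 (enorm x) * `|u x| ^+ 2)%:E)%E;
       exists2 c : R, 0 < c & forall u : 'rV[R]_N.+2 -> R,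
         test_function (eball rho `\ 0) u -> radial u ->
         (\int[lebesgue_rV R N.+2]_(x in eball rho)
             (enorm (grad u x) ^+ 2)%:E >=
          c%:E * \int[lebesgue_rV R N.+2]_(x in eball rho)
                   (W2 (enorm x) * `|u x| ^+ 2)%:E)%E;
       exists2 c : R, 0 < c &
         bessel_pair N.+2 rho (fun=> 1) (fun r => c * W2 r)].
Proof.
tfae.
- by move=> [c c0 hc]; exists c => // u hu _; exact: hc.
- move=> [c c0 hc]; case: N hN hc => [//|n] hN hc.
  have line : forall v, test_line rho v -> moment v = 0 ->
      c * potential n.+2 W2 v <= energy n.+2 v.
    apply: (line_form_of_radial_rellich hW2) => u hu ru.
    by rewrite -(rellich_ballE hW2 hu); exact: hc.
  have [c' c'0 line'] := unconstrain hrho hW2 c0 line.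
  have bp := line_form_bessel_pair hrho hW2 c'0 line'.
  exists (c' / 2) => [|u hu]; first by rewrite divr_gt0.
  by rewrite (hardy_ballE hW2 hu); exact: (hardy_of_bessel hW2 bp hu).
- by move=> [c c0 hc]; exists c => // u hu _; exact: hc.
- move=> [c c0 hc]; exists (c / 2); first by rewrite divr_gt0.
  apply: line_form_bessel_pair => //; apply: (line_form_of_radial_hardy hW2) => u hu ru.
  by rewrite -(hardy_ballE hW2 hu); exact: hc.
- move=> [c c0 bp]; have n2 : (2 < N)%N by exact: leq_trans hN.
  have [c' c'0 hc'] := rellich_of_bessel hW2 n2 c0 bp.
  exists c' => // u hu; rewrite (rellich_ballE hW2 hu); exact: hc'.
Qed.
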